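(* Let $q\ge 2$, let $A$ be a $q\times q$ matrix with entries in $\{0,1\}$ such that $A^M>0$ (all entries positive) for some integer $M\ge 1$, let $\theta\in(0,1)$, and let $f\in\mathcal{F}_\theta(\Sigma_A^+)$ be real-valued. Put $$b=\max\{1,|f|_\theta\},\quad B=\frac{e^{\frac{2\theta}{1-\theta}}\,q^{M+1}e^{2(M+1)|f|_\infty}}{1-\theta},\quad r_0=\frac{\log q+2|f|_\infty}{|\log\theta|},\quad K=B\,b^{r_0}.$$ Then the following hold. (a) There exist a unique $\lambda>0$, a Borel probability measure $\nu$ on $\Sigma_A^+$ and a positive function $h\in\mathcal{F}_\theta(\Sigma_A^+)$ such that $L_f^*\nu=\lambda\nu$, $L_fh=\lambda h$ and $\int h\,d\nu=1$. The spectral radius of $L_f$ as an operator on $\mathcal{F}_\theta(\Sigma_A^+)$ is $\lambda$, and its essential spectral radius is $\theta\lambda$. The eigenfunction $h$ satisfies $$\frac1K\le h\le K,\qquad |h|_\theta\le B\,b\,K.$$ (b) The probability measure $\hat\nu=h\,\nu$ is $\sigma$-invariant. (c) $\mathrm{spec}_\theta(L_f)\cap\{z\in\mathbb{C}:|z|=\lambda\}=\{\lambda\}$. Moreover, $\lambda$ is a simple eigenvalue of $L_f$, and every $z\in\mathrm{spec}_\theta(L_f)$ with $|z|<\lambda$ satisfies $|z|\le\rho\,\lambda$, where $$\rho=1-\frac{1-\theta}{8K^3}\in(0,1).$$ (d) For every $g\in\mathcal{F}_\theta(\Sigma_A^+)$ and every integer $n\ge 0$, $$\left\|L_f^n g-\lambda^n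 h\int g\,d\nu\right\|_\theta\le D_f\,\lambda^n\rho^n\,\|g\|_\theta,\qquad\text{where } D_f=\frac{100\,K^5\,b^3}{1-\theta}.$$
   Context: $\Sigma_A^+=\{\xi=(\xi_0,\xi_1,\ldots):1\le\xi_i\le q,\ A(\xi_i,\xi_{i+1})=1\text{ for all }i\ge0\}$ with the product topology, and $\sigma:\Sigma_A^+\to\Sigma_A^+$ is the shift $(\sigma\xi)_i=\xi_{i+1}$. $C(\Sigma_A^+)$ is the space of continuous functions $g:\Sigma_A^+\to\mathbb{R}$. For $g:\Sigma_A^+\to\mathbb{R}$ put $$\mathrm{var}_k g=\sup\{|g(\xi)-g(\eta)|:\xi_i=\eta_i,\ 0\le i\le k\},\quad |g|_\theta=\sup_{k\ge0}\frac{\mathrm{var}_kg}{\theta^k},\quad |g|_\infty=\sup_{\xi}|g(\xi)|,\quad \|g\|_\theta=|g|_\theta+|g|_\infty.$$ $\mathcal{F}_\theta(\Sigma_A^+)$ is the space of all functions $g$ on $\Sigma_A^+$ with $\|g\|_\theta<\infty$, with norm $\|\cdot\|_\theta$. The Ruelle transfer operator of $f$ is $(L_fg)(x)=\sum_{\sigma(y)=x}e^{f(y)}g(y)$; it acts on $C(\Sigma_A^+)$ and on $\mathcal{F}_\theta(\Sigma_A^+)$. $L_f^*\nu=\lambda\nu$ means $\int L_fg\,d\nu=\lambda\int g\,d\nu$ for all $g\in C(\Sigma_A^+)$. $\mathrm{spec}_\theta(L_f)$ is the spectrum of $L_f:\mathcal{F}_\theta(\Sigma_A^+)\to\mathcal{F}_\theta(\Sigma_A^+)$;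 spectral notions refer to the complexification of this operator. $h\nu$ denotes the measure with density $h$ with respect to $\nu$. *)

(* Defs.v *)
From HB Require Import structures.
From mathcomp Require Import all_boot all_order all_algebra.
From mathcomp Require Import all_classical all_reals all_analysis.
From mathcomp Require Export complex.
Import numFieldNormedType.Exports.
Import Order.TTheory GRing.Theory Num.Theory.

Set Implicit Arguments.
Unset Strict Implicit.
Unset Printing Implicit Defensive.

Local Open Scope classical_set_scope.
Local Open Scope ring_scope.

Section OneSidedShift.
Variables (q : nat) (A : 'M[nat]_q).

(* The symbols 1, ..., q are represented by the elements 0, ..., q-1 of 'I_q. *)
Definition full_shift : Type :=
  prod_topology (fun _ : nat => discrete_topology 'I_q).

HB.instance Definition _ := Choice.on full_shift.
HB.instance Definition _ := Topological.on full_shift.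

Definition admissible : set full_shift :=
  [set xi | forall i, A (xi i) (xi i.+1) = 1%N].

Definition SFT : Type := set_type admissible.

HB.instance Definition _ := Choice.on SFT.
HB.instance Definition _ := Topological.on SFT.

Definition coordinate (x : SFT) (i : nat) : 'I_q := set_val x i.

Lemma shift_admissible (x : SFT) :
  (fun i => coordinate x i.+1) \in admissible.
Proof. by apply/mem_set => i; exact: (set_valP x i.+1). Qed.

Definition sft_shift (x : SFT) : SFT :=
  exist _ (fun i => coordinate x i.+1) (shift_admissible x).

Lemma sft_point (M : nat) : (2 <= q)%N ->
    (forall i j, A i j = 0%N \/ A i j = 1%N) ->
    (1 <= M)%N -> (forall i j, (0 < (A ^+ M) i j)%N) -> SFT.
Proof.
move=> q2 A01 M1 AM.
have next i : exists j, A i j = 1%N.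
  apply: contrapT => /forallNP h; have := AM i i.
  case: M M1 {AM} => // n _; rewrite exprS mxE big1 // => k _.
  by case: (A01 i k) => [->|/h//]; rewrite mul0r.
have i0 : 'I_q by exact: Ordinal (ltnW q2).
pose s i := projT1 (cid (next i)).
have s_adm : (fun n => iter n s i0) \in admissible.
  by apply/mem_set => n /=; exact: projT2 (cid (next _)).
exact (exist _ (fun n => iter n s i0) s_adm).
Qed.

(* In the library a measurable space carries a base point; x0 serves that
   purpose only, and the sigma-algebra does not depend on it. *)
Definition borel_SFT (x0 : SFT) : Type := g_sigma_algebraType (@open SFT).

Section borel_instances.
Variable x0 : SFT.
HB.instance Definition _ := Choice.on (borel_SFT x0).
HB.instance Definition _ := isPointed.Build (borel_SFT x0) x0.
HB.instance Definition _ := @isMeasurable.Build (sigma_display (@open SFT))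
  (borel_SFT x0) <<s @open SFT >> (@sigma_algebra0 _ setT _)
  (fun B HB => eq_ind _ _ (@sigma_algebraCD _ setT _ B HB) _ (setTD B))
  (@sigma_algebra_bigcup _ setT _).
End borel_instances.

End OneSidedShift.

Section HolderNorms.
Variables (R : realType) (q : nat) (A : 'M[nat]_q).
(* V with absolute value md is either R with its absolute value or R[i] with
   the complex modulus. *)
Variables (V : zmodType) (md : V -> R) (theta : R).
Implicit Type g : SFT A -> V.
Local Open Scope ereal_scope.

Definition variation (k : nat) g : \bar R :=
  ereal_sup [set (md (g p.1 - g p.2)%R)%:E | p in
    [set p : SFT A * SFT A |
      forall i, (i <= k)%N -> coordinate p.1 i = coordinate p.2 i]].

Definition theta_seminorm g : \bar R :=
  ereal_sup [set variation k g * ((theta ^+ k)^-1)%:E | k in [set: nat]].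

Definition sup_norm g : \bar R :=
  ereal_sup [set (md (g x))%:E | x in [set: SFT A]].

Definition theta_norm g : \bar R := theta_seminorm g + sup_norm g.

Definition Ftheta : set (SFT A -> V) := [set g | theta_norm g < +oo].

End HolderNorms.

Definition rabs {R : realType} (x : R) : R := `|x|.
Definition cabs {R : realType} (z : R[i]) : R := complex.Re `|z|.

Section TransferOperator.
Variables (R : realType) (q : nat) (A : 'M[nat]_q) (f : SFT A -> R).

Definition transfer (g : SFT A -> R) : SFT A -> R :=
  fun x => \sum_(y \in [set y | sft_shift y = x]) expR (f y) * g y.

Definition complexify (T : (SFT A -> R) -> (SFT A -> R))
    (G : SFT A -> R[i]^o) : SFT A -> R[i]^o :=
  fun x => Complex (T (fun y => complex.Re (G y)) x)
                   (T (fun y => complex.Im (G y)) x).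

End TransferOperator.

(* The complexification of Ftheta is identified with the complex-valued
   functions of finite norm, where cabs replaces the absolute value. *)
Definition complex_Ftheta (R : realType) (q : nat) (A : 'M[nat]_q) (theta : R) :
  set (SFT A -> R[i]^o) := Ftheta (V := R[i]^o) cabs theta.

Definition complex_theta_norm (R : realType) (q : nat) (A : 'M[nat]_q)
    (theta : R) : (SFT A -> R[i]^o) -> \bar R :=
  theta_norm (V := R[i]^o) cabs theta.

(* Spectral notions for an operator T on the normed space E, given as a linear
   subspace of V on which the norm N is finite. *)
Section Spectrum.
Variables (R : realType) (V : lmodType R[i]).
Variables (E : set V) (N : V -> \bar R) (T : V -> V).

Definition pencil (z : R[i]) (u : V) : V := z *: u - T u.

Definition resolvent_set : set R[i] := [set z | exists S : V -> V,
  [/\ forall u, E u -> E (S u),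
      exists C : R, forall u, E u -> (N (S u) <= C%:E * N u)%E,
      forall u, E u -> S (pencil z u) = u &
      forall u, E u -> pencil z (S u) = u]].

Definition spectrum : set R[i] := ~` resolvent_set.

(* Finite-dimensional kernel and finite-codimensional range; for a bounded
   operator on a Banach space the range is then closed. *)
Definition fredholm (P : V -> V) : Prop :=
  (exists n (e : 'I_n -> V), forall u, E u -> P u = 0 ->
     exists c : 'I_n -> R[i], u = \sum_(i < n) c i *: e i) /\
  (exists n (e : 'I_n -> V), (forall i, E (e i)) /\ forall v, E v ->
     exists u (c : 'I_n -> R[i]), E u /\ v = P u + \sum_(i < n) c i *: e i).

Definition essential_spectrum : set R[i] := [set z | ~ fredholm (pencil z)].

Definition spectral_radius : \bar R :=
  ereal_sup [set (cabs z)%:E | z in spectrum].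

Definition essential_spectral_radius : \bar R :=
  ereal_sup [set (cabs z)%:E | z in essential_spectrum].

(* Algebraic simplicity: the generalized eigenspace is a line. *)
Definition simple_eigenvalue (z : R[i]) : Prop :=
  exists u0, [/\ E u0, u0 <> 0, T u0 = z *: u0 &
    forall n u, E u -> iter n (pencil z) u = 0 -> exists c, u = c *: u0].

End Spectrum.

Section RuellePerronFrobenius.
Variables (R : realType) (q : nat) (A : 'M[nat]_q) (x0 : SFT A).
Variables (theta : R) (f : SFT A -> R).

Definition dual_eigenmeasure (lambda : R) (nu : probability (borel_SFT x0) R) :=
  forall g : SFT A -> R, continuous g ->
    \int[nu]_x transfer f g x = lambda * \int[nu]_x g x.

Definition rpf_data (lambda : R) (nu : probability (borel_SFT x0) R)
    (h : SFT A -> R) : Prop :=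
  [/\ 0 < lambda,
      dual_eigenmeasure lambda nu,
      Ftheta rabs theta h /\ (forall x, 0 < h x),
      (forall x, transfer f h x = lambda * h x) &
      \int[nu]_x h x = 1].

Definition has_density (h : SFT A -> R)
    (nu mu : probability (borel_SFT x0) R) : Prop :=
  forall B : set (borel_SFT x0), measurable B ->
    mu B = (\int[nu]_(x in B) (h x)%:E)%E.

Definition shift_invariant (mu : probability (borel_SFT x0) R) : Prop :=
  forall B : set (borel_SFT x0), measurable B ->
    mu (@sft_shift q A @^-1` B) = mu B.

End RuellePerronFrobenius.

(* Main.v *)
Require Import Defs.
From HB Require Import structures.
From mathcomp Require Import all_boot all_order all_algebra.
From mathcomp Require Import all_classical all_reals all_analysis.
From mathcomp Require Import measurable_realfun.
From mathcomp Require Import ring lra.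
Import numFieldNormedType.Exports.
Import Order.TTheory GRing.Theory Num.Theory.
Local Open Scope classical_set_scope.
Local Open Scope ring_scope.
Set Implicit Arguments.
Unset Strict Implicit.
Unset Printing Implicit Defensive.

(* The cones of positive functions g with g x <= exp (a theta^k) g y whenever x
   and y share the coordinates 0, ..., k are mapped into themselves by L_f, and
   N = m + M iterations, with b theta^m <= 1, bring the values of any cone element
   within the Harnack constant of each other. Hence the ratios L^n g / L^n 1
   converge geometrically to a number nu(g), the functional nu is represented by a
   probability measure because SFT A is compact, h is the limit of
   lambda^-n L^n 1, and subtracting c nu(g) from lambda^-N L^N g leaves it in the
   cone: this contraction by 1 - c, with c = N (1 - rho), is the spectral gap.
   The resolvents are Neumann series for L - lambda nu h (spectrum) and for
   L^n (1 - P_n), where P_n freezes all coordinates beyond n (essential spectrum,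
   outside the disc of radius theta lambda). Inside that disc the kernel of
   t - L is infinite dimensional: an element w of the kernel of L gives the
   eigenfunction (1 - (t / lambda) U)^-1 w, where U is the weighted composition
   with the shift, a right inverse of L / lambda. *)

(** * Words and the transfer operator *)

(** All constants of the statement are explicit, so the gap comes from inequalities between values
    of cone functions; compactness serves only measures and continuous functions. Two slopes occur:
    the solution of a0 = theta (a0 + b) + b, which leaves a margin b for subtracting from an image,
    and that of a = theta (a + b), which is smaller and gives the bounds of h. The factor b^r0 of K
    is the price of bringing the distortion below 1: this takes m, about log b / |log theta|, steps,
    each costing a factor q e^(2F) with F the sup norm of f, and r0 = log (q e^(2F)) / |log theta|.
    The loss c occurs once in N steps, and Bernoulli's inequality 1 - c <= rho^N spreads it over
    single steps. Functions are real wherever order is used; complex ones appear only for spectra,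
    through real and imaginary parts. *)

Section Words.
Variables (q : nat) (A : 'M[nat]_q).
Implicit Types (x y z : SFT A) (i : 'I_q).

Lemma SFT_ext x y : (forall n, coordinate x n = coordinate y n) -> x = y.
Proof. by move=> xy; apply: val_inj; apply/funext => n; exact: xy. Qed.

Lemma coordinate_admissible x n : A (coordinate x n) (coordinate x n.+1) = 1%N.
Proof. exact: (set_valP x n). Qed.

Definition prepend_seq i x : full_shift q :=
  fun n => if n is n'.+1 then coordinate x n' else i.

Lemma prepend_admissible i x : A i (coordinate x 0) = 1%N ->
  prepend_seq i x \in admissible A.
Proof.
by move=> ix; apply/mem_set => -[|n] //=; exact: coordinate_admissible.
Qed.

(* The junk value is x itself when i cannot precede x. *)
Definition prepend i x : SFT A :=
  match pselect (A i (coordinate x 0) = 1%N) with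
  | left ix => exist _ (prepend_seq i x) (prepend_admissible ix)
  | right _ => x
  end.

Lemma prepend0 i x : A i (coordinate x 0) = 1%N ->
  coordinate (prepend i x) 0 = i.
Proof. by rewrite /prepend; case: pselect. Qed.

Lemma prependS i x n : A i (coordinate x 0) = 1%N ->
  coordinate (prepend i x) n.+1 = coordinate x n.
Proof. by rewrite /prepend; case: pselect. Qed.

Lemma sft_shiftE x n : coordinate (sft_shift x) n = coordinate x n.+1.
Proof. by []. Qed.

Lemma shift_prepend i x : A i (coordinate x 0) = 1%N ->
  sft_shift (prepend i x) = x.
Proof. by move=> ix; apply: SFT_ext => n; rewrite sft_shiftE prependS. Qed.

Lemma prepend_shift x : prepend (coordinate x 0) (sft_shift x) = x.
Proof.
have ix : A (coordinate x 0) (coordinate (sft_shift x) 0) = 1%N.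
  exact: coordinate_admissible.
by apply: SFT_ext => -[|n]; rewrite ?prepend0 ?prependS.
Qed.

Lemma iter_shiftE n x k :
  coordinate (iter n (@sft_shift q A) x) k = coordinate x (k + n).
Proof. by elim: n k => [|n IH] k; rewrite ?addn0// iterS sft_shiftE IH addSnnS. Qed.

Definition agree k x y :=
  forall n : nat, (n <= k)%N -> coordinate x n = coordinate y n.

Lemma agree_refl k x : agree k x x. Proof. by []. Qed.

Lemma agree_sym k x y : agree k x y -> agree k y x.
Proof. by move=> xy i ik; rewrite xy. Qed.

Lemma agree_trans k x y z : agree k x y -> agree k y z -> agree k x z.
Proof. by move=> xy yz i ik; rewrite xy// yz. Qed.

Lemma agree_le k l x y : (l <= k)%N -> agree k x y -> agree l x y.
Proof. by move=> lk xy i il; apply: xy; exact: leq_trans lk. Qed.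

Lemma agree_prepend k i x y : A i (coordinate x 0) = 1%N -> agree k x y ->
  agree k.+1 (prepend i x) (prepend i y).
Proof.
move=> ix xy; have iy : A i (coordinate y 0) = 1%N by rewrite -(xy 0%N).
by move=> [|n]; rewrite ?prepend0// !prependS//; exact: xy.
Qed.

Lemma agree_shift k x y : agree k.+1 x y -> agree k (sft_shift x) (sft_shift y).
Proof. by move=> xy i ik; rewrite !sft_shiftE; exact: xy. Qed.

Hypothesis hA : forall i j, A i j = 0%N \/ A i j = 1%N.

Lemma pow_gt0 n i j : (0 < (A ^+ n.+1) i j)%N ->
  exists k, A i k = 1%N /\ (0 < (A ^+ n) k j)%N.
Proof.
rewrite exprS mxE; apply: contraPP => /forallNP h.
rewrite big1 ?ltnn// => k _; have := h k.
case: (hA i k) => ->; first by rewrite mul0r.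
move=> h'; apply/eqP; rewrite mul1r eqn0Ngt; apply/negP => h2; exact: h'.
Qed.

(** A positive entry of A^n is an admissible word of n steps from i; [pow_gt0] peels off its
    letters, which are put in front of x one by one. *)
Lemma connect_pow n i x : (0 < (A ^+ n) i (coordinate x 0))%N ->
  exists z, coordinate z 0 = i /\ iter n (@sft_shift q A) z = x.
Proof.
elim: n i => [|n IH] i.
  rewrite expr0 mxE; case: eqP => [->|]//= _.
  by exists x.
move=> /pow_gt0[k [ik]] /IH[z [zk zx]].
have iz : A i (coordinate z 0) = 1%N by rewrite zk.
by exists (prepend i z); rewrite prepend0// iterSr shift_prepend.
Qed.

Lemma connect_prefix m y z : coordinate z 0 = coordinate y m ->
  exists z', agree m z' y /\ iter m (@sft_shift q A) z' = z.
Proof.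
elim: m y => [|m IH] y zy; first by exists z; split => // i; rewrite leqn0 => /eqP ->.
have [|z' [z'y z'z]] := IH (sft_shift y); first by rewrite zy sft_shiftE.
have iz : A (coordinate y 0) (coordinate z' 0) = 1%N.
  by rewrite z'y// sft_shiftE coordinate_admissible.
exists (prepend (coordinate y 0) z'); split; last by rewrite iterSr shift_prepend.
by rewrite -[y in agree _ _ y]prepend_shift; exact: agree_prepend.
Qed.

Variable M : nat.
Hypothesis hAM : forall i j, (0 < (A ^+ M) i j)%N.

(** The first m + 1 symbols of y, then a bridge of M steps supplied by the positivity of A^M, then
    x. *)
Lemma mixing m x y :
  exists z, agree m z y /\ iter (m + M) (@sft_shift q A) z = x.
Proof.
have [w [wy wx]] := connect_pow (hAM (coordinate y m) (coordinate x 0)).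
have [z [zy zw]] := connect_prefix wy.
by exists z; split => //; rewrite addnC iterD zw.
Qed.

(** If no symbol preceded x, a column of A would vanish, and with it the same column of A^M. *)
Lemma exists_preceding x : (0 < M)%N -> exists i, A i (coordinate x 0) = 1%N.
Proof.
case: M hAM => // n h _; have := h (coordinate x 0) (coordinate x 0).
rewrite exprSr mxE; apply: contraPP => /forallNP hn.
rewrite big1 ?ltnn// => k _; have := hn k.
by case: (hA k (coordinate x 0)) => ->//; rewrite mulr0.
Qed.

(** Otherwise every symbol has at most one predecessor, hence at most one ancestor M steps back,
    although by positivity of A^M all q >= 2 symbols are ancestors. The branching feeds the kernel
    of L in [kernel_family]. *)
Lemma exists_branching : (1 < q)%N ->
  exists i i' j, [/\ i != i', A i j = 1%N & A i' j = 1%N].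
Proof.
move=> q2; apply: contrapT => hn.
have inj i i' j : A i j = 1%N -> A i' j = 1%N -> i = i'.
  move=> ij i'j; apply: contrapT => /eqP ne; apply: hn.
  by exists i, i', j.
have pinj n i i' j : (0 < (A ^+ n) i j)%N -> (0 < (A ^+ n) i' j)%N -> i = i'.
  elim: n i i' => [|n IH] i i'.
    by rewrite expr0 !mxE; case: eqP => [->|]//; case: eqP => [->|].
  move=> /pow_gt0[k [ik kj]] /pow_gt0[k' [ik' k'j]].
  by move: ik ik'; rewrite (IH _ _ kj k'j); exact: inj.
have := pinj M (Ordinal (ltnW q2)) (Ordinal q2) (Ordinal q2) (hAM _ _) (hAM _ _).
by move/(congr1 val).
Qed.

End Words.

Section Transfer.
Variables (R : realType) (q : nat) (A : 'M[nat]_q) (f : SFT A -> R).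
Implicit Types (x y : SFT A) (g : SFT A -> R).

(** A preimage of x is determined by its first symbol, which makes the sum over the preimage set a
    finite sum over the symbols allowed before x. *)
Lemma transferE g x : transfer f g x =
  \sum_(i < q | A i (coordinate x 0) == 1%N)
    expR (f (prepend i x)) * g (prepend i x).
Proof.
pose P := [pred i : 'I_q | A i (coordinate x 0) == 1%N].
pose r := [seq prepend i x | i <- enum P].
have ur : uniq r.
  rewrite map_inj_in_uniq ?enum_uniq// => i j.
  rewrite !mem_enum => /eqP Pi /eqP Pj /(congr1 (@coordinate q A ^~ 0%N)).
  by rewrite !prepend0.
have sub y : y \in r <-> sft_shift y = x.
  split; first by case/mapP => i; rewrite mem_enum => /eqP ix ->; exact: shift_prepend.
  move=> yx; apply/mapP; exists (coordinate y 0); last by rewrite -yx prepend_shift.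
  by rewrite mem_enum inE -yx sft_shiftE coordinate_admissible.
rewrite /transfer (fsbigE _ _ ur); last 2 first.
- by move=> y /= /sub.
- by move=> y /= /sub ->.
rewrite big_map big_enum_cond; apply: eq_bigl => i /=.
rewrite unfold_in /=; apply/andb_idr => /eqP ix.
by apply/mem_set => /=; exact: shift_prepend.
Qed.

End Transfer.

(** * Norm bounds in real numbers *)

Section NormBounds.
Variables (R : realType) (q : nat) (A : 'M[nat]_q) (V : zmodType) (md : V -> R).
Variables (theta : R) (x0 : SFT A).
Hypotheses (theta_gt0 : 0 < theta) (md_ge0 : forall v, 0 <= md v).
Implicit Type g : SFT A -> V.

Definition sup_le t g := forall x, md (g x) <= t.
Definition lip_le s g :=
  forall k x y, agree k x y -> md (g x - g y) <= s * theta ^+ k.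

Lemma sup_norm_leP g t : (sup_norm md g <= t%:E)%E <-> sup_le t g.
Proof.
split=> [h x|h].
  by rewrite -lee_fin; apply: le_trans h; apply: ereal_sup_ubound; exists x.
by apply: ge_ereal_sup => _ [x _ <-]; rewrite lee_fin.
Qed.

Lemma theta_seminorm_leP g s :
  (theta_seminorm md theta g <= s%:E)%E <-> lip_le s g.
Proof.
split=> [h k x y xy|h].
  have tk : 0 < theta ^+ k by rewrite exprn_gt0.
  rewrite -ler_pdivrMr// -lee_fin EFinM; apply: le_trans h.
  apply: (@le_trans _ (\bar R) (Defs.variation md k g * ((theta ^+ k)^-1)%:E)%E).
    rewrite lee_wpmul2r ?lee_fin ?invr_ge0 ?(ltW tk)//.
    by apply: ereal_sup_ubound; exists (x, y).
  by apply: ereal_sup_ubound; exists k.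
apply: ge_ereal_sup => _ [k _ <-].
have tk : 0 < theta ^+ k by rewrite exprn_gt0.
apply: (@le_trans _ (\bar R) ((s * theta ^+ k)%:E * ((theta ^+ k)^-1)%:E)%E).
  rewrite lee_wpmul2r ?lee_fin ?invr_ge0 ?(ltW tk)//.
  by apply: ge_ereal_sup => _ [[x y] /= xy <-]; rewrite lee_fin; exact: h.
by rewrite -EFinM mulfK ?gt_eqF.
Qed.

Lemma theta_norm_le g s t : lip_le s g -> sup_le t g ->
  (theta_norm md theta g <= (s + t)%:E)%E.
Proof.
by move=> /theta_seminorm_leP hs /sup_norm_leP ht; rewrite EFinD; exact: leeD.
Qed.

Lemma Ftheta_intro g s t : lip_le s g -> sup_le t g -> Ftheta md theta g.
Proof.
by move=> hs ht; apply: le_lt_trans (theta_norm_le hs ht) _; rewrite ltry.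
Qed.

(** The point [x0] matters: over an empty space the supremum would be -oo. *)
Lemma sup_norm_ge0 g : (0 <= sup_norm md g)%E.
Proof.
apply: (@le_trans _ (\bar R) (md (g x0))%:E); first by rewrite lee_fin.
by apply: ereal_sup_ubound; exists x0.
Qed.

Lemma theta_seminorm_ge0 g : (0 <= theta_seminorm md theta g)%E.
Proof.
apply: (@le_trans _ (\bar R) (Defs.variation md 0 g * ((theta ^+ 0)^-1)%:E)%E).
  rewrite expr0 invr1 mule1.
  apply: (@le_trans _ (\bar R) (md (g x0 - g x0))%:E); first by rewrite lee_fin.
  by apply: ereal_sup_ubound; exists (x0, x0).
by apply: ereal_sup_ubound; exists 0%N.
Qed.

Lemma Ftheta_elim g : Ftheta md theta g -> exists s t,
  [/\ 0 <= s, 0 <= t, lip_le s g, sup_le t g &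
      [/\ theta_norm md theta g = (s + t)%:E,
          theta_seminorm md theta g = s%:E & sup_norm md g = t%:E]].
Proof.
rewrite /Ftheta /= /theta_norm.
have := theta_seminorm_ge0 g; have := sup_norm_ge0 g.
case Es: (theta_seminorm md theta g) => [s| |]//;
case Et: (sup_norm md g) => [t| |]//.
rewrite !lee_fin => t0 s0 _; exists s, t; split => //.
- by apply/theta_seminorm_leP; rewrite Es.
- by apply/sup_norm_leP; rewrite Et.
Qed.

End NormBounds.

(** * Cones and the Harnack inequality *)

(** The tangent bound 1 + t <= exp t at the intermediate point z, averaged with weights 1 - r and
    r. *)
Lemma expR_convex (R : realType) (r x y : R) : 0 <= r <= 1 ->
  expR ((1 - r) * x + r * y) <= (1 - r) * expR x + r * expR y.
Proof.
move=> /andP[r0 r1]; set z := _ + _.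
have ez : 0 < expR z by exact: expR_gt0.
have -> : expR x = expR z * expR (x - z) by rewrite -expRD addrC subrK.
have -> : expR y = expR z * expR (y - z) by rewrite -expRD addrC subrK.
have hx := expR_ge1Dx (x - z); have hy := expR_ge1Dx (y - z).
have h : 1 <= (1 - r) * expR (x - z) + r * expR (y - z).
  apply: (@le_trans _ _ ((1 - r) * (1 + (x - z)) + r * (1 + (y - z)))).
    by rewrite /z; lra.
  by apply: lerD; apply: ler_wpM2l; rewrite // subr_ge0.
by rewrite mulrCA [r * _]mulrCA -mulrDr ler_peMr// ltW.
Qed.

Section Cone.
Variables (R : realType) (q : nat) (A : 'M[nat]_q) (theta : R).
Implicit Types (g u : SFT A -> R).

Definition cone (a : R) g := (forall x, 0 <= g x) /\
  forall k x y, agree k x y -> g x <= expR (a * theta ^+ k) * g y.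

Hypothesis htheta : 0 < theta < 1.

Let theta_gt0 : 0 < theta. Proof. by case/andP: htheta. Qed.
Let thetaX_gt0 k : 0 < theta ^+ k. Proof. exact: exprn_gt0. Qed.

Lemma cone_mono (a a' : R) g : a <= a' -> cone a g -> cone a' g.
Proof.
move=> aa' [g0 hg]; split => // k x y /hg /le_trans; apply.
by rewrite ler_wpM2r// ler_expR ler_wpM2r// ltW.
Qed.

Lemma cone_cst (a c : R) : 0 <= a -> 0 <= c -> cone a (fun=> c).
Proof.
move=> a0 c0; split => // k x y _; rewrite ler_peMl// -expR0 ler_expR.
by rewrite mulr_ge0// ltW.
Qed.

Lemma coneZ (a c : R) g : 0 <= c -> cone a g -> cone a (fun x => c * g x).
Proof.
move=> c0 [g0 hg]; split => [x|k x y xy]; first exact: mulr_ge0.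
by rewrite mulrCA ler_wpM2l// hg.
Qed.

(** Put s = theta^k. As u <= r g, it suffices that r (exp (a s) - exp (- a2 s)) <= exp (a s) - exp
    (a' s). The hypothesis on r says a' <= (1 - r) a - r a2, and convexity of exp turns this into
    that inequality. Both contraction arguments subtract by this lemma. *)
Lemma cone_sub (a a' a2 r : R) g u : cone a' g -> cone a2 u -> 0 <= r <= 1 ->
  0 <= a + a2 ->
  r * (a + a2) <= a - a' -> (forall x, u x <= r * g x) ->
  cone a (fun x => g x - u x).
Proof.
move=> [g0 hg] [u0 hu] r01 aa2 hr hug; have /andP[r0 r1] := r01; split=> [x|k x y xy].
  by rewrite subr_ge0 (le_trans (hug x))// ler_piMl.
have h1 := hg _ _ _ xy; have h2 := hu _ _ _ (agree_sym xy).
set s := theta ^+ k in h1 h2 *; have s0 : 0 < s by exact: thetaX_gt0.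
have {h2} h2 : expR (- (a2 * s)) * u y <= u x.
  have := ler_wpM2l (expR_ge0 (- (a2 * s))) h2.
  by rewrite mulrA -expRD addNr expR0 mul1r.
apply: (le_trans (lerB h1 h2)).
have h3 : expR (a' * s) <= (1 - r) * expR (a * s) + r * expR (- (a2 * s)).
  apply: le_trans (expR_convex _ _ r01); rewrite ler_expR -mulrN.
  by have := ler_wpM2r (ltW s0) hr; lra.
have h4 : expR (- (a2 * s)) <= expR (a * s).
  by rewrite ler_expR -subr_ge0 opprK -mulrDl mulr_ge0// ltW.
have h5 := ler_wpM2r (g0 y) h3.
have h6 : u y * (expR (a * s) - expR (- (a2 * s))) <=
          r * g y * (expR (a * s) - expR (- (a2 * s))).
  by rewrite ler_wpM2r ?subr_ge0.
lra.
Qed.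

(** From 1 - exp (- a s) <= a s, applied to the larger of the two values. *)
Lemma cone_lip (a t : R) g : 0 <= a -> cone a g -> (forall x, g x <= t) ->
  lip_le rabs theta (a * t) g.
Proof.
move=> a0 [g0 hg] gt k x y; rewrite /rabs.
wlog le : x y / g y <= g x.
  move=> W xy; have [/W|/ltW/W] := leP (g y) (g x); first by apply.
  by rewrite distrC; apply; exact: agree_sym.
move=> xy; rewrite ger0_norm ?subr_ge0//.
set s := theta ^+ k; have s0 : 0 < s by exact: thetaX_gt0.
have h := hg _ _ _ (xy : agree k x y).
have {}h : expR (- (a * s)) * g x <= g y.
  have := ler_wpM2l (expR_ge0 (- (a * s))) h.
  by rewrite mulrA -expRD addNr expR0 mul1r.
apply: (@le_trans _ _ (a * s * g x)).
  have h2 := ler_wpM2r (g0 x) (expR_ge1Dx (- (a * s))); lra.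
by rewrite mulrAC ler_wpM2r ?(ltW s0)// ler_wpM2l.
Qed.

(** Adding T makes the values at least s, so a variation s theta^k becomes a relative variation of
    at most theta^k, and 1 + theta^k <= exp (a theta^k) once a >= 1. *)
Lemma lip_cone (a s t T : R) g : lip_le rabs theta s g -> sup_le rabs t g ->
  1 <= a -> 0 <= t -> s + t <= T -> cone a (fun x => T + g x).
Proof.
move=> hs ht a1 t0 sT.
(* On an empty space s could be negative, hence the guard. *)
have s0 : inhabited (SFT A) -> 0 <= s.
  by case=> x; have := hs 0%N x x (agree_refl _);
     rewrite /rabs subrr normr0 expr0 mulr1.
have gt x : - t <= g x by have := ht x; rewrite /rabs ler_norml => /andP[].
split=> [x|k x y xy]; first by have := gt x; have := s0 (inhabits x); lra.
set u := theta ^+ k; have u0 : 0 < u by exact: thetaX_gt0.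
have := hs _ _ _ xy; rewrite /rabs -/u ler_norml => /andP[_ h].
have h1 : 1 + u <= expR (a * u).
  by apply: le_trans (expR_ge1Dx _); rewrite lerD2l ler_peMl// ltW.
have Tg : s <= T + g y by have := gt y; lra.
have h2 := ler_wpM2r (le_trans (s0 (inhabits x)) Tg) h1.
have h3 := ler_wpM2r (ltW u0) Tg.
lra.
Qed.

Lemma cone_lim a (g_ : nat -> SFT A -> R) g : (forall n, cone a (g_ n)) ->
  (forall x, (fun n => g_ n x) @ \oo --> g x) -> cone a g.
Proof.
move=> hg cg; split=> [x|k x y xy].
  rewrite -(cvg_lim _ (cg x))//; apply: limr_ge; first by apply: cvgP; exact: cg.
  by near=> n; exact: (hg n).1.
have c2 : (fun n => expR (a * theta ^+ k) * g_ n y) @ \oo -->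
    expR (a * theta ^+ k) * g y by apply: cvgMr; exact: cg.
apply: (@ler_cvg_to _ _ _ _ _ _ _ _ (cg x) c2).
by near=> n; exact: (hg n).2.
Unshelve. all: by end_near.
Qed.

End Cone.

Section TransferLinear.
Variables (R : realType) (q : nat) (A : 'M[nat]_q) (f : SFT A -> R).
Implicit Types (g u : SFT A -> R).
Local Notation L := (transfer f).

Lemma transfer_lin c g u :
  L (fun x => c * g x + u x) = fun x => c * L g x + L u x.
Proof.
apply/funext => x; rewrite !transferE mulr_sumr -big_split/=.
by apply: eq_bigr => i _; rewrite mulrDr mulrCA.
Qed.

Lemma iter_transfer_lin n c g u :
  iter n L (fun x => c * g x + u x) = fun x => c * iter n L g x + iter n L u x.
Proof. by elim: n => // n IH; rewrite !iterS IH transfer_lin. Qed.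

Lemma transferZ c g : L (fun x => c * g x) = fun x => c * L g x.
Proof.
by apply/funext => x; rewrite !transferE mulr_sumr; apply: eq_bigr => i _; rewrite mulrCA.
Qed.

Lemma iter_transferZ n c g :
  iter n L (fun x => c * g x) = fun x => c * iter n L g x.
Proof. by elim: n => // n IH; rewrite !iterS IH transferZ. Qed.

Lemma transferB g u : L (fun x => g x - u x) = fun x => L g x - L u x.
Proof.
have -> : (fun x => g x - u x) = fun x => (-1) * u x + g x.
  by apply/funext => x; rewrite mulN1r addrC.
by rewrite transfer_lin; apply/funext => x; rewrite mulN1r addrC.
Qed.

Lemma iter_transferB n g u :
  iter n L (fun x => g x - u x) = fun x => iter n L g x - iter n L u x.
Proof. by elim: n => // n IH; rewrite !iterS IH transferB. Qed.

Lemma transfer_ge0 g : (forall x, 0 <= g x) -> forall x, 0 <= L g x.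
Proof.
by move=> g0 x; rewrite transferE sumr_ge0// => i _; rewrite mulr_ge0 ?expR_ge0.
Qed.

Lemma iter_transfer_ge0 n g : (forall x, 0 <= g x) -> forall x, 0 <= iter n L g x.
Proof. by move=> g0; elim: n => // n IH x; rewrite iterS; exact: transfer_ge0. Qed.

Lemma iter_transfer_le n g u : (forall x, g x <= u x) ->
  forall x, iter n L g x <= iter n L u x.
Proof.
move=> gu x; rewrite -subr_ge0.
have := @iter_transfer_ge0 n (fun x => u x - g x).
by rewrite iter_transferB; apply => y; rewrite subr_ge0.
Qed.

End TransferLinear.

(* F bounds f, b is a Lipschitz constant of f, and m is the number of
   coordinates after which the distortion b theta^m is at most 1. *)
Record ruelle_data (R : realType) (q : nat) (A : 'M[nat]_q) (M : nat)
    (theta : R) (f : SFT A -> R) (b F : R) (m : nat) : Prop := RuelleData {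
  rd_q : (1 < q)%N;
  rd_A : forall i j, A i j = 0%N \/ A i j = 1%N;
  rd_M : (0 < M)%N;
  rd_AM : forall i j, (0 < (A ^+ M) i j)%N;
  rd_theta : 0 < theta < 1;
  rd_b : 1 <= b;
  rd_F : 0 <= F;
  rd_lip : lip_le rabs theta b f;
  rd_sup : sup_le rabs F f;
  rd_m : b * theta ^+ m <= 1 }.

Section Ruelle.
Variables (R : realType) (q : nat) (A : 'M[nat]_q) (M : nat) (theta : R).
Variables (f : SFT A -> R) (b F : R) (m : nat).
Implicit Types (g u : SFT A -> R).
Hypothesis H : ruelle_data M theta f b F m.

Let q_gt0 := ltnW (rd_q H).
Let hA := rd_A H.
Let hM := rd_M H.
Let hAM := rd_AM H.
Let htheta := rd_theta H.
Let f_lip := rd_lip H.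
Let f_sup := rd_sup H.

Local Notation L := (transfer f).
Local Notation N := (m + M)%N.

(** Prepending a symbol lengthens the agreement by one, so the slope of g and the Lipschitz constant
    of f both acquire a factor theta. *)
Lemma transfer_cone a g : cone theta a g -> cone theta (theta * (a + b)) (L g).
Proof.
move=> [g0 hg]; split => [|k x y xy]; first exact: transfer_ge0.
rewrite !transferE mulr_sumr -(xy 0%N)//; apply: ler_sum => i /eqP ix.
have pxy := agree_prepend ix xy.
set x' := prepend i x in pxy *; set y' := prepend i y in pxy *.
have h1 := hg _ _ _ pxy; have := f_lip pxy; rewrite /rabs ler_norml => /andP[_ h2].
apply: le_trans (ler_wpM2l (expR_ge0 _) h1) _.
rewrite !mulrA ler_wpM2r// -!expRD ler_expR.
by move: h2; rewrite exprS; lra.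
Qed.

Lemma iter_transfer_cone a n g : theta * (a + b) <= a -> cone theta a g ->
  cone theta a (iter n L g).
Proof.
move=> ha hg; elim: n => // n IH; rewrite iterS.
by apply: cone_mono ha _ => //; exact: transfer_cone.
Qed.

Lemma iter_transferS_cone a n g : theta * (a + b) <= a -> cone theta a g ->
  cone theta (theta * (a + b)) (iter n.+1 L g).
Proof. by move=> ha hg; rewrite iterS; apply: transfer_cone; exact: iter_transfer_cone. Qed.

(** The preimage z contributes one of the nonnegative terms of L^n g x, with weight at least exp (-
    n F). *)
Lemma iter_transfer_lower n g z x : (forall x, 0 <= g x) ->
  iter n (@sft_shift q A) z = x -> g z <= expR (n%:R * F) * iter n L g x.
Proof.
elim: n g z => [|n IH] g z g0; first by move=> /= <-; rewrite mul0r expR0 mul1r.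
rewrite iterSr => zx.
have h1 : g z <= expR F * L g (sft_shift z).
  have zi : A (coordinate z 0) (coordinate (sft_shift z) 0) = 1%N.
    exact: coordinate_admissible.
  rewrite transferE (bigD1 (coordinate z 0)) ?zi//= prepend_shift mulrDr.
  rewrite -[leLHS]addr0 lerD//.
    rewrite mulrA -expRD ler_peMl// -expR0 ler_expR.
    by have := f_sup z; rewrite /rabs ler_norml => /andP[]; lra.
  by rewrite mulr_ge0 ?expR_ge0// sumr_ge0// => i _; rewrite mulr_ge0 ?expR_ge0.
apply: (le_trans h1).
have h2 := IH (L g) _ (transfer_ge0 f g0) zx.
rewrite iterSr -natr1 mulrDl mul1r expRD (mulrC (expR _) (expR F)) -mulrA.
by rewrite ler_wpM2l ?expR_ge0.
Qed.

(** Each step has at most q terms, of weight at most exp F. *)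
Lemma iter_transfer_upper n g t : 0 <= t -> (forall x, g x <= t) ->
  forall x, iter n L g x <= (q%:R * expR F) ^+ n * t.
Proof.
move=> t0; elim: n g t t0 => [|n IH] g t t0 gt x; first by rewrite expr0 mul1r.
rewrite iterSr exprSr -mulrA; apply: IH => [|y].
  by rewrite mulr_ge0 ?mulr_ge0 ?ler0n ?expR_ge0.
rewrite transferE big_mkcond/= -mulrA.
have -> : q%:R * (expR F * t) = \sum_(i < q) expR F * t.
  by rewrite sumr_const card_ord mulr_natl.
apply: ler_sum => i _; case: ifP => _; last by rewrite mulr_ge0 ?expR_ge0.
apply: le_trans (ler_wpM2l (expR_ge0 _) (gt _)) _.
rewrite ler_wpM2r// ler_expR.
by have := f_sup (prepend i y); rewrite /rabs ler_norml => /andP[].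
Qed.

(* The iterate can follow any finite word, so one value of a cone element
   controls all values of its image after m + M steps. *)
Lemma cone_mixing a g x y : cone theta a g ->
  g y <= expR (a * theta ^+ m) * expR (N%:R * F) * iter N L g x.
Proof.
move=> [g0 hg]; have [z [zy zx]] := mixing hA hAM m x y.
apply: (le_trans (hg _ _ _ (agree_sym zy))).
rewrite -mulrA ler_wpM2l ?expR_ge0//.
exact: iter_transfer_lower.
Qed.

(** The factor (q e^F)^N of [iter_transfer_upper] times the constant of [cone_mixing], multiplied
    out; [HarnackE] recovers the two factors. *)
Definition Harnack a := expR (a * theta ^+ m) * (q%:R * expR (2 * F)) ^+ N.

Lemma Harnack_gt0 a : 0 < Harnack a.
Proof. by rewrite mulr_gt0 ?expR_gt0// exprn_gt0// mulr_gt0 ?expR_gt0// ltr0n. Qed.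

Lemma HarnackE a : Harnack a =
  (q%:R * expR F) ^+ N * (expR (a * theta ^+ m) * expR (N%:R * F)).
Proof.
rewrite /Harnack (mulrC _ (expR _ * expR _)) -mulrA; congr (_ * _).
rewrite !exprMn -!expRM_natl mulrC -mulrA -expRD; congr (_ * expR _).
by ring.
Qed.

Lemma cone_Harnack a g x y : cone theta a g ->
  iter N L g y <= Harnack a * iter N L g x.
Proof.
move=> hg; rewrite HarnackE -mulrA; apply: iter_transfer_upper.
  by rewrite !mulr_ge0 ?expR_ge0// iter_transfer_ge0//; case: hg.
by move=> z; exact: cone_mixing.
Qed.

Lemma iter_transfer1_gt0 n x : 0 < iter n L (fun=> 1) x.
Proof.
elim: n x => // n IH x; rewrite iterS transferE.
have [i ix] := exists_preceding hA hAM x hM.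
rewrite (bigD1 i)/= ?ix// ltr_wpDr//; last by rewrite mulr_gt0 ?expR_gt0.
by rewrite sumr_ge0// => j _; rewrite mulr_ge0 ?expR_ge0// ltW.
Qed.

End Ruelle.

(** * The eigenfunctional and the eigenvalue *)

Lemma cauchy_seq_cvg (R : realType) (u : nat -> R) :
  (forall e, 0 < e -> exists n0, forall n k, (n0 <= n)%N -> (n0 <= k)%N ->
     `|u n - u k| <= e) -> cvgn u.
Proof.
move=> hu; apply: cauchy_cvg; apply: cauchy_exP => e e0.
have [|n0 hn0] := hu (e / 2); first by rewrite divr_gt0.
exists (u n0); exists n0 => // n /= n0n; rewrite /ball/=.
by apply: le_lt_trans (hn0 _ _ (leqnn _) n0n) _; rewrite ltr_pdivrMr// ltr_pMr// ltr1n.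
Qed.

Section Functional.
Variables (R : realType) (q : nat) (A : 'M[nat]_q) (M : nat) (theta : R).
Variables (f : SFT A -> R) (b F : R) (m : nat).
Implicit Types (g u : SFT A -> R).
Hypothesis H : ruelle_data M theta f b F m.

Let q_gt0 := ltnW (rd_q H).
Let hM := rd_M H.
Let htheta := rd_theta H.
Let b_ge1 := rd_b H.
Let F_ge0 := rd_F H.

Local Notation L := (transfer f).
Local Notation N := (m + M)%N.

Let theta_gt0 : 0 < theta. Proof. by case/andP: htheta. Qed.
Let theta_lt1 : theta < 1. Proof. by case/andP: htheta. Qed.
Let b_gt0 : 0 < b. Proof. exact: lt_le_trans b_ge1. Qed.

(** The solution of a = theta (a + b) + b: one application of L gains exactly b, which [cone_sub]
    spends on the subtraction. *)
Definition cone_slope := b * (1 + theta) / (1 - theta).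
Local Notation a0 := cone_slope.
Local Notation a1 := (theta * (a0 + b)).
Local Notation S := (Harnack q M theta F m a0).

Lemma cone_slope_imageE : a1 = 2 * theta * b / (1 - theta).
Proof. by rewrite /cone_slope; field; rewrite gt_eqF// subr_gt0. Qed.

Lemma cone_slope_gap : a0 - a1 = b.
Proof. by rewrite cone_slope_imageE /cone_slope; field; rewrite gt_eqF// subr_gt0. Qed.

Lemma cone_slope_image_le : a1 <= a0.
Proof. by rewrite -subr_ge0 cone_slope_gap ltW. Qed.

Lemma cone_slope_image_ge0 : 0 <= a1.
Proof. by rewrite cone_slope_imageE divr_ge0 ?mulr_ge0 ?subr_ge0// ltW. Qed.

Lemma cone_slope_ge1 : 1 <= a0.
Proof.
rewrite /cone_slope ler_pdivlMr ?subr_gt0// mul1r.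
by have := ler_wpM2r (ltW theta_gt0) b_ge1; have := theta_gt0; have := b_ge1; lra.
Qed.

Lemma cone_slope_ge0 : 0 <= a0. Proof. exact: le_trans cone_slope_ge1. Qed.

Lemma iter_cone n g : cone theta a0 g -> cone theta a0 (iter n L g).
Proof. exact: (iter_transfer_cone H _ cone_slope_image_le). Qed.

Lemma iterN_cone g : cone theta a0 g -> cone theta a1 (iter N L g).
Proof.
move=> hg; rewrite -(prednK (_ : 0 < N)%N); last by rewrite addn_gt0 hM orbT.
exact: (iter_transferS_cone H _ cone_slope_image_le).
Qed.

Lemma Harnack_slope_ge1 : 1 <= S.
Proof.
rewrite /Harnack; apply: mulr_ege1.
  by rewrite -expR0 ler_expR mulr_ge0 ?cone_slope_ge0// exprn_ge0// ltW.
rewrite exprn_ege1// mulr_ege1 ?ler1n//.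
by rewrite -expR0 ler_expR mulr_ge0.
Qed.

(** This r satisfies r (a0 + a1) = b (1 + 3 theta) / 4 <= b, as [cone_sub] requires. In c the factor
    2 S^2 pays for two Harnack inequalities and for the factor 2 in the hypothesis of
    [cone_improve]. *)
Let r := (1 - theta) / 4.
Let c := r / (2 * S ^+ 2).

Let r01 : 0 <= r <= 1.
Proof. by rewrite /r; apply/andP; split; have := theta_gt0; have := theta_lt1; lra. Qed.

Let c_gt0 : 0 < c.
Proof.
rewrite /c divr_gt0//; first by rewrite /r; have := theta_lt1; lra.
by rewrite mulr_gt0// exprn_gt0// (lt_le_trans _ Harnack_slope_ge1).
Qed.

Let c_lt1 : c < 1.
Proof.
rewrite /c ltr_pdivrMr; last by rewrite mulr_gt0// exprn_gt0// (lt_le_trans _ Harnack_slope_ge1).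
have : 1 <= S ^+ 2 by rewrite exprn_ege1// Harnack_slope_ge1.
by move: r01 => /andP[]; lra.
Qed.

(** Harnack spreads the comparison at the single point x to all points, at the cost of a factor S
    for each of u and v. *)
Lemma cone_improve (x : SFT A) d v u : 0 <= d -> cone theta a0 v -> cone theta a0 u ->
  d * iter N L u x <= 2 * iter N L v x ->
  cone theta a0 (fun y => iter N L v y - c * d * iter N L u y).
Proof.
move=> d0 hv hu hx.
apply: (cone_sub htheta (a' := a1) (a2 := a1) (r := r)) => //.
- exact: iterN_cone.
- by apply: coneZ; [rewrite mulr_ge0// ltW | exact: iterN_cone].
- by rewrite addr_ge0 ?cone_slope_ge0// cone_slope_image_ge0.
- rewrite cone_slope_gap cone_slope_imageE /cone_slope /r.
  rewrite [leLHS](_ : _ = b * (1 + 3 * theta) / 4); last first.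
    by field; rewrite gt_eqF// subr_gt0.
  by have := ler_wpM2l (ltW b_gt0) (ltW theta_lt1); lra.
move=> y.
have h1 := cone_Harnack H x y hu; have h2 := cone_Harnack H y x hv.
have S0 : 0 < S by exact: Harnack_gt0 H _.
have h3 : d * iter N L u y <= 2 * S ^+ 2 * iter N L v y.
  apply: le_trans (ler_wpM2l d0 h1) _.
  rewrite mulrCA expr2.
  apply: le_trans (ler_wpM2l (ltW S0) hx) _.
  by have := ler_wpM2l (ltW S0) h2; lra.
rewrite /c -mulrA; apply: le_trans (ler_wpM2l _ h3) _; first exact: ltW.
by rewrite mulrA divfK// mulf_neq0// expf_neq0// gt_eqF.
Qed.

(** The functions g - al u and be u - g add up to (be - al) u, so at x one of their images is at
    least half the image of the sum; the corresponding end of the interval moves in by c (be -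
    al). *)
Lemma ratio_step (x : SFT A) g u al be : al <= be -> cone theta a0 u ->
  cone theta a0 (fun x => g x - al * u x) ->
  cone theta a0 (fun x => be * u x - g x) ->
  exists al' be', [/\ be' - al' = (1 - c) * (be - al),
    cone theta a0 (fun x => iter N L g x - al' * iter N L u x) &
    cone theta a0 (fun x => be' * iter N L u x - iter N L g x)].
Proof.
move=> ab hu hv hw.
have d0 : 0 <= be - al by rewrite subr_ge0.
have Ev : iter N L (fun x => g x - al * u x) =
    fun x => iter N L g x - al * iter N L u x.
  by rewrite iter_transferB iter_transferZ.
have Ew : iter N L (fun x => be * u x - g x) =
    fun x => be * iter N L u x - iter N L g x.
  by rewrite iter_transferB iter_transferZ.
have [h|h] := leP ((be - al) * iter N L u x) (2 * iter N L (fun x => g x - al * u x) x).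
  exists (al + c * (be - al)), be; split.
  - by ring.
  - have := cone_improve d0 hv hu h; rewrite Ev; congr (cone _ _ _).
    by apply/funext => y; ring.
  - by rewrite -Ew; exact: iter_cone.
have {}h : (be - al) * iter N L u x <= 2 * iter N L (fun x => be * u x - g x) x.
  by move: h; rewrite Ev Ew; lra.
exists al, (be - c * (be - al)); split.
- by ring.
- by rewrite -Ev; exact: iter_cone.
- have := cone_improve d0 hw hu h; rewrite Ew; congr (cone _ _ _).
  by apply/funext => y; ring.
Qed.

Lemma ratio_iter (x : SFT A) g u al be j : al <= be -> cone theta a0 u ->
  cone theta a0 (fun x => g x - al * u x) ->
  cone theta a0 (fun x => be * u x - g x) ->
  exists al' be', [/\ be' - al' = (1 - c) ^+ j * (be - al),
    cone theta a0 (fun x => iter (j * N) L g x - al' * iter (j * N) L u x) &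
    cone theta a0 (fun x => be' * iter (j * N) L u x - iter (j * N) L g x)].
Proof.
move=> ab hu hv hw; elim: j => [|j [al1 [be1 [E1 h1 h2]]]].
  by exists al, be; split => //; rewrite expr0 mul1r.
have ab1 : al1 <= be1.
  by rewrite -subr_ge0 E1 mulr_ge0 ?subr_ge0// exprn_ge0// subr_ge0 ltW.
have [al2 [be2 [E2 h3 h4]]] := ratio_step x ab1 (iter_cone (j * N) hu) h1 h2.
exists al2, be2; split; first by rewrite E2 E1 exprS mulrA.
- by rewrite mulSn !(iterD N).
- by rewrite mulSn !(iterD N).
Qed.

(** A norm bound with real witnesses for both terms, which avoids suprema and extended reals. *)
Definition bdd_lip (t : R) g := exists s s', [/\ lip_le rabs theta s g, sup_le rabs s' g,
  0 <= s, 0 <= s' & s + s' <= t].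

Lemma bdd_lip_cone t g : bdd_lip t g -> cone theta a0 (fun x => t + g x).
Proof.
by move=> [s [s' [hs hs' s0 s'0 st]]]; exact: (lip_cone htheta hs hs' cone_slope_ge1).
Qed.

Lemma bdd_lipN t g : bdd_lip t g -> bdd_lip t (fun x => - g x).
Proof.
move=> [s [s' [hs hs' s0 s'0 st]]]; exists s, s'; split=> //.
  by move=> k x y /hs; rewrite /rabs -opprD normrN.
by move=> x; rewrite /rabs normrN; exact: hs'.
Qed.

Lemma bdd_lip_ge0 t g : bdd_lip t g -> 0 <= t.
Proof. by move=> [s [s' [_ _ s0 s'0]]]; apply: le_trans; exact: addr_ge0. Qed.

Lemma ratio_cvg (x : SFT A) (t : R) g : bdd_lip t g ->
  cvgn (fun n => iter n L g x / iter n L (fun=> 1) x).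
Proof.
move=> hg; have t0 := bdd_lip_ge0 hg; apply: cauchy_seq_cvg => e e0.
have h1 : cone theta a0 (fun x => g x - (- t) * 1).
  by have := bdd_lip_cone hg; congr (cone _ _ _); apply/funext => y; ring.
have h2 : cone theta a0 (fun x => t * 1 - g x).
  by have := bdd_lip_cone (bdd_lipN hg); congr (cone _ _ _); apply/funext => y; ring.
have h3 : cone theta a0 (fun _ : SFT A => 1).
  by apply: (cone_cst A htheta cone_slope_ge0).
have [j hj] : exists j, (1 - c) ^+ j * (t - - t) <= e.
  have : geometric (t - - t) (1 - c) @ \oo --> 0.
    apply: cvg_geometric; rewrite ger0_norm ?subr_ge0 ?(ltW c_lt1)//.
    by rewrite ltrBlDr ltrDl.
  move=> /cvgrPdist_le /(_ _ e0) [j _ /(_ j (leqnn _))].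
  rewrite sub0r normrN => h; exists j; rewrite mulrC.
  exact: le_trans (ler_norm _) h.
have tt : - t <= t by lra.
have [al [be [E hal hbe]]] := ratio_iter x j tt h3 h1 h2.
(* Positivity of L keeps all later ratios in the interval, so its length bounds their
   differences. *)
have hn n : (j * N <= n)%N ->
    al <= iter n L g x / iter n L (fun=> 1) x <= be.
  move=> jn; have u0 := iter_transfer1_gt0 H n x.
  rewrite ler_pdivlMr// ler_pdivrMr//.
  have := iter_transfer_ge0 f (n - j * N) hal.1 x.
  have := iter_transfer_ge0 f (n - j * N) hbe.1 x.
  by rewrite !iter_transferB !iter_transferZ -!iterD subnK// !subr_ge0 => -> ->.
exists (j * N)%N => n k /hn/andP[a_n b_n] /hn/andP[a_k b_k].
by rewrite -E in hj; rewrite ler_norml; apply/andP; split; lra.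
Qed.

Lemma cone_bdd_lip (t : R) g : cone theta a0 g -> 0 <= t -> (forall x, g x <= t) ->
  bdd_lip (a0 * t + t) g.
Proof.
move=> hg t0 gt; exists (a0 * t), t; split=> //.
- exact: (cone_lip htheta cone_slope_ge0 hg gt).
- by move=> x; rewrite /rabs ger0_norm//; case: hg.
- by rewrite mulr_ge0// cone_slope_ge0.
Qed.

(** Boundedness without compactness: [cone_mixing] bounds all values of g by one value of L^N g. *)
Lemma cone_bdd_lip_ex (x : SFT A) g : cone theta a0 g -> exists t, bdd_lip t g.
Proof.
move=> hg; eexists; apply: (cone_bdd_lip hg) => [|y]; last exact: (cone_mixing H x y hg).
by rewrite !mulr_ge0 ?expR_ge0//; exact: (iter_transfer_ge0 f N hg.1 x).
Qed.

Lemma bdd_lip_lin (d t t' : R) g g' : bdd_lip t g -> bdd_lip t' g' ->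
  bdd_lip (`|d| * t + t') (fun x => d * g x + g' x).
Proof.
move=> [s1 [s2 [h1 h2 h3 h4 h5]]] [s1' [s2' [h1' h2' h3' h4' h5']]].
exists (`|d| * s1 + s1'), (`|d| * s2 + s2'); split.
- move=> k x y xy; rewrite /rabs.
  rewrite [_ - _](_ : _ = d * (g x - g y) + (g' x - g' y)); last by ring.
  apply: le_trans (ler_normD _ _) _; rewrite normrM mulrDl lerD//; last exact: h1'.
  by rewrite -mulrA ler_wpM2l// h1.
- move=> x; rewrite /rabs; apply: le_trans (ler_normD _ _) _.
  by rewrite normrM lerD//; [rewrite ler_wpM2l// h2|exact: h2'].
- by rewrite addr_ge0// mulr_ge0.
- by rewrite addr_ge0// mulr_ge0.
- by have := ler_wpM2l (normr_ge0 d) h5; lra.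
Qed.

Lemma bdd_lip_le (t t' : R) g : t <= t' -> bdd_lip t g -> bdd_lip t' g.
Proof.
move=> tt' [s1 [s2 [h1 h2 h3 h4 h5]]]; exists s1, s2; split=> //.
exact: le_trans tt'.
Qed.

Lemma bdd_lip_cst (d : R) : bdd_lip `|d| (fun=> d).
Proof.
exists 0, `|d|; split=> //; last by rewrite add0r.
by move=> k x y _; rewrite /rabs subrr normr0 mul0r.
Qed.

(** L^n g is the difference of L^n (t + g) and L^n t, both in the cone. *)
Lemma bdd_lip_iter (x : SFT A) n (t : R) g : bdd_lip t g ->
  exists t', bdd_lip t' (iter n L g).
Proof.
move=> hg; have t0 := bdd_lip_ge0 hg.
have [t1 h1] := cone_bdd_lip_ex x (iter_cone n (bdd_lip_cone hg)).
have [t2 h2] := cone_bdd_lip_ex x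
  (iter_cone n (cone_cst A htheta cone_slope_ge0 t0)).
exists (`|-1| * t2 + t1); have := bdd_lip_lin (-1) h2 h1.
congr bdd_lip; apply/funext => y.
have -> : (fun x => t + g x) = fun x => 1 * g x + t.
  by apply/funext => z; rewrite mul1r addrC.
by rewrite iter_transfer_lin; ring.
Qed.

End Functional.

(** * The eigenfunctional and its normalization *)

Section Eigenfunctional.
Variables (R : realType) (q : nat) (A : 'M[nat]_q) (M : nat) (theta : R).
Variables (f : SFT A -> R) (b F : R) (m : nat).
Implicit Types (g u : SFT A -> R) (t c e a : R).
Hypothesis H : ruelle_data M theta f b F m.

Let hA := rd_A H.
Let hM := rd_M H.
Let hAM := rd_AM H.
Let htheta := rd_theta H.

Variable x0 : SFT A.
Local Notation L := (transfer f).
Local Notation N := (m + M)%N.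
Local Notation a0 := (cone_slope theta b).
Local Notation bdd := (bdd_lip theta).

Definition eigenfunctional g : R :=
  limn (fun n => iter n L g x0 / iter n L (fun=> 1) x0).
Local Notation nu := eigenfunctional.

(** The equations nu (L g) = lambda nu (g) and nu (1) = 1 leave no other choice. *)
Definition eigenvalue : R := nu (L (fun=> 1)).
Local Notation lam := eigenvalue.

Let one_gt0 n : 0 < iter n L (fun=> 1) x0.
Proof. exact: iter_transfer1_gt0 H n x0. Qed.

Lemma nu_cvg t g : bdd t g ->
  (fun n => iter n L g x0 / iter n L (fun=> 1) x0) @ \oo --> nu g.
Proof. by move=> hg; exact: (ratio_cvg H hg). Qed.

Lemma nu_lin (c t t' : R) g g' : bdd t g -> bdd t' g' ->
  nu (fun x => c * g x + g' x) = c * nu g + nu g'.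
Proof.
move=> hg hg'; apply: cvg_lim => //.
have h : (fun n => c * (iter n L g x0 / iter n L (fun=> 1) x0)) @ \oo --> c * nu g.
  by apply: cvgMr; exact (nu_cvg hg).
rewrite (_ : (fun n => _) = fun n => c * (iter n L g x0 / iter n L (fun=> 1) x0)
    + iter n L g' x0 / iter n L (fun=> 1) x0).
  exact: (cvgD h (nu_cvg hg')).
by apply/funext => n; rewrite iter_transfer_lin mulrDl mulrA.
Qed.

Lemma nu1 : nu (fun=> 1) = 1.
Proof.
apply: cvg_lim => //; apply: cvg_near_cst; near=> n.
by rewrite divff// gt_eqF.
Unshelve. all: by end_near.
Qed.

Lemma nu_cst c : nu (fun=> c) = c.
Proof.
apply: cvg_lim => //; apply: cvg_near_cst; near=> n.
rewrite (_ : (fun=> c) = fun x => c * 1); last by apply/funext => x; rewrite mulr1.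
by rewrite iter_transferZ mulfK// gt_eqF.
Unshelve. all: by end_near.
Qed.

Lemma nuZ c t g : bdd t g -> nu (fun x => c * g x) = c * nu g.
Proof.
move=> hg; have := nu_lin c hg (bdd_lip_cst A theta 0).
rewrite nu_cst addr0 => <-; congr (nu _).
by apply/funext => x; rewrite addr0.
Qed.

Lemma nu_le t t' g u : bdd t g -> bdd t' u -> (forall x, g x <= u x) -> nu g <= nu u.
Proof.
move=> hg hu gu; apply: (ler_cvg_to (nu_cvg hg) (nu_cvg hu)).
near=> n; rewrite ler_pM2r ?invr_gt0//; exact: iter_transfer_le.
Unshelve. all: by end_near.
Qed.

Lemma nu_ge0 t g : bdd t g -> (forall x, 0 <= g x) -> 0 <= nu g.
Proof.
by move=> hg g0; rewrite -(nu_cst 0); exact: (nu_le (bdd_lip_cst A theta 0) hg).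
Qed.

Lemma nu_upper t c g : bdd t g -> (forall x, g x <= c) -> nu g <= c.
Proof. by move=> hg gc; rewrite -(nu_cst c); exact: (nu_le hg (bdd_lip_cst A theta c)). Qed.

Lemma nu_lower t c g : bdd t g -> (forall x, c <= g x) -> c <= nu g.
Proof. by move=> hg gc; rewrite -(nu_cst c); exact: (nu_le (bdd_lip_cst A theta c) hg). Qed.

Lemma nu_norm t c g : bdd t g -> (forall x, `|g x| <= c) -> `|nu g| <= c.
Proof.
move=> hg gc; rewrite ler_norml; apply/andP; split.
  by apply: (nu_lower hg) => x; have := gc x; rewrite ler_norml => /andP[].
by apply: (nu_upper hg) => x; have := gc x; rewrite ler_norml => /andP[].
Qed.

Lemma bdd_one : bdd 1 (fun _ : SFT A => 1).
Proof. by have := bdd_lip_cst A theta 1; rewrite normr1. Qed.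

(** The ratio L^(n+1) g / L^n 1 is the product of L^n (L 1) / L^n 1 and L^(n+1) g / L^(n+1) 1, which
    tend to lambda and nu g. *)
Lemma nu_transfer t g : bdd t g -> nu (L g) = lam * nu g.
Proof.
move=> hg.
have [t1 h1] := bdd_lip_iter H x0 1 bdd_one.
have [t2 h2] := bdd_lip_iter H x0 1 hg.
apply: cvg_lim => //.
have hS := nu_cvg hg; rewrite -cvg_shiftS in hS.
rewrite (_ : (fun n => _) = fun n => iter n L (L (fun=> 1)) x0 / iter n L (fun=> 1) x0
    * (iter n.+1 L g x0 / iter n.+1 L (fun=> 1) x0)).
  exact: (cvgM (nu_cvg h1) hS).
apply/funext => n /=.
rewrite -!iterS !iterSr [RHS]mulrC mulrA divfK//.
by rewrite gt_eqF// -iterSr.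
Qed.

Lemma nu_iter n t g : bdd t g -> nu (iter n L g) = lam ^+ n * nu g.
Proof.
move=> hg; elim: n => [|n IH]; first by rewrite expr0 mul1r.
have [t1 h1] := bdd_lip_iter H x0 n hg.
by rewrite iterS (nu_transfer h1) IH exprS mulrA.
Qed.

Lemma eigenvalue_upper : lam <= q%:R * expR F.
Proof.
have [t1 h1] := bdd_lip_iter H x0 1 bdd_one.
apply: (nu_upper h1) => x.
have := iter_transfer_upper H 1 ler01 (fun _ => lexx 1) x.
by rewrite expr1 mulr1.
Qed.

Lemma eigenvalue_gt0 : 0 < lam.
Proof.
have [t1 h1] := bdd_lip_iter H x0 1 bdd_one.
apply: (@lt_le_trans _ _ (expR (- F))); first exact: expR_gt0.
apply: (nu_lower h1) => x.
have [i ix] := exists_preceding hA hAM x hM.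
have := iter_transfer_lower H (g := fun=> 1) (n := 1) (z := prepend i x) (x := x) (fun=> ler01).
move=> /(_ (shift_prepend ix)); rewrite mul1r expRN => h.
by rewrite -div1r ler_pdivrMr ?expR_gt0// mulrC.
Qed.

Let lamX_gt0 n : 0 < lam ^+ n. Proof. by rewrite exprn_gt0// eigenvalue_gt0. Qed.

Definition normalized n g x := lam ^- n * iter n L g x.
Local Notation Ln := normalized.

Lemma normalized_lin n c g u :
  Ln n (fun x => c * g x + u x) = fun x => c * Ln n g x + Ln n u x.
Proof. by apply/funext => x; rewrite /Ln iter_transfer_lin; ring. Qed.

Lemma normalizedB n g u : Ln n (fun x => g x - u x) = fun x => Ln n g x - Ln n u x.
Proof. by apply/funext => x; rewrite /Ln iter_transferB; ring. Qed.

Lemma normalizedD n k g : Ln (n + k) g = Ln n (Ln k g).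
Proof.
apply/funext => x; rewrite /Ln iter_transferZ mulrA -invfM -exprD iterD.
by rewrite addnC.
Qed.

Lemma normalized_bdd n t g : bdd t g -> exists t', bdd t' (Ln n g).
Proof.
move=> /(bdd_lip_iter H x0 n)[t' h].
exists (`|lam ^- n| * t' + `|0 : R|); have := bdd_lip_lin (lam ^- n) h (bdd_lip_cst A theta 0).
by congr bdd; apply/funext => x; rewrite addr0.
Qed.

Lemma nu_normalized n t g : bdd t g -> nu (Ln n g) = nu g.
Proof.
move=> hg; have [t' h] := bdd_lip_iter H x0 n hg.
by rewrite /Ln (nuZ _ h) (nu_iter n hg) mulKf// gt_eqF.
Qed.

Lemma normalized_cone n g : cone theta a0 g -> cone theta a0 (Ln n g).
Proof.
move=> hg; apply: coneZ; first by rewrite invr_ge0 ltW.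
exact: (iter_cone H).
Qed.

(** This is [cone_mixing] averaged over x by nu, where lambda^N <= (q e^F)^N completes the Harnack
    constant. The slope a stays free because h uses its own, smaller one. *)
Lemma cone_le_nu a g y : a <= a0 -> cone theta a g ->
  g y <= Harnack q M theta F m a * nu g.
Proof.
move=> aa0 hg; have hg0 := cone_mono htheta aa0 hg.
have [t ht] := cone_bdd_lip_ex H x0 hg0.
have [t' ht'] := bdd_lip_iter H x0 N ht.
have nu0 : 0 <= nu g by apply: (nu_ge0 ht) => x; case: hg.
pose k := expR (a * theta ^+ m) * expR (N%:R * F).
have k0 : 0 < k by rewrite mulr_gt0 ?expR_gt0.
have h1 : g y / k <= nu (iter N L g).
  apply: (nu_lower ht') => x; rewrite ler_pdivrMr// mulrC.
  exact: (cone_mixing H x y hg).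
rewrite ler_pdivrMr// (nu_iter N ht) in h1; apply: (le_trans h1).
rewrite HarnackE -/k [leRHS]mulrAC ler_wpM2r ?(ltW k0)// ler_wpM2r//.
by rewrite lerXn2r// ?nnegrE ?(ltW eigenvalue_gt0) ?mulr_ge0 ?expR_ge0// eigenvalue_upper.
Qed.

(** This is [cone_Harnack] averaged over y by nu. *)
Lemma nu_le_cone g x : cone theta a0 g ->
  nu g <= Harnack q M theta F m a0 * Ln N g x.
Proof.
move=> hg; have [t ht] := cone_bdd_lip_ex H x0 hg.
have [t' ht'] := bdd_lip_iter H x0 N ht.
have : nu (iter N L g) <= Harnack q M theta F m a0 * iter N L g x.
  by apply: (nu_upper ht') => y; exact: (cone_Harnack H).
by rewrite (nu_iter N ht) /Ln mulrCA ler_pdivlMl.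
Qed.

End Eigenfunctional.

(** * The eigenfunction and the spectral gap *)

Section SpectralGap.
Variables (R : realType) (q : nat) (A : 'M[nat]_q) (M : nat) (theta : R).
Variables (f : SFT A -> R) (b F : R) (m : nat).
Implicit Types (g u : SFT A -> R) (t c e a : R).
Hypothesis H : ruelle_data M theta f b F m.

Let hM := rd_M H.
Let htheta := rd_theta H.
Let b_ge1 := rd_b H.

Variable x0 : SFT A.
Local Notation L := (transfer f).
Local Notation N := (m + M)%N.
Local Notation a0 := (cone_slope theta b).
Local Notation bdd := (bdd_lip theta).
Local Notation nu := (eigenfunctional f x0).
Local Notation lam := (eigenvalue f x0).
Local Notation Ln := (normalized f x0).
Local Notation S := (Harnack q M theta F m a0).

Let theta_gt0 : 0 < theta. Proof. by case/andP: htheta. Qed.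
Let theta_lt1 : theta < 1. Proof. by case/andP: htheta. Qed.
Let S_ge1 : 1 <= S. Proof. exact: Harnack_slope_ge1 H. Qed.
Let a0_ge0 : 0 <= a0. Proof. exact: cone_slope_ge0 H. Qed.
Let lamX_gt0 n : 0 < lam ^+ n.
Proof. by rewrite exprn_gt0// (eigenvalue_gt0 H). Qed.
Let N_gt0 : (0 < N)%N. Proof. by rewrite addn_gt0 hM orbT. Qed.

Variable c : R.
Hypothesis c_gt0 : 0 < c.
Hypothesis hc : 2 * S * c <= 1 - theta.

Let c_le1 : c <= 1.
Proof. have := ler_wpM2r (ltW c_gt0) S_ge1; move: theta_gt0 hc; lra. Qed.

Let c1X_ge0 j : 0 <= (1 - c) ^+ j.
Proof. by rewrite exprn_ge0// subr_ge0. Qed.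

(** By [nu_le_cone], c nu g <= c S Ln N g <= r Ln N g with r = (1 - theta) / 2, which is the origin
    of [hc]. Constants have slope 0, and r a0 = b (1 + theta) / 2 <= b is the margin that [cone_sub]
    asks for. *)
Lemma contraction_step g : cone theta a0 g ->
  cone theta a0 (fun x => Ln N g x - c * nu g).
Proof.
move=> hg; have [t ht] := cone_bdd_lip_ex H x0 hg.
have nu0 : 0 <= nu g by apply: (nu_ge0 H _ ht) => x; case: hg.
have th0 := theta_gt0; have th1 := theta_lt1.
apply: (cone_sub htheta (a' := theta * (a0 + b)) (a2 := 0) (r := (1 - theta) / 2)).
- by apply: coneZ; [rewrite invr_ge0 ltW|exact: (iterN_cone H)].
- by apply: (cone_cst A htheta) => //; rewrite mulr_ge0// ltW.
- by apply/andP; split; lra.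
- by rewrite addr0.
- rewrite addr0 (cone_slope_gap H) /cone_slope.
  rewrite [leLHS](_ : _ = b * (1 + theta) / 2); last first.
    by field; rewrite gt_eqF// subr_gt0.
  by have := ler_wpM2l (le_trans ler01 b_ge1) (ltW th1); lra.
move=> x; have h := nu_le_cone H x0 x hg.
apply: (@le_trans _ _ (c * (S * Ln N g x))); first by rewrite ler_wpM2l// ltW.
have h0 : 0 <= Ln N g x.
  by rewrite mulr_ge0 ?invr_ge0 ?(ltW (lamX_gt0 _))//; exact: (iter_transfer_ge0 f _ hg.1).
by rewrite mulrA ler_wpM2r//; move: hc; lra.
Qed.

(** As nu g = nu g', both functions lose the same constant in each round: their difference is
    unaffected, while nu of each shrinks by 1 - c. *)
Lemma contraction_iter j g g' : cone theta a0 g -> cone theta a0 g' -> nu g = nu g' ->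
  exists u u', [/\ cone theta a0 u, cone theta a0 u',
    nu u = (1 - c) ^+ j * nu g, nu u' = (1 - c) ^+ j * nu g &
    forall x, Ln (j * N) g x - Ln (j * N) g' x = u x - u' x].
Proof.
move=> hg hg' E; elim: j => [|j [u [u' [hu hu' Eu Eu' D]]]].
  exists g, g'; split; rewrite ?expr0 ?mul1r//.
  by move=> x; rewrite /Ln expr0 invr1 !mul1r.
exists (fun x => Ln N u x - c * nu u), (fun x => Ln N u' x - c * nu u').
have nuE v : cone theta a0 v -> nu (fun x => Ln N v x - c * nu v) = (1 - c) * nu v.
  move=> hv; have [t ht] := cone_bdd_lip_ex H x0 hv.
  have [t' ht'] := normalized_bdd H x0 N ht.
  have -> : (fun x => Ln N v x - c * nu v) = fun x => 1 * Ln N v x + (- (c * nu v)).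
    by apply/funext => x; rewrite mul1r.
  rewrite (nu_lin H _ 1 ht' (bdd_lip_cst A theta _)) (nu_cst H) (nu_normalized H _ _ ht).
  by ring.
split.
- exact: contraction_step.
- exact: contraction_step.
- by rewrite nuE// Eu exprS mulrA.
- by rewrite nuE// Eu' exprS mulrA.
move=> x; rewrite mulSn !(normalizedD _ _ N) Eu Eu'.
have : Ln N (fun x => Ln (j * N) g x - Ln (j * N) g' x) x = Ln N (fun x => u x - u' x) x.
  by congr (Ln _ _ _); apply/funext.
by rewrite !normalizedB => ->; ring.
Qed.

(** The n mod N remaining steps preserve the cone and nu. Two functions with values in [0, d] differ
    by at most d, while their Lipschitz constants a0 d add up. *)
Lemma contraction n g g' : cone theta a0 g -> cone theta a0 g' -> nu g = nu g' ->
  let d := S * ((1 - c) ^+ (n %/ N) * nu g) in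
  sup_le rabs d (fun x => Ln n g x - Ln n g' x) /\
  lip_le rabs theta (2 * a0 * d) (fun x => Ln n g x - Ln n g' x).
Proof.
move=> hg hg' E d.
have [u [u' [hu hu' Eu Eu' D]]] := contraction_iter (n %/ N) hg hg' E.
have {}D x : Ln n g x - Ln n g' x = Ln (n %% N) u x - Ln (n %% N) u' x.
  have : Ln (n %% N) (fun x => Ln (n %/ N * N) g x - Ln (n %/ N * N) g' x) x =
         Ln (n %% N) (fun x => u x - u' x) x.
    by congr (Ln _ _ _); apply/funext.
  by rewrite !normalizedB -!normalizedD addnC -divn_eq.
have hv v : cone theta a0 v -> nu v = (1 - c) ^+ (n %/ N) * nu g ->
    (forall x, 0 <= Ln (n %% N) v x <= d) /\
    lip_le rabs theta (a0 * d) (Ln (n %% N) v).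
  move=> hv Ev; have hLv := normalized_cone H x0 (n %% N) hv.
  have [t ht] := cone_bdd_lip_ex H x0 hv.
  have le x : Ln (n %% N) v x <= d.
    apply: le_trans (cone_le_nu H x0 x (lexx _) hLv) _.
    by rewrite (nu_normalized H _ _ ht) Ev.
  split; last exact: (cone_lip htheta a0_ge0 hLv le).
  by move=> x; rewrite le andbT; case: hLv.
have [h1 l1] := hv _ hu Eu; have [h2 l2] := hv _ hu' Eu'.
split=> [x|k x y xy]; rewrite /rabs !D.
  by have /andP[? ?] := h1 x; have /andP[? ?] := h2 x; rewrite ler_norml; apply/andP; split; lra.
have := l1 _ _ _ xy; have := l2 _ _ _ xy; rewrite /rabs !ler_norml.
by move=> /andP[? ?] /andP[? ?]; apply/andP; split; lra.
Qed.

Definition eigenfunction x := limn (fun n => Ln n (fun=> 1) x).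
Local Notation h := eigenfunction.

Let cone1 : cone theta a0 (fun _ : SFT A => 1). Proof. exact: (cone_cst A htheta a0_ge0). Qed.

Let rate n := S * (1 - c) ^+ (n %/ N).

Let rate_cvg e : 0 < e -> exists n0, forall n, (n0 <= n)%N -> rate n <= e.
Proof.
move=> e0.
have : geometric S (1 - c) @ \oo --> 0.
  by apply: cvg_geometric; rewrite ger0_norm ?subr_ge0// ltrBlDr ltrDl.
move=> /cvgrPdist_le /(_ _ e0) [j _ hj]; exists (j * N)%N => n jn.
have /hj : (j <= n %/ N)%N by rewrite leq_divRL.
by rewrite sub0r normrN; apply: le_trans; exact: ler_norm.
Qed.

Let eigenfunction_cauchy n k x :
  `|Ln n (fun=> 1) x - Ln (n + k) (fun=> 1) x| <= rate n.
Proof.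
(* Both 1 and lambda^-k L^k 1 are cone elements with nu-value 1. *)
have hk := normalized_cone H x0 k cone1.
rewrite normalizedD.
have [|] := contraction n cone1 hk.
  by rewrite (nu_normalized H _ _ (bdd_one _ _)).
by rewrite (nu1 H) mulr1 => /(_ x).
Qed.

Lemma eigenfunction_cvg x : (fun n => Ln n (fun=> 1) x) @ \oo --> h x.
Proof.
apply: cauchy_seq_cvg => e /rate_cvg[n0 hn0]; exists n0 => n k n0n n0k.
wlog nk : n k n0n n0k / (n <= k)%N.
  move=> W; have [|/ltnW] := leqP n k; first exact: W.
  by move=> kn; rewrite distrC; exact: W.
by rewrite -(subnKC nk); apply: le_trans (eigenfunction_cauchy _ _ _) (hn0 _ n0n).
Qed.

Let eigenfunction_rate n x : `|Ln n (fun=> 1) x - h x| <= rate n.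
Proof.
have h1 : (fun k => `|Ln n (fun=> 1) x - Ln (k + n) (fun=> 1) x|) @ \oo -->
    `|Ln n (fun=> 1) x - h x|.
  apply: cvg_norm; apply: cvgB; first exact: cvg_cst.
  by rewrite (cvg_shiftn n (fun k => Ln k (fun=> 1) x)); exact (@eigenfunction_cvg x).
apply: (cvgr_to_le h1); near=> k; rewrite addnC; exact: eigenfunction_cauchy.
Unshelve. all: by end_near.
Qed.

(** The fixed point of a |-> theta (a + b). Its cone is invariant and contains the constants, hence
    h, and it is narrower than that of slope a0. *)
Definition eigenslope := b * theta / (1 - theta).
Local Notation a := eigenslope.

Lemma eigenslope_ge0 : 0 <= a.
Proof.
by rewrite divr_ge0 ?mulr_ge0 ?(ltW theta_gt0) ?(le_trans ler01 b_ge1)// subr_ge0 ltW.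
Qed.

Lemma eigenslope_le : a <= a0.
Proof.
rewrite /a /cone_slope ler_wpM2r ?invr_ge0 ?subr_ge0 ?(ltW theta_lt1)//.
by rewrite ler_wpM2l ?(le_trans ler01 b_ge1)// lerDr.
Qed.

Lemma eigenfunction_cone : cone theta a h.
Proof.
apply: (cone_lim (g_ := fun n => Ln n (fun=> 1))) => [n|]; last exact: eigenfunction_cvg.
apply: coneZ; first by rewrite invr_ge0 ltW.
apply: (iter_transfer_cone H) => [|].
  rewrite [leLHS](_ : _ = a)// /a; by field; rewrite gt_eqF// subr_gt0.
exact: (cone_cst A htheta eigenslope_ge0).
Qed.

Lemma eigenfunction_cone0 : cone theta a0 h.
Proof. exact: (cone_mono htheta eigenslope_le eigenfunction_cone). Qed.

Lemma eigenfunction_bdd : exists t, bdd t h.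
Proof. exact: (cone_bdd_lip_ex H x0 eigenfunction_cone0). Qed.

Lemma eigenfunction_eq : L h = fun x => lam * h x.
Proof.
apply/funext => x.
have h1 : (fun n => lam * Ln n.+1 (fun=> 1) x) @ \oo --> lam * h x.
  apply: cvgMr; have := @eigenfunction_cvg x; rewrite -cvg_shiftS; exact.
have h2 : (fun n => L (Ln n (fun=> 1)) x) @ \oo --> L h x.
  rewrite transferE; rewrite (_ : (fun n => _) = fun n =>
    \sum_(i < q | A i (coordinate x 0) == 1%N)
      expR (f (prepend i x)) * Ln n (fun=> 1) (prepend i x)); last first.
    by apply/funext => n; rewrite transferE.
  apply: cvg_big => [|i _]; first by exact: add_continuous.
  by apply: cvgMr; exact (@eigenfunction_cvg _).
have E : (fun n => lam * Ln n.+1 (fun=> 1) x) = fun n => L (Ln n (fun=> 1)) x.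
  apply/funext => n; rewrite /Ln transferZ iterS mulrA exprS invfM mulVKf//.
  by rewrite gt_eqF// (eigenvalue_gt0 H).
by rewrite E in h1; apply: (cvg_unique _ h2 h1).
Qed.

(** The convergence to h is uniform and nu is bounded by the supremum, so nu h is the limit of nu
    (lambda^-n L^n 1) = 1. *)
Lemma nu_eigenfunction : nu h = 1.
Proof.
have [t ht] := eigenfunction_bdd.
apply/eqP; rewrite -subr_eq0 -normr_le0; apply/ler_addgt0Pr => e /rate_cvg[n hn].
rewrite add0r; apply: le_trans (hn n (leqnn _)).
have [t' ht'] := normalized_bdd H x0 n (bdd_one A theta).
have -> : nu h - 1 = nu (fun x => (-1) * Ln n (fun=> 1) x + h x).
  by rewrite (nu_lin H _ _ ht' ht) (nu_normalized H _ _ (bdd_one _ _)) (nu1 H); ring.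
apply: (nu_norm H _ (bdd_lip_lin (-1) ht' ht)) => x.
by rewrite mulN1r addrC distrC.
Qed.

Local Notation K0 := (Harnack q M theta F m a).

Lemma eigenfunction_upper x : h x <= K0.
Proof.
have := cone_le_nu H x0 x eigenslope_le eigenfunction_cone.
by rewrite nu_eigenfunction mulr1.
Qed.

Lemma iter_eigenfunction n : iter n L h = fun x => lam ^+ n * h x.
Proof.
elim: n => [|n IH]; first by apply/funext => x; rewrite expr0 mul1r.
by rewrite iterS IH transferZ eigenfunction_eq; apply/funext => x; rewrite exprSr mulrA.
Qed.

Lemma normalized_eigenfunction n : Ln n h = h.
Proof. by apply/funext => x; rewrite /Ln iter_eigenfunction mulKf// gt_eqF. Qed.

(** With L^N h = lambda^N h and lambda <= q e^F, [cone_mixing] bounds every h y by K0 h x; averaging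
    over y by nu leaves nu h = 1 on the left. *)
Lemma eigenfunction_lower x : 1 <= K0 * h x.
Proof.
have [t ht] := eigenfunction_bdd.
rewrite -{1}nu_eigenfunction; apply: (nu_upper H _ ht) => y.
apply: le_trans (cone_mixing H x y eigenfunction_cone) _.
rewrite iter_eigenfunction HarnackE mulrA ler_wpM2r//; first by case: eigenfunction_cone.
rewrite mulrC ler_wpM2r ?mulr_ge0 ?expR_ge0//.
by rewrite lerXn2r ?nnegrE ?(ltW (eigenvalue_gt0 H _))//; exact: (eigenvalue_upper H).
Qed.

Lemma eigenfunction_lip : lip_le rabs theta (a * K0) h.
Proof. exact: (cone_lip htheta eigenslope_ge0 eigenfunction_cone eigenfunction_upper). Qed.

(** The function g is the difference of the cone elements t + g and t, and each is compared with the
    multiple of h that has the same nu-value. These values are at most 2 t and t, whence 3 t; the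
    summands 1 and 2 a0 are the supremum and Lipschitz parts of [contraction]. *)
Lemma spectral_gap n t g : bdd t g ->
  bdd (3 * t * ((1 + 2 * a0) * S) * (1 - c) ^+ (n %/ N))
    (fun x => Ln n g x - h x * nu g).
Proof.
move=> hg; have t0 := bdd_lip_ge0 hg.
set r := (1 - c) ^+ _; have r0 : 0 <= r by exact: c1X_ge0.
have [t' ht'] := eigenfunction_bdd.
have nug : `|nu g| <= t.
  case: (hg) => s [s' [_ hs' s0 s'0 ss']].
  by apply: (nu_norm H _ hg) => x; have := hs' x; rewrite /rabs; lra.
have := nug; rewrite ler_norml => /andP[nug1 nug2].
pose g1 := fun x : SFT A => t + g x.
have cg1 : cone theta a0 g1 by exact: (bdd_lip_cone H hg).
have nu_g1 : nu g1 = t + nu g.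
  have -> : g1 = fun x => 1 * g x + t by apply/funext => x; rewrite /g1 mul1r addrC.
  by rewrite (nu_lin H _ 1 hg (bdd_lip_cst A theta t)) (nu_cst H) mul1r addrC.
have cone_h k : 0 <= k -> cone theta a0 (fun x => k * h x).
  by move=> k0; exact: coneZ k0 eigenfunction_cone0.
have nu_h k : nu (fun x => k * h x) = k.
  by rewrite (nuZ H _ _ ht') nu_eigenfunction mulr1.
have ct : cone theta a0 (fun _ : SFT A => t) by exact: (cone_cst A htheta a0_ge0).
have tg0 : 0 <= t + nu g by lra.
have [|s1 l1] := contraction n cg1 (cone_h _ tg0); first by rewrite nu_h.
have [|s2 l2] := contraction n ct (cone_h _ t0); first by rewrite nu_h (nu_cst H).
have LhE k : Ln n (fun x => k * h x) = fun x => k * h x.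
  have -> : (fun x => k * h x) = fun x => k * h x + (fun=> 0) x.
    by apply/funext => x; rewrite addr0.
  rewrite normalized_lin normalized_eigenfunction; apply/funext => x.
  rewrite /Ln (_ : (fun=> 0) = fun x => 0 * h x) ?iter_transferZ; first by rewrite mul0r mulr0.
  by apply/funext => y; rewrite mul0r.
have E x : Ln n g x - h x * nu g =
   (Ln n g1 x - Ln n (fun x => (t + nu g) * h x) x) -
   (Ln n (fun=> t) x - Ln n (fun x => t * h x) x).
  have -> : Ln n g1 x = Ln n (fun=> t) x + Ln n g x.
    have -> : g1 = fun x => 1 * g x + t by apply/funext => y; rewrite /g1 mul1r addrC.
    by rewrite normalized_lin mul1r addrC.
  by rewrite !LhE; ring.
rewrite -/r nu_g1 (nu_cst H) in s1 l1 s2 l2.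
have rS0 : 0 <= S * r by rewrite mulr_ge0// (le_trans ler01).
have T0 : 0 <= 3 * t * (S * r) by rewrite mulr_ge0// mulr_ge0.
exists (2 * a0 * (3 * t * (S * r))), (3 * t * (S * r)); split.
- move=> k x y xy; rewrite !E.
  have := l1 _ _ _ xy; have := l2 _ _ _ xy; rewrite /rabs !ler_norml.
  have th0 : 0 <= 2 * a0 * (S * r) * theta ^+ k.
    by rewrite mulr_ge0 ?exprn_ge0 ?(ltW theta_gt0)// mulr_ge0// mulr_ge0.
  have := ler_wpM2r th0 nug2.
  by move=> ? /andP[? ?] /andP[? ?]; apply/andP; split; lra.
- move=> x; rewrite E.
  have := s1 x; have := s2 x; rewrite /rabs !ler_norml.
  have := ler_wpM2r rS0 nug2.
  by move=> ? /andP[? ?] /andP[? ?]; apply/andP; split; lra.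
- by rewrite mulr_ge0// mulr_ge0.
- by [].
- by lra.
Qed.

End SpectralGap.

(** * Topology of the shift space *)

Section ShiftTopology.
Variables (q : nat) (A : 'M[nat]_q).

Definition cylinder (p : full_shift q) n : set (full_shift q) :=
  [set y | forall i, (i <= n)%N -> y i = p i].

Lemma nbhs_coordinate (p : full_shift q) i : nbhs p [set y | y i = p i].
Proof.
have := @proj_continuous nat (fun _ => discrete_topology 'I_q) i p.
move=> /(_ [set p i]); apply.
by rewrite nbhs_principalE; exact/principal_filterP.
Qed.

Lemma cylinder_nbhs p n : nbhs p (cylinder p n).
Proof.
elim: n => [|n IH].
  by apply: filterS (nbhs_coordinate p 0) => y yp i; rewrite leqn0 => /eqP ->.
apply: filterS (filterI IH (nbhs_coordinate p n.+1)) => y [h1 h2] i.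
by rewrite leq_eqVlt ltnS => /predU1P[->//|]; exact: h1.
Qed.

Let cylinders p : set_system (full_shift q) := filter_from setT (cylinder p).

Let cylinders_filter p : Filter (cylinders p).
Proof.
apply: filter_from_filter; first by exists 0%N.
move=> i j _ _; exists (maxn i j) => // y h; split=> k hk; apply: h.
  by rewrite (leq_trans hk)// leq_maxl.
by rewrite (leq_trans hk)// leq_maxr.
Qed.

Lemma nbhs_cylinder (p : full_shift q) V : nbhs p V -> exists n, cylinder p n `<=` V.
Proof.
(* The cylinders form a filter; it converges to p in every factor, hence in the product. *)
suff : cylinders p --> (p : full_shift q) by move=> /[apply] -[n _ h]; exists n.
have FF := cylinders_filter p.
apply/(@cvg_sup (forall i : nat, discrete_topology 'I_q) nat) => i W.
rewrite nbhsE => -[G [[G' oG' <-] Gp]] GW; exists i => // y yp.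
by apply: GW; rewrite /= (yp i).
Qed.

Lemma SFT_nbhsP (x : SFT A) (U : set (SFT A)) :
  nbhs x U <-> exists n, forall y, agree n x y -> U y.
Proof.
split=> [|[n hn]].
  rewrite nbhsE => -[G [[V oV <-] Vx] GU].
  have [n hn] := nbhs_cylinder (open_nbhs_nbhs (conj oV Vx)).
  by exists n => y xy; apply: GU; apply: hn => i /xy.
have [V [oV Vx VU]] : exists V : set (full_shift q),
    [/\ open V, V (set_val x) & V `<=` cylinder (set_val x) n].
  have := cylinder_nbhs (set_val x) n; rewrite nbhsE => -[V [oV Vx] VU].
  by exists V.
rewrite nbhsE; exists (set_val @^-1` V).
  by split => //; exists V.
by move=> y /VU h; apply: hn => i ni; rewrite /coordinate h.
Qed.

Lemma SFT_openP (U : set (SFT A)) :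
  open U <-> forall x, U x -> exists n, forall y, agree n x y -> U y.
Proof.
rewrite openE; split=> h x /h; first by move/SFT_nbhsP.
by move=> ?; apply/SFT_nbhsP.
Qed.

Lemma full_shift_compact : compact [set: full_shift q].
Proof.
have := @tychonoff nat (fun _ => discrete_topology 'I_q) (fun _ => setT).
rewrite (_ : [set f | _] = setT); first by apply => i; apply: finite_compact; exact: (@finite_finset 'I_q).
by apply/seteqP; split.
Qed.

(** The form in which compactness is used. Points u n outside U n cluster at some p in the full
    shift. Long initial words of p occur in the u n, so p is admissible, and an open U n around p
    then captures some u l with l >= n. *)
Lemma increasing_cover (U : nat -> set (SFT A)) :
  (forall n, open (U n)) -> (forall n m, (n <= m)%N -> U n `<=` U m) ->
  (forall x, exists n, U n x) -> exists n, forall x, U n x.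
Proof.
move=> oU mU cU; apply: contrapT => /forallNP hn.
have {hn} /choice[u hu] n : exists x, ~ U n x by apply/existsNP; exact: hn.
have [p [_ cp]] := full_shift_compact (F := (set_val \o u) @ \oo) _ filterT.
have close n k : exists2 l, (k <= l)%N & forall i, (i <= n)%N -> coordinate (u l) i = p i.
  have [|y [/= [l kl <-] ly]] := cp ((set_val \o u) @` [set l | (k <= l)%N])
    (cylinder p n) _ (cylinder_nbhs p n).
    by exists k => // l /= kl; exists l.
  by exists l.
have adm : p \in admissible A.
  apply/mem_set => i; have [l _ hl] := close i.+1 0%N.
  by rewrite -!hl//; exact: coordinate_admissible.
pose x : SFT A := exist _ p adm.
have [n /((SFT_openP _).1 (oU n))[k hk]] := cU x.
have [l nl hl] := close k n.
by apply: (hu l); apply: mU nl _ _; apply: hk => i ik; rewrite hl.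
Qed.

Lemma SFT_uniform_continuity (R : realType) (g : SFT A -> R) e : continuous g -> 0 < e ->
  exists n, forall x y, agree n x y -> `|g x - g y| < e.
Proof.
move=> cg e0.
pose U n := [set x | forall y z, agree n x y -> agree n x z -> `|g y - g z| < e].
have [| | |n hn] := @increasing_cover U.
- move=> n; apply/SFT_openP => x Ux; exists n => y xy z t yz yt.
  by apply: Ux; exact: agree_trans xy _.
- move=> n k nk x Ux y z xy xz; apply: Ux; exact: agree_le nk _.
- move=> x; have /cvgrPdist_lt/(_ (e / 2)) := cg x.
  rewrite divr_gt0// => /(_ isT) /SFT_nbhsP[n hn]; exists n => y z xy xz.
  rewrite (_ : g y - g z = (g x - g z) - (g x - g y)); last by ring.
  rewrite [e]splitr (le_lt_trans (ler_normB _ _))// ltrD//; exact: hn.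
- by exists n => x y xy; apply: (hn x).
Qed.

Lemma SFT_bounded (R : realType) (g : SFT A -> R) : continuous g ->
  exists t, forall x, `|g x| <= t.
Proof.
move=> cg; have [| | |n hn] := @increasing_cover (fun n => [set x | `|g x| < n%:R]).
- move=> n; apply/SFT_openP => x /=; rewrite -subr_gt0 => gx.
  have /cvgrPdist_lt/(_ _ gx)/SFT_nbhsP[k hk] := cg x; exists k => y /hk h.
  have := ler_normB (g x) (g x - g y); rewrite subKr; move: h; lra.
- by move=> n k nk x /= /lt_le_trans; apply; rewrite ler_nat.
- by move=> x; exists (Num.truncn `|g x|).+1; rewrite /= truncnS_gt.
- by exists n%:R => x; exact/ltW/hn.
Qed.

Lemma lip_continuous (R : realType) (theta s : R) (g : SFT A -> R) :
  0 < theta < 1 -> lip_le rabs theta s g -> continuous g.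
Proof.
move=> /andP[th0 th1] hg x; apply/(@cvgrPdist_le _ _ _ (nbhs x) (nbhs_filter x)) => e e0.
have : geometric s theta @ \oo --> 0 by apply: cvg_geometric; rewrite gtr0_norm.
move=> /cvgrPdist_le /(_ _ e0) [n _ /(_ n (leqnn _))]; rewrite sub0r normrN => h.
apply/SFT_nbhsP; exists n => y /hg; rewrite /rabs => /le_trans; apply.
exact: le_trans (ler_norm _) h.
Qed.

(** The finite unions of cylinders: a clopen algebra that generates the Borel sets. *)
Definition determined (C : set (SFT A)) :=
  exists k, forall x y, agree k x y -> C x -> C y.

Lemma determinedC C : determined C -> determined (~` C).
Proof. by move=> [k h]; exists k => x y xy Cx Cy; apply: Cx; exact: h (agree_sym xy) Cy. Qed.

Lemma determinedU C D : determined C -> determined D -> determined (C `|` D).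
Proof.
move=> [k h] [l h']; exists (maxn k l) => x y xy [Cx|Dx].
  by left; apply: h Cx; apply: agree_le xy; rewrite leq_maxl.
by right; apply: h' Dx; apply: agree_le xy; rewrite leq_maxr.
Qed.

Lemma determined0 : determined set0. Proof. by exists 0%N. Qed.
Lemma determinedT : determined setT. Proof. by exists 0%N. Qed.

Lemma determinedI C D : determined C -> determined D -> determined (C `&` D).
Proof.
by move=> hC hD; rewrite -[C `&` D]setCK setCI; apply/determinedC/determinedU; exact: determinedC.
Qed.

Lemma determined_open C : determined C -> open C.
Proof. by move=> [k h]; apply/SFT_openP => x Cx; exists k => y xy; exact: h xy Cx. Qed.

Lemma open_bigcup_determined (U : set (SFT A)) : open U ->
  exists C : nat -> set (SFT A), (forall n, determined (C n)) /\ U = \bigcup_n C n.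
Proof.
move=> /SFT_openP oU; exists (fun n => [set x | forall y, agree n x y -> U y]); split.
  by move=> n; exists n => x y xy h z yz; apply: h; exact: agree_trans yz.
apply/seteqP; split=> [x /oU[n hn]|x [n _]]; first by exists n.
by apply; exact: agree_refl.
Qed.

Lemma sigma_determined : <<s determined >> = <<s (@open (SFT A)) >>.
Proof.
apply/seteqP; split.
  apply: smallest_sub; first exact: smallest_sigma_algebra.
  by move=> C /determined_open oC; exact: sub_sigma_algebra.
apply: smallest_sub; first exact: smallest_sigma_algebra.
move=> U /open_bigcup_determined[C [dC ->]].
by apply: sigma_algebra_bigcup => n; apply: sub_sigma_algebra.
Qed.

End ShiftTopology.

(** * The eigenmeasure *)

Section Representation.
Variables (R : realType) (q : nat) (A : 'M[nat]_q) (x0 : SFT A).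

Definition locally_constant (g : SFT A -> R) :=
  exists k, forall x y, agree k x y -> g x = g y.

(* The algebra of determined sets on SFT A, on which a positive functional
   defines a premeasure. *)
Definition determined_SFT (x : SFT A) : Type := SFT A.

Section instances.
Variable x : SFT A.
HB.instance Definition _ := Choice.on (determined_SFT x).
HB.instance Definition _ := isPointed.Build (determined_SFT x) x.
HB.instance Definition _ := @isAlgebraOfSets.Build default_measure_display
  (determined_SFT x) (@determined q A) (@determined0 q A) (@determinedU q A)
  (@determinedC q A).
End instances.

Variable I : (SFT A -> R) -> R.
Hypothesis I_lin : forall c g u, locally_constant g -> locally_constant u ->
  I (fun x => c * g x + u x) = c * I g + I u.
Hypothesis I_ge0 : forall g, locally_constant g -> (forall x, 0 <= g x) -> 0 <= I g.
Hypothesis I1 : I (fun=> 1) = 1.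

Lemma locally_constant_indic C : determined C -> locally_constant (\1_C : SFT A -> R).
Proof.
move=> [k h]; exists k => x y xy; rewrite !indicE; congr (_%:R); congr nat_of_bool.
by apply/idP/idP => /set_mem hC; apply/mem_set; apply: h hC => //; exact: agree_sym.
Qed.

Lemma locally_constant_cst c : locally_constant (fun=> c).
Proof. by exists 0%N. Qed.

(* The absolute value makes this nonnegative also off the determined sets. *)
Definition premeasure (C : set (determined_SFT x0)) : \bar R :=
  (`|I (\1_C : SFT A -> R)|)%:E.

Let premeasure_ge0 C : (0 <= premeasure C)%E.
Proof. by rewrite lee_fin. Qed.

Let premeasureE C : determined C -> premeasure C = (I (\1_C : SFT A -> R))%:E.
Proof.
move=> dC; rewrite /premeasure ger0_norm// I_ge0//; exact: locally_constant_indic.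
Qed.

Let premeasure0 : premeasure set0 = 0%E.
Proof.
rewrite premeasureE; last exact: determined0.
have := I_lin (-1) (locally_constant_cst 1) (locally_constant_cst 1).
rewrite (mulN1r (I _)) addNr => I0; congr (_%:E); rewrite -[RHS]I0.
by congr I; apply/funext => x; rewrite indic0 mulr1 addNr.
Qed.

Let premeasure_additive : measure_function.semi_additive premeasure.
Proof.
apply/(additive2P premeasure0) => C D dC dD CD.
rewrite !premeasureE//; last exact: determinedU.
rewrite -EFinD; congr (_%:E).
have := I_lin 1 (locally_constant_indic dC) (locally_constant_indic dD).
rewrite mul1r => <-; congr I; apply/funext => x.
rewrite mul1r !indicE in_setU.
have [xC|] := boolP (x \in C); last by rewrite add0r.
have [xD|] := boolP (x \in D); last by rewrite addr0.
have : set0 x by rewrite -CD; split; exact: set_mem.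
by [].
Qed.

HB.instance Definition _ := isContent.Build _ _ R premeasure
  premeasure_ge0 premeasure_additive.

Let premeasure_sigma_subadditive : measurable_subset_sigma_subadditive premeasure.
Proof.
move=> C D mD mC CD.
(* With the complement of C thrown in, [increasing_cover] shows that finitely many D i already cover
   C, so finite subadditivity is enough. *)
pose U n := ~` C `|` \big[setU/set0]_(i < n) D i.
have dU n : determined (\big[setU/set0]_(i < n) D i).
  by apply: (@bigsetU_measurable _ (determined_SFT x0)) => i _; exact: mD.
have [| | |n hn] := @increasing_cover q A U.
- by move=> n; apply: determined_open; apply: determinedU => //; exact: determinedC.
- by move=> n k nk; apply: setUS; exact: subset_bigsetU.
- move=> x; have [/CD[i _ Di]|nCx] := pselect (C x); last by exists 0%N; left.
  by exists i.+1; right; rewrite big_ord_recr; right.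
apply: (@le_trans _ _ (\sum_(i < n) premeasure (D i))%E).
  apply: (content_subadditive premeasure) => // x Cx.
  by have [] := hn x.
rewrite -(big_mkord xpredT (premeasure \o D)).
by apply: nneseries_lim_ge => i _ _; exact: premeasure_ge0.
Qed.

HB.instance Definition _ := Content_SigmaSubAdditive_isMeasure.Build _ R _ premeasure
  premeasure_sigma_subadditive.

(** The Caratheodory extension lives on the sigma-algebra generated by the determined sets. It is
    restated on [borel_SFT x0], whose sigma-algebra is the same by [sigma_determined]. *)
Definition represented (C : set (borel_SFT x0)) : \bar R := measure_extension premeasure C.

Let measurable_borel (C : set (borel_SFT x0)) : measurable C = <<s (@determined q A) >> C.
Proof. by rewrite sigma_determined. Qed.

Let represented0 : represented set0 = 0%E.
Proof. exact: measure0. Qed.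

Let represented_ge0 C : (0 <= represented C)%E.
Proof. exact: measure_ge0. Qed.

Let represented_sigma_additive : semi_sigma_additive represented.
Proof.
move=> F mF tF mUF; apply: (measure_semi_sigma_additive (s := measure_extension premeasure)) => //.
  by move=> i; have := mF i; rewrite measurable_borel.
by move: mUF; rewrite measurable_borel.
Qed.

HB.instance Definition _ := isMeasure.Build _ _ R represented
  represented0 represented_ge0 represented_sigma_additive.

Let representedE C : determined C -> represented C = (I (\1_C : SFT A -> R))%:E.
Proof.
by move=> dC; rewrite -premeasureE// /represented /measure_extension measurable_mu_extE.
Qed.

Let represented1 : represented setT = 1%E.
Proof.
rewrite representedE; last exact: determinedT.
by rewrite indicT I1.
Qed.

HB.instance Definition _ := Measure_isProbability.Build _ _ R represented represented1.

Lemma representation : exists P : probability (borel_SFT x0) R,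
  forall C, determined C -> P C = (I (\1_C : SFT A -> R))%:E.
Proof. by exists represented; exact: representedE. Qed.

End Representation.

(** * Approximation by functions of finitely many coordinates *)

Section Discretization.
Variables (q : nat) (A : 'M[nat]_q) (x0 : SFT A).

Definition word k (x : SFT A) : {ffun 'I_k.+1 -> 'I_q} := [ffun i : 'I_k.+1 => coordinate x i].

Lemma word_agree k x y : word k x = word k y <-> agree k x y.
Proof.
split=> [/ffunP h i ik|xy].
  by have := h (Ordinal (ik : (i < k.+1)%N)); rewrite !ffunE.
by apply/ffunP => i; rewrite !ffunE xy// -ltnS.
Qed.

(** A representative of w, with the junk value [x0] when no point begins with w. *)
Definition word_point k (w : {ffun 'I_k.+1 -> 'I_q}) : SFT A :=
  xget x0 [set x | word k x = w].

Lemma word_pointK k x : agree k (word_point (word k x)) x.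
Proof.
apply/word_agree.
by apply: (@xgetI _ x0 [set y | word k y = word k x] x).
Qed.

Variable R : realType.
Implicit Types (g : SFT A -> R).

Definition discretize k g : SFT A -> R := fun x => g (word_point (word k x)).

Lemma discretize_const k g x y : agree k x y -> discretize k g x = discretize k g y.
Proof. by move=> /word_agree xy; rewrite /discretize xy. Qed.

Definition cyl k w : SFT A -> R := \1_[set x | word k x = w].

Lemma cylE k w x : cyl w x = (word k x == w)%:R.
Proof.
rewrite /cyl indicE; congr (nat_of_bool _)%:R.
by apply/idP/eqP => [/set_mem//|h]; exact/mem_set.
Qed.

Lemma discretizeE k g :
  discretize k g = fun x => \sum_w g (word_point w) * cyl (k := k) w x.
Proof.
apply/funext => x; rewrite (bigD1 (word k x))//= big1 ?addr0.
  by rewrite cylE eqxx mulr1.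
by move=> w; rewrite eq_sym cylE => /negPf ->; rewrite mulr0.
Qed.

Lemma determined_cyl k w : determined [set x : SFT A | word k x = w].
Proof. by exists k => x y /word_agree /= <-. Qed.

Lemma locally_constant_continuous g : locally_constant g -> continuous g.
Proof.
move=> [k hk] x; apply/(@cvgrPdist_le _ _ _ (nbhs x) (nbhs_filter x)) => e e0.
by apply/SFT_nbhsP; exists k => y /hk ->; rewrite subrr normr0 ltW.
Qed.

(** Beyond scale k the variation vanishes; earlier scales are absorbed into the constant, as 2 t <=
    (2 t / theta^k) theta^j for j < k. *)
Lemma locally_constant_bdd (theta : R) g : 0 < theta < 1 -> locally_constant g ->
  exists t, bdd_lip theta t g.
Proof.
move=> /andP[th0 th1] hg; have [t ht] := SFT_bounded (locally_constant_continuous hg).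
have [k hk] := hg.
have t0 : 0 <= t by exact: le_trans (ht x0).
have thk : 0 < theta ^+ k by rewrite exprn_gt0.
exists (2 * t / theta ^+ k + t), (2 * t / theta ^+ k), t; split => //; last first.
  by rewrite divr_ge0 ?mulr_ge0 ?(ltW thk).
move=> j x y xy; rewrite /rabs; have [kj|jk] := leqP k j.
  rewrite (hk x y) ?subrr ?normr0; last exact: agree_le xy.
  by rewrite mulr_ge0 ?divr_ge0 ?mulr_ge0 ?exprn_ge0 ?(ltW thk) ?(ltW th0).
apply: (@le_trans _ _ (2 * t)).
  apply: (le_trans (ler_normB _ _)); have := ht x; have := ht y; lra.
rewrite mulrAC ler_pdivlMr// ler_wpM2l ?mulr_ge0//.
by apply: ler_wiXn2l; [exact: ltW|exact: ltW|exact: ltnW].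
Qed.

End Discretization.

Section ContinuousCombination.
Variables (R : realType) (q : nat) (A : 'M[nat]_q).
Implicit Types (g u : SFT A -> R).

Lemma continuousZ_SFT c g : continuous g -> continuous (fun x => c * g x).
Proof.
move=> cg x; have FF := nbhs_filter x.
by apply: (@cvgMl_tmp _ _ (nbhs x) FF); exact (cg x).
Qed.

Lemma continuousD_SFT g u : continuous g -> continuous u ->
  continuous (fun x => g x + u x).
Proof.
move=> cg cu x; have FF := nbhs_filter x.
exact (@cvgD _ _ _ (nbhs x) FF _ _ _ _ (cg x) (cu x)).
Qed.

Lemma continuous_cst_SFT (k : R) : continuous (fun _ : SFT A => k).
Proof. by move=> x; have FF := nbhs_filter x; apply: cvg_cst. Qed.

End ContinuousCombination.

Section Integration.
Variables (R : realType) (q : nat) (A : 'M[nat]_q) (x0 : SFT A).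
Variable P : probability (borel_SFT x0) R.
Implicit Types (g u : SFT A -> R).

Lemma continuous_measurable g : continuous g ->
  measurable_fun [set: borel_SFT x0] (g : borel_SFT x0 -> R).
Proof.
move=> /continuousP cg.
apply: (measurability _ (RGenOInfty.measurableE R)) => _ [_ [a ->] <-].
rewrite setTI; apply: sub_sigma_algebra.
by apply: cg; exact: interval_open.
Qed.

Lemma continuous_integrable g : continuous g ->
  P.-integrable setT (EFin \o (g : borel_SFT x0 -> R)).
Proof.
move=> cg; have [t ht] := SFT_bounded cg.
apply: measurable_bounded_integrable => //.
- by rewrite (le_lt_trans (probability_le1 P measurableT)) ?ltry.
- exact: continuous_measurable.
exists t; split; first exact: num_real.
by move=> M tM x _; apply: le_trans (ht x) (ltW tM).
Qed.

Lemma integral_lin c g u : continuous g -> continuous u ->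
  \int[P]_x (c * g x + u x) = c * (\int[P]_x g x) + \int[P]_x u x.
Proof.
move=> cg cu.
have ig := continuous_integrable cg; have iu := continuous_integrable cu.
have cc := continuousZ_SFT (c := c) cg.
by rewrite (RintegralD measurableT (continuous_integrable cc) iu) RintegralZl.
Qed.

Lemma integral_cst c : \int[P]_x c = c.
Proof.
rewrite Rintegral_cst// [X in c * X](_ : _ = 1) ?mulr1//.
exact: (congr1 fine (probability_setT P)).
Qed.

Lemma integral_le g u : continuous g -> continuous u -> (forall x, g x <= u x) ->
  \int[P]_x g x <= \int[P]_x u x.
Proof. by move=> cg cu gu; apply: le_Rintegral => //; exact: continuous_integrable. Qed.

Lemma integral_dist g u e : continuous g -> continuous u ->
  (forall x, `|g x - u x| <= e) -> `|\int[P]_x g x - \int[P]_x u x| <= e.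
Proof.
move=> cg cu gu.
have h : \int[P]_x ((-1) * u x + g x) = \int[P]_x g x - \int[P]_x u x.
  by rewrite integral_lin// mulN1r addrC.
have cgu : continuous (fun x => (-1) * u x + g x).
  exact: continuousD_SFT (continuousZ_SFT cu) cg.
have cc k := @continuous_cst_SFT R q A k.
rewrite -h ler_norml; apply/andP; split.
  rewrite -[leLHS](integral_cst (- e)); apply: integral_le => // x.
  by have := gu x; rewrite ler_norml => /andP[]; lra.
rewrite -[leRHS](integral_cst e); apply: integral_le => // x.
by have := gu x; rewrite ler_norml => /andP[]; lra.
Qed.

Lemma integral_sum (J : finType) (c : J -> R) (u_ : J -> SFT A -> R) :
  (forall i, continuous (u_ i)) ->
  \int[P]_x (\sum_i c i * u_ i x) = \sum_i c i * \int[P]_x u_ i x.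
Proof.
move=> cu.
suff h (s : seq J) : \int[P]_x (\sum_(i <- s) c i * u_ i x) =
    \sum_(i <- s) c i * \int[P]_x u_ i x by exact: h.
elim: s => [|i s IH].
  by rewrite big_nil -[RHS](integral_cst 0); apply: eq_Rintegral => x _; rewrite big_nil.
rewrite big_cons -IH -integral_lin//.
  by apply: eq_Rintegral => x _; rewrite big_cons.
elim: s {IH} => [|j s IH].
  rewrite (_ : (fun x => _) = fun=> 0); first exact: continuous_cst_SFT.
  by apply/funext => y; rewrite big_nil.
rewrite (_ : (fun x => _) = fun x => c j * u_ j x + \sum_(i <- s) c i * u_ i x); last first.
  by apply/funext => y; rewrite big_cons.
exact: continuousD_SFT (continuousZ_SFT (cu j)) IH.
Qed.

Lemma integral_cyl k w : \int[P]_x cyl R (k := k) w x = fine (P [set x | word k x = w]).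
Proof.
rewrite /Rintegral /cyl integral_indic// ?setIT//.
by apply: sub_sigma_algebra; exact/determined_open/determined_cyl.
Qed.

End Integration.

Lemma transfer_continuous (R : realType) (q : nat) (A : 'M[nat]_q) (f g : SFT A -> R) :
  continuous f -> continuous g -> continuous (transfer f g).
Proof.
move=> cf cg; pose u y := expR (f y) * g y.
have cu : continuous u.
  move=> x; have FF := nbhs_filter x.
  have ce : {for x, continuous (expR \o f)}.
    exact: continuous_comp (cf x) (@continuous_expR R (f x)).
  exact (@cvgM _ _ (nbhs x) FF _ _ _ _ ce (cg x)).
move=> x; apply/(@cvgrPdist_le _ _ _ (nbhs x) (nbhs_filter x)) => e e0.
(* The denominator q + 1 avoids a separate case q = 0. *)
have q0 : 0 < q%:R + 1 :> R by rewrite ltr_wpDl.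
have [k hk] := SFT_uniform_continuity cu (divr_gt0 e0 q0).
apply/SFT_nbhsP; exists k => y xy; rewrite !transferE -(xy 0%N)//.
rewrite -sumrB; apply: (le_trans (ler_norm_sum _ _ _)).
apply: (@le_trans _ _ (\sum_(i < q) e / (q%:R + 1))).
  rewrite big_mkcond/=; apply: ler_sum => i _; case: ifP => [/eqP ix|_].
    by apply/ltW/(hk (prepend i x)); exact: agree_le (agree_prepend ix xy).
  by rewrite divr_ge0// ltW.
rewrite sumr_const card_ord -[_ *+ q]mulr_natr -mulrA ler_piMr ?(ltW e0)//.
by rewrite mulrC ler_pdivrMr// mul1r lerDl.
Qed.

Section Eigenmeasure.
Variables (R : realType) (q : nat) (A : 'M[nat]_q) (M : nat) (theta : R).
Variables (f : SFT A -> R) (b F : R) (m : nat).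
Implicit Types (g u : SFT A -> R) (t c e a : R).
Hypothesis H : ruelle_data M theta f b F m.

Let q_gt0 := ltnW (rd_q H).
Let htheta := rd_theta H.
Let f_lip := rd_lip H.

Variable x0 : SFT A.
Local Notation L := (transfer f).
Local Notation bdd := (bdd_lip theta).
Local Notation nu := (eigenfunctional f x0).
Local Notation lam := (eigenvalue f x0).

Let theta_gt0 : 0 < theta. Proof. by case/andP: htheta. Qed.
Let theta_lt1 : theta < 1. Proof. by case/andP: htheta. Qed.

Lemma bdd_continuous t g : bdd t g -> continuous g.
Proof. by move=> [s [s' [hs _ _ _ _]]]; exact: lip_continuous htheta hs. Qed.

Lemma eigenmeasure_exists : exists P : probability (borel_SFT x0) R,
  forall C, determined C -> P C = (nu (\1_C : SFT A -> R))%:E.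
Proof.
apply: representation => [c g u||].
- move=> /(locally_constant_bdd x0 htheta)[t ht] /(locally_constant_bdd x0 htheta)[t' ht'].
  exact: (nu_lin H x0 c ht ht').
- by move=> g /(locally_constant_bdd x0 htheta)[t ht]; exact: (nu_ge0 H x0 ht).
- exact: (nu1 H).
Qed.

Variable P : probability (borel_SFT x0) R.
Hypothesis hP : forall C, determined C -> P C = (nu (\1_C : SFT A -> R))%:E.

Lemma nu_sum (J : finType) (c : J -> R) (u_ : J -> SFT A -> R) :
  (forall i, exists t, bdd t (u_ i)) ->
  nu (fun x => \sum_i c i * u_ i x) = \sum_i c i * nu (u_ i).
Proof.
move=> hu.
suff h (s : seq J) : (exists t, bdd t (fun x => \sum_(i <- s) c i * u_ i x)) /\
    nu (fun x => \sum_(i <- s) c i * u_ i x) = \sum_(i <- s) c i * nu (u_ i).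
  exact: (h _).2.
elim: s => [|i s [[t ht] IH]].
  rewrite (_ : (fun x => _) = fun=> 0); last by apply/funext => y; rewrite big_nil.
  rewrite big_nil (nu_cst H); split => //.
  by exists `|0 : R|; exact: bdd_lip_cst.
have [t' ht'] := hu i.
rewrite (_ : (fun x => _) = fun x => c i * u_ i x + \sum_(i <- s) c i * u_ i x); last first.
  by apply/funext => y; rewrite big_cons.
split; first by eexists; exact: bdd_lip_lin ht' ht.
by rewrite (nu_lin H x0 _ ht' ht) IH big_cons.
Qed.

Lemma discretize_bdd k g : exists t, bdd t (discretize x0 k g).
Proof. by apply: (locally_constant_bdd x0 htheta); exists k => x y; exact: discretize_const. Qed.

Lemma cyl_bdd k w : exists t, bdd t (cyl R (A := A) (k := k) w).
Proof.
apply: (locally_constant_bdd x0 htheta); apply: locally_constant_indic.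
exact: determined_cyl.
Qed.

Lemma integral_discretize k g : \int[P]_x discretize x0 k g x = nu (discretize x0 k g).
Proof.
rewrite discretizeE nu_sum; last by move=> w; exact: cyl_bdd.
rewrite integral_sum; last by move=> w; have [t] := cyl_bdd w; exact: bdd_continuous.
apply: eq_bigr => w _; congr (_ * _).
by rewrite integral_cyl hP//; exact: determined_cyl.
Qed.

(** Both sides agree on [discretize x0 k g], a combination of cylinder indicators, and each moves by
    at most s theta^k when g is replaced by it. *)
Lemma integral_nu t g : bdd t g -> \int[P]_x g x = nu g.
Proof.
move=> hg; have cg := bdd_continuous hg.
have [s [s' [hs _ s0 _ _]]] := hg.
apply/eqP; rewrite -subr_eq0 -normr_le0; apply/ler_addgt0Pr => e e0; rewrite add0r.
have : geometric (2 * s) theta @ \oo --> 0 by apply: cvg_geometric; rewrite gtr0_norm.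
move=> /cvgrPdist_le /(_ _ e0) [k _ /(_ k (leqnn _))]; rewrite sub0r normrN => hk.
have {}hk : 2 * s * theta ^+ k <= e by apply: le_trans hk; exact: ler_norm.
have [t' ht'] := discretize_bdd k g.
have gd x : `|g x - discretize x0 k g x| <= s * theta ^+ k.
  by apply: hs; apply: agree_sym; exact: word_pointK.
have h1 := integral_dist P cg (bdd_continuous ht') gd.
have h2 : `|nu (discretize x0 k g) - nu g| <= s * theta ^+ k.
  have -> : nu (discretize x0 k g) - nu g = nu (fun x => (-1) * g x + discretize x0 k g x).
    by rewrite (nu_lin H x0 _ hg ht') mulN1r addrC.
  apply: (nu_norm H x0 (bdd_lip_lin (-1) hg ht')) => x.
  by rewrite mulN1r addrC distrC.
rewrite integral_discretize in h1.
have -> : \int[P]_x g x - nu g =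
    (\int[P]_x g x - nu (discretize x0 k g)) + (nu (discretize x0 k g) - nu g) by ring.
apply: (le_trans (ler_normD _ _)); lra.
Qed.

Lemma transfer_dist g u e x : (forall x, `|g x - u x| <= e) ->
  `|L g x - L u x| <= q%:R * expR F * e.
Proof.
move=> gu; have e0 : 0 <= e by exact: le_trans (gu x).
have h g' u' : (forall x, `|g' x - u' x| <= e) -> L g' x - L u' x <= q%:R * expR F * e.
  move=> gu'; have := iter_transfer_upper H 1 (g := fun x => g' x - u' x) e0 _ x.
  rewrite /= transferB expr1; apply => y; exact: le_trans (ler_norm _) (gu' y).
rewrite ler_norml h// andbT lerNl opprB h// => y.
by rewrite distrC.
Qed.

(** A merely continuous g is out of reach of [nu_transfer], which is applied to a discretization at
    uniform distance d; each side of the identity then moves by at most q e^F d. *)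
Lemma integral_transfer g : continuous g ->
  \int[P]_x L g x = lam * \int[P]_x g x.
Proof.
move=> cg.
have cf : continuous f by exact: lip_continuous htheta f_lip.
apply/eqP; rewrite -subr_eq0 -normr_le0; apply/ler_addgt0Pr => e e0; rewrite add0r.
pose k0 : R := q%:R * expR F.
have k0_gt0 : 0 < k0 by rewrite mulr_gt0 ?expR_gt0// ltr0n.
have d0 : 0 < e / (2 * k0) by rewrite divr_gt0// mulr_gt0.
have [k hk] := SFT_uniform_continuity cg d0.
set d := e / _ in d0 hk.
have gd x : `|g x - discretize x0 k g x| <= d.
  by apply/ltW/hk; apply: agree_sym; exact: word_pointK.
have [t ht] := discretize_bdd k g.
have [t' ht'] := bdd_lip_iter H x0 1 ht.
have h1 := integral_dist P cg (bdd_continuous ht) gd.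
have h2 := integral_dist P (transfer_continuous cf cg) (bdd_continuous ht')
  (fun x => transfer_dist x gd).
rewrite (integral_nu ht') /= (nu_transfer H _ ht) -(integral_nu ht) in h2.
set J := \int[P]_x discretize x0 k g x in h1 h2 *.
have l0 := eigenvalue_gt0 H x0.
have -> : \int[P]_x L g x - lam * \int[P]_x g x =
   (\int[P]_x L g x - lam * J) - lam * (\int[P]_x g x - J) by ring.
apply: (le_trans (ler_normB _ _)); rewrite normrM (gtr0_norm l0).
have h3 := ler_wpM2l (ltW l0) h1.
have h4 := ler_wpM2r (ltW d0) (eigenvalue_upper H x0).
have -> : e = k0 * d + k0 * d by rewrite /d; field; rewrite gt_eqF.
by apply: lerD => //; apply: (le_trans h3); exact: h4.
Qed.

End Eigenmeasure.

(** * The invariant density *)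

Section Density.
Variables (R : realType) (q : nat) (A : 'M[nat]_q) (x0 : SFT A).
Variables (P : probability (borel_SFT x0) R) (h : SFT A -> R).
Hypothesis h_cont : continuous h.
Hypothesis h_ge0 : forall x, 0 <= h x.
Hypothesis h_int : \int[P]_x h x = 1.

Definition density (B : set (borel_SFT x0)) : \bar R := (\int[P]_(x in B) (h x)%:E)%E.

Let density_meas D : measurable_fun D (EFin \o (h : borel_SFT x0 -> R)).
Proof.
apply: measurable_funTS; apply/measurable_EFinP.
exact: continuous_measurable.
Qed.

Let density0 : density set0 = 0%E.
Proof. by rewrite /density integral_set0. Qed.

Let density_ge0 B : (0 <= density B)%E.
Proof. by apply: integral_ge0 => x _; rewrite lee_fin. Qed.

Let density_sigma_additive : semi_sigma_additive density.
Proof.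
move=> F mF tF mUF; rewrite /density ge0_integral_bigcup//; last first.
  by move=> x _; rewrite lee_fin.
by apply: is_cvg_nneseries => n _ _; exact: density_ge0.
Qed.

HB.instance Definition _ := isMeasure.Build _ _ R density
  density0 density_ge0 density_sigma_additive.

Lemma integral_density C : measurable C -> density C =
  (\int[P]_x (\1_C x * h x)%:E)%E.
Proof.
move=> mC; rewrite /density integral_mkcond; apply: eq_integral => x _.
by rewrite patchE indicE; case: (x \in C); rewrite ?mul1r ?mul0r.
Qed.

Let density1 : density setT = 1%E.
Proof.
have := h_int; rewrite /Rintegral /density => <-; rewrite fineK//.
exact: integrable_fin_num (continuous_integrable P h_cont).
Qed.

HB.instance Definition _ := Measure_isProbability.Build _ _ R density density1.

Lemma shift_measurable : measurable_fun [set: borel_SFT x0]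
  (@sft_shift q A : borel_SFT x0 -> borel_SFT x0).
Proof.
apply: (@measurability _ _ (borel_SFT x0) (borel_SFT x0) setT (@sft_shift q A)
  (@open (SFT A)) erefl) => _ [U oU <-]; rewrite setTI.
apply: sub_sigma_algebra; apply/SFT_openP => x Ux.
have [n hn] := (SFT_openP _).1 oU _ Ux; exists n.+1 => y xy; apply: hn.
exact: agree_shift.
Qed.

Variables (f : SFT A -> R) (lam : R).
Hypothesis f_cont : continuous f.
Hypothesis lam_gt0 : 0 < lam.
Hypothesis P_dual : dual_eigenmeasure f lam P.
Hypothesis h_eig : transfer f h = fun x => lam * h x.

Lemma transfer_shift (g u : SFT A -> R) x :
  transfer f (fun y => u (sft_shift y) * g y) x = u x * transfer f g x.
Proof.
rewrite !transferE mulr_sumr; apply: eq_bigr => i /eqP ix.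
by rewrite shift_prepend// mulrCA.
Qed.

Let cont_indic (C : set (SFT A)) : determined C -> continuous (\1_C : SFT A -> R).
Proof. by move=> dC; apply: locally_constant_continuous; exact: locally_constant_indic. Qed.

Let determined_shift C : determined C -> determined (@sft_shift q A @^-1` C).
Proof.
move=> [k hk]; exists k.+1 => x y xy; apply: hk; exact: agree_shift.
Qed.

Let contM (g u : SFT A -> R) : continuous g -> continuous u -> continuous (fun x => g x * u x).
Proof.
by move=> cg cu x; have FF := nbhs_filter x; exact (@cvgM _ _ (nbhs x) FF _ _ _ _ (cg x) (cu x)).
Qed.

(** Since L ((1_C o sigma) h) = 1_C L h = lambda 1_C h, the dual equation gives equality of the two
    integrals after division by lambda. *)
Lemma density_shift C : determined C -> density (@sft_shift q A @^-1` C) = density C.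
Proof.
move=> dC; have dsC := determined_shift dC.
have mD D : determined D -> measurable (D : set (borel_SFT x0)).
  by move=> dD; apply: sub_sigma_algebra; exact: determined_open.
have fin D : determined D -> (\int[P]_x (\1_D x * h x)%:E)%E =
    (\int[P]_x (\1_D x * h x))%:E.
  move=> dD; rewrite /Rintegral fineK//.
  exact: integrable_fin_num (continuous_integrable P (contM (cont_indic dD) h_cont)).
rewrite !integral_density//; [|exact: mD|exact: mD].
rewrite !fin//; congr (_%:E).
apply: (mulfI (lt0r_neq0 lam_gt0)); rewrite -P_dual; last first.
  exact: contM (cont_indic dsC) h_cont.
rewrite -(RintegralZl lam measurableT (continuous_integrable P (contM (cont_indic dC) h_cont))).
apply: eq_Rintegral => x _.
have -> : (fun x => \1_(@sft_shift q A @^-1` C) x * h x) =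
    fun x => (\1_C : SFT A -> R) (sft_shift x) * h x.
  by apply/funext => y; rewrite !indicE; congr (_%:R * _).
by rewrite transfer_shift h_eig mulrCA.
Qed.

(** The pushforward by the shift and the measure itself agree on the determined sets, a pi-system
    that generates the Borel sets. *)
Lemma density_invariant : shift_invariant density.
Proof.
move=> B mB.
pose m1 := measure_function_pushforward__canonical__measure_function_Measure
  density shift_measurable.
suff : m1 B = density B by [].
apply: (@measure_unique _ R (borel_SFT x0) (@determined q A) (fun=> setT)) => //.
- by rewrite sigma_determined.
- by move=> C D; exact: determinedI.
- by move=> _; exact: determinedT.
- by rewrite bigcup_const//; exists 0%N.
- by move=> C dC; exact: density_shift.
- by move=> _; rewrite /= /pushforward preimage_setT density1 ltry.
Qed.

Lemma density_probability : exists Q : probability (borel_SFT x0) R,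
  has_density h P Q /\ shift_invariant Q.
Proof. by exists density; split; [move=> B mB|exact: density_invariant]. Qed.

End Density.

(** * Neumann series and complexification *)

Section ComplexModulus.
Variable R : realType.
Implicit Types z w : R[i].

Lemma cabsE z : `|z| = (cabs z)%:C%C.
Proof. by case: z => a c; rewrite /cabs normc_def. Qed.

Lemma cabs_ge0 z : 0 <= cabs z.
Proof. by have := normr_ge0 z; rewrite cabsE lecR. Qed.

Lemma cabsM z w : cabs (z * w) = cabs z * cabs w.
Proof. by apply: complexI; rewrite rmorphM -!cabsE normrM. Qed.

Lemma cabsD z w : cabs (z + w) <= cabs z + cabs w.
Proof. by have := ler_normD z w; rewrite !cabsE -rmorphD lecR. Qed.

Lemma cabsN z : cabs (- z) = cabs z.
Proof. by apply: complexI; rewrite -!cabsE normrN. Qed.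

Lemma cabs_eq0 z : cabs z = 0 -> z = 0.
Proof. by move=> z0; apply/eqP; rewrite -normr_eq0 cabsE z0. Qed.

Lemma cabsV z : cabs z^-1 = (cabs z)^-1.
Proof. by apply: complexI; rewrite fmorphV -!cabsE normfV. Qed.

Lemma cabsX z n : cabs (z ^+ n) = cabs z ^+ n.
Proof. by apply: complexI; rewrite rmorphXn -!cabsE normrX. Qed.

Lemma cabs_real (a : R) : cabs a%:C%C = `|a|.
Proof. by apply: complexI; rewrite -cabsE normc_def /= expr0n addr0 sqrtr_sqr. Qed.

Lemma cabs_Re z : `|complex.Re z| <= cabs z.
Proof.
case: z => a c; rewrite /cabs normc_def /= -sqrtr_sqr ler_sqrt.
  by rewrite lerDl sqr_ge0.
by rewrite addr_ge0 ?sqr_ge0.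
Qed.

Lemma cabs_Im z : `|complex.Im z| <= cabs z.
Proof.
case: z => a c; rewrite /cabs normc_def /= -sqrtr_sqr ler_sqrt.
  by rewrite lerDr sqr_ge0.
by rewrite addr_ge0 ?sqr_ge0.
Qed.

Lemma cabs_ReIm z : cabs z <= `|complex.Re z| + `|complex.Im z|.
Proof.
case: z => a c /=.
rewrite (_ : (a +i* c)%C = a%:C%C + 'i%C * c%:C%C); last by simpc.
apply: le_trans (cabsD _ _) _; rewrite cabsM !cabs_real.
suff -> : cabs 'i%C = 1 :> R by rewrite mul1r.
by rewrite /cabs normc_def /= expr0n expr1n add0r sqrtr1.
Qed.

End ComplexModulus.

Section Neumann.
Variables (R : realType) (V : lmodType R[i]) (E : set V) (nrm : V -> R).
Implicit Types (u v : V) (z : R[i]).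

Hypothesis E_lin : forall z u v, E u -> E v -> E (z *: u + v).
Hypothesis nrm_ge0 : forall u, 0 <= nrm u.
Hypothesis nrmD : forall u v, E u -> E v -> nrm (u + v) <= nrm u + nrm v.
Hypothesis nrmZ : forall z u, E u -> nrm (z *: u) <= cabs z * nrm u.
Hypothesis nrm0_eq0 : forall u, E u -> nrm u = 0 -> u = 0.
(** Geometric increments are all that a Neumann series needs. The factor 4 is that of
    [holder_complete]: 2 for real and imaginary parts, 2 for the two terms of the norm. *)
Hypothesis nrm_complete : forall (s : nat -> V) (K r : R), (forall n, E (s n)) ->
  0 <= r < 1 -> (forall n, nrm (s n.+1 - s n) <= K * r ^+ n) ->
  exists l, E l /\ forall n, nrm (l - s n) <= 4 * K * r ^+ n / (1 - r).

Variables (T : V -> V) (C r : R).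
Hypothesis C_ge0 : 0 <= C.
Hypothesis r_ge0 : 0 <= r.
Hypothesis T_E : forall u, E u -> E (T u).
Hypothesis T_lin : forall z u v, E u -> E v -> T (z *: u + v) = z *: T u + T v.
Hypothesis T_pow : forall n u, E u -> nrm (iter n T u) <= C * r ^+ n * nrm u.

Lemma normed_E0 u : E u -> E 0.
Proof. by move=> Eu; have := E_lin (-1) Eu Eu; rewrite scaleN1r addNr. Qed.

Lemma normed_EZ z u : E u -> E (z *: u).
Proof. by move=> Eu; have := E_lin z Eu (normed_E0 Eu); rewrite addr0. Qed.

Lemma normed_EB u v : E u -> E v -> E (u - v).
Proof. by move=> Eu Ev; have := E_lin (-1) Ev Eu; rewrite scaleN1r addrC. Qed.

Lemma nrmB u v : E u -> E v -> nrm (u - v) <= nrm u + nrm v.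
Proof.
move=> Eu Ev; apply: le_trans (nrmD Eu _) _.
  by rewrite -scaleN1r; exact: normed_EZ.
rewrite lerD2l -scaleN1r; apply: le_trans (nrmZ _ Ev) _.
by rewrite cabsN (cabs_real 1) normr1 mul1r.
Qed.

Lemma iter_T_E n u : E u -> E (iter n T u).
Proof. by move=> Eu; elim: n => // n IH; exact: T_E. Qed.

Lemma T_0 u : E u -> T 0 = 0.
Proof.
by move=> Eu; have := T_lin (-1) Eu Eu; rewrite scaleN1r addNr scaleN1r addNr.
Qed.

Lemma pencil_lin z w u v : E u -> E v ->
  pencil T z (w *: u + v) = w *: pencil T z u + pencil T z v.
Proof.
move=> Eu Ev; rewrite /pencil T_lin// scalerDr scalerBr !scalerA mulrC.
by rewrite opprD addrACA.
Qed.

Lemma pencil_E z u : E u -> E (pencil T z u).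
Proof. by move=> Eu; apply: normed_EB; [exact: normed_EZ|exact: T_E]. Qed.

Section Inverse.
Variable z : R[i].
Hypothesis rz : r < cabs z.

Let z_gt0 : 0 < cabs z. Proof. exact: le_lt_trans rz. Qed.
Let z_neq0 : z != 0.
Proof. by apply/eqP => z0; move: z_gt0; rewrite z0 (cabs_real 0) normr0 ltxx. Qed.
Let k := r / cabs z.
Let k01 : 0 <= k < 1.
Proof. by rewrite /k divr_ge0 ?(ltW z_gt0)//= ltr_pdivrMr// mul1r. Qed.
Let kE n : r ^+ n = k ^+ n * cabs z ^+ n.
Proof. by rewrite -exprMn divfK// gt_eqF. Qed.

Let vanish x c : 0 <= x -> (forall n, x <= c * k ^+ n) -> x = 0.
Proof.
move=> x0 h; apply/eqP; rewrite eq_le x0 andbT; apply/ler_addgt0Pr => e e0.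
have /andP[k0 k1] := k01.
have : geometric c k @ \oo --> 0 by apply: cvg_geometric; rewrite ger0_norm.
move=> /cvgrPdist_le /(_ _ e0) [n _ /(_ n (leqnn _))]; rewrite sub0r normrN add0r => hn.
exact: le_trans (h n) (le_trans (ler_norm _) hn).
Qed.

Let partial u n := \sum_(j < n) z ^- j.+1 *: iter j T u.

Let partial_E u n : E u -> E (partial u n).
Proof.
move=> Eu; rewrite /partial; elim: n => [|n IH].
  by rewrite big_ord0; exact: normed_E0 Eu.
by rewrite big_ord_recr /= addrC; apply: E_lin => //; exact: iter_T_E.
Qed.

Let pencil_partial u n : E u -> pencil T z (partial u n) = u - z ^- n *: iter n T u.
Proof.
move=> Eu; elim: n => [|n IH].
  by rewrite /partial big_ord0 /pencil scaler0 (T_0 Eu) expr0 invr1 scale1r !subrr.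
rewrite /partial big_ord_recr /= addrC pencil_lin ?IH; last 2 first.
- exact: iter_T_E.
- exact: partial_E.
have zE : z ^- n.+1 * z = z ^- n by rewrite exprS invfM mulrAC mulVf// mul1r.
rewrite [pencil T z (iter n T u)]/pencil scalerBr scalerA zE.
by rewrite addrC addrA subrK.
Qed.

(** The solution is the sum of z^(-j-1) T^j u, which converges because the powers of T grow at a
    rate r < |z|. *)
Lemma neumann_solution u : E u ->
  exists v, [/\ E v, pencil T z v = u & nrm v <= 4 * C / (cabs z - r) * nrm u].
Proof.
move=> Eu; set K := C * nrm u / cabs z; have /andP[k0 k1] := k01.
have Epu n := partial_E n Eu; have ETn n := iter_T_E n Eu.
have [|v [Ev hv]] := nrm_complete (K := K) Epu k01.
  move=> n; rewrite /partial big_ord_recr /= addrAC subrr add0r.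
  apply: le_trans (nrmZ _ (ETn n)) _; rewrite cabsV cabsX.
  have h : cabs z ^- n.+1 * nrm (iter n T u) <= cabs z ^- n.+1 * (C * r ^+ n * nrm u).
    by rewrite ler_wpM2l ?invr_ge0 ?exprn_ge0 ?(ltW z_gt0)// T_pow.
  apply: (le_trans h); rewrite le_eqVlt; apply/orP; left; apply/eqP.
  by rewrite kE /K exprS; field; rewrite expf_neq0 gt_eqF.
exists v; split => //; last first.
  have := hv 0%N; rewrite /partial big_ord0 subr0 expr0 mulr1.
  move=> h; apply: (le_trans h); rewrite le_eqVlt; apply/orP; left; apply/eqP.
  rewrite /K /k; field; rewrite (gt_eqF z_gt0) subr_eq0 gt_eqF//=.
apply/eqP; rewrite -subr_eq0; apply/eqP; apply: nrm0_eq0.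
  by apply: normed_EB => //; exact: pencil_E.
(* The defect of v is controlled by its distance to the n-th partial sum and by the remainder z^-n
   T^n u, both of order k^n. *)
apply: (vanish (c := (cabs z + C * r) * (4 * K / (1 - k)) + C * nrm u)) => // n.
have Ed : E (v - partial u n) by apply: normed_EB.
have -> : pencil T z v - u = pencil T z (v - partial u n) - z ^- n *: iter n T u.
  have := pencil_lin z (-1) (Epu n) Ev; rewrite !scaleN1r addrC => ->.
  by rewrite pencil_partial// opprB [_ + pencil T z v]addrC addrA addrAC addrK.
apply: (le_trans (nrmB (pencil_E _ Ed) (normed_EZ _ (ETn n)))).
rewrite mulrDl lerD//.
  apply: (@le_trans _ _ ((cabs z + C * r) * nrm (v - partial u n))); last first.
    rewrite -mulrA ler_wpM2l ?addr_ge0 ?mulr_ge0 ?(ltW z_gt0)//.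
    by apply: (le_trans (hv n)); rewrite mulrAC.
  apply: (le_trans (nrmB (normed_EZ _ Ed) (T_E Ed))); rewrite mulrDl lerD ?nrmZ//.
  by have := T_pow 1 Ed; rewrite expr1.
apply: (le_trans (nrmZ _ (ETn n))); rewrite cabsV cabsX.
rewrite mulrC ler_pdivrMr ?exprn_gt0//.
by have := T_pow n Eu; rewrite kE; lra.
Qed.

(** A kernel element satisfies z^n u = T^n u, and the right side grows more slowly than |z|^n. *)
Lemma pencil_inj u : E u -> pencil T z u = 0 -> u = 0.
Proof.
move=> Eu /eqP; rewrite subr_eq0 => /eqP zu.
have h n : z ^+ n *: u = iter n T u.
  elim: n => [|n IH]; first by rewrite expr0 scale1r.
  rewrite iterS -IH exprSr -scalerA zu.
  have := T_lin (z ^+ n) Eu (normed_E0 Eu); rewrite (T_0 Eu) !addr0.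
  by [].
apply: nrm0_eq0 => //; apply: (vanish (c := C * nrm u)) => // n.
rewrite [leLHS](_ : _ = nrm (z ^- n *: (z ^+ n *: u))); last first.
  by rewrite scalerA mulVf ?expf_neq0// scale1r.
apply: (le_trans (nrmZ _ (normed_EZ _ Eu))); rewrite cabsV cabsX mulrC.
rewrite ler_pdivrMr ?exprn_gt0// h.
by have := T_pow n Eu; rewrite kE; lra.
Qed.

Lemma neumann_inverse : exists S : V -> V,
  [/\ forall u, E u -> E (S u),
      forall u, E u -> nrm (S u) <= 4 * C / (cabs z - r) * nrm u,
      forall u, E u -> S (pencil T z u) = u &
      forall u, E u -> pencil T z (S u) = u].
Proof.
have /choice[S hS] u : exists v, E u ->
    [/\ E v, pencil T z v = u & nrm v <= 4 * C / (cabs z - r) * nrm u].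
  have [/neumann_solution[v hv]|nE] := pselect (E u); first by exists v.
  by exists u => /nE.
exists S; split => u Eu.
- by have [] := hS _ Eu.
- by have [] := hS _ Eu.
- have [Ev zv _] := hS _ (pencil_E z Eu).
  apply/eqP; rewrite -subr_eq0; apply/eqP/pencil_inj; first exact: normed_EB.
  have := pencil_lin z (-1) Eu Ev; rewrite !scaleN1r addrC => ->.
  by rewrite zv addNr.
- by have [] := hS _ Eu.
Qed.

End Inverse.

End Neumann.

Lemma geometric_limit (R : realType) (a : nat -> R) D r : 0 <= r < 1 ->
  (forall n, `|a n.+1 - a n| <= D * r ^+ n) ->
  exists l, a @ \oo --> l /\ forall n, `|l - a n| <= D * r ^+ n / (1 - r).
Proof.
move=> /andP[r0 r1] ha; have r1' : 0 < 1 - r by rewrite subr_gt0.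
have D0 : 0 <= D by have := ha 0%N; rewrite expr0 mulr1; exact: le_trans.
(* The partial geometric sum is kept exact, with its factor 1 - r^k, so that the induction
   closes. *)
have hk n k : `|a (n + k)%N - a n| <= D * r ^+ n / (1 - r) * (1 - r ^+ k).
  elim: k => [|k IH]; first by rewrite addn0 subrr normr0 expr0 subrr mulr0.
  rewrite addnS (_ : a _ - a n = (a (n + k).+1 - a (n + k)%N) + (a (n + k)%N - a n)); last by ring.
  apply: (le_trans (ler_normD _ _)).
  apply: (le_trans (lerD (ha _) IH)); rewrite le_eqVlt; apply/orP; left; apply/eqP.
  by rewrite exprD exprS; field; rewrite gt_eqF.
have hk' n k : `|a (n + k)%N - a n| <= D * r ^+ n / (1 - r).
  apply: (le_trans (hk n k)); rewrite ler_piMr//.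
    by rewrite divr_ge0 ?(ltW r1')// mulr_ge0// exprn_ge0.
  by rewrite gerBl exprn_ge0.
have ca : cvgn a.
  apply: cauchy_seq_cvg => e e0.
  have : geometric (D / (1 - r)) r @ \oo --> 0 by apply: cvg_geometric; rewrite ger0_norm.
  move=> /cvgrPdist_le /(_ _ e0) [n _ hn]; exists n => i j ni nj.
  wlog ij : i j ni nj / (i <= j)%N.
    by move=> W; have [/W|/ltnW/W] := leqP i j; [apply|rewrite distrC; apply].
  rewrite distrC -(subnKC ij); apply: (le_trans (hk' _ _)).
  have := hn i ni; rewrite sub0r normrN /geometric /= => h.
  by apply: le_trans h; rewrite mulrAC; exact: ler_norm.
exists (limn a); split => // n.
have h1 : (fun k => `|a (k + n)%N - a n|) @ \oo --> `|limn a - a n|.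
  apply: cvg_norm; apply: cvgB; last exact: cvg_cst.
  by rewrite (cvg_shiftn n a).
by apply: (cvgr_to_le h1); near=> k; rewrite addnC; exact: hk'.
Unshelve. all: by end_near.
Qed.

(** * Complex Holder functions as a complete normed space *)

Section ComplexHolder.
Variables (R : realType) (q : nat) (A : 'M[nat]_q) (theta : R) (x0 : SFT A).
Hypothesis htheta : 0 < theta < 1.
Let theta_gt0 : 0 < theta. Proof. by case/andP: htheta. Qed.
Local Notation V := (SFT A -> R[i]^o).
Local Notation E := (complex_Ftheta (A := A) theta).
Local Notation N := (complex_theta_norm (A := A) theta).
Local Notation lip := (lip_le (V := R[i]^o) (@cabs R) theta).
Local Notation sup := (sup_le (V := R[i]^o) (@cabs R)).
Implicit Types (u v : V) (z : R[i]).

Lemma addfE u v x : (u + v) x = u x + v x. Proof. by []. Qed.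
Lemma oppfE u x : (- u) x = - u x. Proof. by []. Qed.
Lemma scalefE z u x : (z *: u) x = z * u x. Proof. by []. Qed.

Definition holder_norm u : R := fine (N u).
Local Notation nrm := holder_norm.

Let md0 (v : R[i]^o) : 0 <= cabs v. Proof. exact: cabs_ge0. Qed.

Lemma holder_elim u : E u -> exists s t,
  [/\ 0 <= s, 0 <= t, lip s u, sup t u & nrm u = s + t] /\ N u = (nrm u)%:E.
Proof.
move=> /(Ftheta_elim x0 theta_gt0 md0)[s [t [s0 t0 hs ht [E1 _ _]]]].
exists s, t; have E2 : nrm u = s + t by rewrite /holder_norm /complex_theta_norm E1.
by split => //; rewrite E2.
Qed.

Lemma holder_intro u s t : lip s u -> sup t u -> E u /\ nrm u <= s + t.
Proof.
move=> hs ht; have Eu : E u := Ftheta_intro theta_gt0 hs ht.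
split => //; have [s' [t' [_ EN]]] := holder_elim Eu.
by have := theta_norm_le theta_gt0 hs ht; rewrite -/(N u) EN lee_fin.
Qed.

Lemma holder_le u : E u -> lip (nrm u) u /\ sup (nrm u) u.
Proof.
move=> /holder_elim[s [t [[s0 t0 hs ht ->] _]]]; split.
  move=> k x y /hs /le_trans; apply.
  by rewrite ler_wpM2r ?exprn_ge0 ?(ltW theta_gt0)// lerDl.
by move=> x; apply: (le_trans (ht x)); rewrite lerDr.
Qed.

Lemma holder_ge0 u : 0 <= nrm u.
Proof.
have [Eu|nE] := pselect (E u).
  by have [s [t [[s0 t0 _ _ ->] _]]] := holder_elim Eu; exact: addr_ge0.
rewrite /holder_norm fine_ge0//.
by apply: adde_ge0; [exact: theta_seminorm_ge0|exact: sup_norm_ge0].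
Qed.

Lemma holder_addE u v : E u -> E v -> E (u + v) /\ nrm (u + v) <= nrm u + nrm v.
Proof.
move=> /holder_elim[s [t [[s0 t0 hs ht ->] _]]] /holder_elim[s' [t' [[s'0 t'0 hs' ht' ->] _]]].
have [||] := @holder_intro (u + v) (s + s') (t + t').
- move=> k x y xy; rewrite mulrDl !addfE opprD addrACA.
  by apply: (le_trans (cabsD _ _)); apply: lerD; [exact: hs|exact: hs'].
- by move=> x; apply: (le_trans (cabsD _ _)); apply: lerD.
by move=> h1 h2; split=> //; rewrite addrACA.
Qed.

Lemma holder_scaleE z u : E u -> E (z *: u) /\ nrm (z *: u) <= cabs z * nrm u.
Proof.
move=> /holder_elim[s [t [[s0 t0 hs ht ->] _]]]; rewrite mulrDr.
apply: holder_intro.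
- move=> k x y xy; rewrite [X in cabs X](_ : _ = z * (u x - u y)); last by rewrite mulrBr.
  by rewrite cabsM -mulrA ler_wpM2l ?cabs_ge0//; exact: hs.
- by move=> x; rewrite [X in cabs X](_ : _ = z * u x)// cabsM ler_wpM2l ?cabs_ge0.
Qed.

Lemma holder_lin z u v : E u -> E v -> E (z *: u + v).
Proof. by move=> Eu Ev; apply: (holder_addE _ Ev).1; exact: (holder_scaleE z Eu).1. Qed.

Lemma holder_eq0 u : E u -> nrm u = 0 -> u = 0.
Proof.
move=> /holder_le[_ hu] u0; apply/funext => x; apply: cabs_eq0; apply/eqP.
by rewrite eq_le cabs_ge0 andbT -u0.
Qed.

(** The limit l is taken pointwise, in real and imaginary parts. Its Lipschitz bound comes from the
    differences s n x - s n y, whose increments carry the extra factor theta^k; uniqueness of limits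
    identifies their limit with l x - l y. *)
Lemma holder_complete (s : nat -> V) K r : (forall n, E (s n)) ->
  0 <= r < 1 -> (forall n, nrm (s n.+1 - s n) <= K * r ^+ n) ->
  exists l, E l /\ forall n, nrm (l - s n) <= 4 * K * r ^+ n / (1 - r).
Proof.
move=> Es r01 hs; have /andP[r0 r1] := r01.
have Ed n : E (s n.+1 - s n).
  by rewrite -scaleN1r addrC; exact: holder_lin.
have hd n x : cabs (s n.+1 x - s n x) <= K * r ^+ n.
  by apply: le_trans (hs n); exact: (holder_le (Ed n)).2 x.
have hdd n k x y : agree k x y ->
    cabs ((s n.+1 x - s n.+1 y) - (s n x - s n y)) <= K * theta ^+ k * r ^+ n.
  move=> xy; rewrite [X in cabs X](_ : _ = (s n.+1 - s n) x - (s n.+1 - s n) y); last first.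
    by rewrite !addfE !oppfE !opprB [LHS]addrACA [RHS]addrACA; congr (_ + _); exact: addrC.
  apply: le_trans ((holder_le (Ed n)).1 _ _ _ xy) _.
  by rewrite mulrAC ler_wpM2r ?exprn_ge0 ?(ltW theta_gt0).
have lim (w : nat -> R[i]) D : (forall n, cabs (w n.+1 - w n) <= D * r ^+ n) ->
    exists l : R[i], [/\ (fun n => complex.Re (w n)) @ \oo --> complex.Re l,
      (fun n => complex.Im (w n)) @ \oo --> complex.Im l &
      forall n, cabs (l - w n) <= 2 * D * r ^+ n / (1 - r)].
  move=> hw.
  have [|a [ca ha]] := @geometric_limit R (fun n => complex.Re (w n)) D r r01.
    by move=> n; apply: le_trans (hw n); apply: le_trans (cabs_Re _); case: (w _) (w _) => ? ? [? ?].
  have [|c [cc hc]] := @geometric_limit R (fun n => complex.Im (w n)) D r r01.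
    by move=> n; apply: le_trans (hw n); apply: le_trans (cabs_Im _); case: (w _) (w _) => ? ? [? ?].
  exists (Complex a c); split => // n.
  apply: (le_trans (cabs_ReIm _)).
  have := ha n; have := hc n; case: (w n) => a' c' /=; lra.
have /choice[l hl] x := lim (fun n => s n x) K (fun n => hd n x).
have bound n : lip (2 * K * r ^+ n / (1 - r)) (l - s n) /\ sup (2 * K * r ^+ n / (1 - r)) (l - s n).
  split=> [k x y xy|x]; last by have [_ _] := hl x; apply.
  have [d [d1 d2 hd']] := lim (fun n => s n x - s n y) (K * theta ^+ k)
    (fun n => hdd n k x y xy).
  have [x1 x2 _] := hl x; have [y1 y2 _] := hl y.
  have -> : (l - s n) x - (l - s n) y = d - (s n x - s n y).
    have -> : d = l x - l y.
      apply/eqP; rewrite eq_complex; apply/andP; split; apply/eqP.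
        have -> : complex.Re (l x - l y) = complex.Re (l x) - complex.Re (l y).
          by case: (l x) (l y) => ? ? [].
        have e : (fun n => complex.Re (s n x - s n y)) =
            fun n => complex.Re (s n x) - complex.Re (s n y).
          by apply/funext => j; case: (s j x) (s j y) => ? ? [].
        have c1 : (fun n => complex.Re (s n x - s n y)) @ \oo -->
            complex.Re (l x) - complex.Re (l y) by rewrite e; exact: cvgB.
        exact: (cvg_unique _ d1 c1).
      have -> : complex.Im (l x - l y) = complex.Im (l x) - complex.Im (l y).
        by case: (l x) (l y) => ? ? [].
      have e : (fun n => complex.Im (s n x - s n y)) =
            fun n => complex.Im (s n x) - complex.Im (s n y).
          by apply/funext => j; case: (s j x) (s j y) => ? ? [].
        have c2 : (fun n => complex.Im (s n x - s n y)) @ \oo -->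
            complex.Im (l x) - complex.Im (l y) by rewrite e; exact: cvgB.
        exact: (cvg_unique _ d2 c2).
    by rewrite !addfE !oppfE !opprB [LHS]addrACA [RHS]addrACA; congr (_ + _); exact: addrC.
  apply: (le_trans (hd' n)); rewrite le_eqVlt; apply/orP; left; apply/eqP; ring.
have El : E l.
  have [E0 _] := @holder_intro (l - s 0%N) _ _ (bound 0%N).1 (bound 0%N).2.
  have := holder_lin 1 E0 (Es 0%N); rewrite scale1r subrK; exact.
exists l; split => // n.
have [_] := @holder_intro (l - s n) _ _ (bound n).1 (bound n).2.
by move/le_trans; apply; rewrite le_eqVlt; apply/orP; left; apply/eqP; ring.
Qed.

Local Notation bdd := (bdd_lip theta).
Implicit Types (g : SFT A -> R).

Lemma holder_Re u : E u -> bdd (nrm u) (fun x => complex.Re (u x)).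
Proof.
move=> /holder_elim[s [t [[s0 t0 hs ht ->] _]]]; exists s, t; split => //.
- move=> k x y /hs; apply: le_trans; apply: le_trans (cabs_Re _).
  by rewrite /rabs; case: (u x) (u y) => ? ? [].
- by move=> x; apply: le_trans (ht x); exact: cabs_Re.
Qed.

Lemma holder_Im u : E u -> bdd (nrm u) (fun x => complex.Im (u x)).
Proof.
move=> /holder_elim[s [t [[s0 t0 hs ht ->] _]]]; exists s, t; split => //.
- move=> k x y /hs; apply: le_trans; apply: le_trans (cabs_Im _).
  by rewrite /rabs; case: (u x) (u y) => ? ? [].
- by move=> x; apply: le_trans (ht x); exact: cabs_Im.
Qed.

Lemma holder_ReIm t t' u : bdd t (fun x => complex.Re (u x)) ->
  bdd t' (fun x => complex.Im (u x)) -> E u /\ nrm u <= t + t'.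
Proof.
move=> [s1 [s2 [h1 h2 _ _ h3]]] [s1' [s2' [h1' h2' _ _ h3']]].
have [||] := @holder_intro u (s1 + s1') (s2 + s2').
- move=> k x y xy; apply: (le_trans (cabs_ReIm _)); rewrite mulrDl.
  have := h1 _ _ _ xy; have := h1' _ _ _ xy; rewrite /rabs.
  by case: (u x) (u y) => ? ? [? ?] /= ? ?; exact: lerD.
- by move=> x; apply: (le_trans (cabs_ReIm _)); apply: lerD; [exact: h2|exact: h2'].
by move=> Eu hN; split => //; lra.
Qed.

Section Complexify.
Variable T : (SFT A -> R) -> (SFT A -> R).
(** Linearity is asked only under norm bounds because the limit defining the eigenfunctional is
    known to exist only there. *)
Hypothesis T_lin : forall c t t' g g', bdd t g -> bdd t' g' ->
  T (fun x => c * g x + g' x) = fun x => c * T g x + T g' x.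

Lemma complexify_iter n u : iter n (complexify T) u = complexify (iter n T) u.
Proof.
elim: n => [|n IH]; last by rewrite iterS IH.
by apply/funext => x; rewrite /complexify /=; case: (u x).
Qed.

Lemma complexify_lin z u v : E u -> E v ->
  complexify T (z *: u + v) = z *: complexify T u + complexify T v.
Proof.
move=> Eu Ev; apply/funext => x.
have hR := holder_Re Eu; have hI := holder_Im Eu.
have hR' := holder_Re Ev; have hI' := holder_Im Ev.
case: z => a c.
have ER : (fun y => complex.Re ((Complex a c *: u + v) y)) = fun y =>
    a * complex.Re (u y) + ((- c) * complex.Im (u y) + complex.Re (v y)).
  apply/funext => y; rewrite addfE scalefE.
  by case: (u y) (v y) => ? ? [? ?] /=; ring.
have EI : (fun y => complex.Im ((Complex a c *: u + v) y)) = fun y =>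
    a * complex.Im (u y) + (c * complex.Re (u y) + complex.Im (v y)).
  apply/funext => y; rewrite addfE scalefE.
  by case: (u y) (v y) => ? ? [? ?] /=; ring.
rewrite {1}/complexify ER EI.
rewrite (T_lin a hR (bdd_lip_lin (- c) hI hR')) (T_lin _ hI hR').
rewrite (T_lin a hI (bdd_lip_lin c hR hI')) (T_lin _ hR hI').
rewrite addfE scalefE /complexify; apply/eqP; rewrite eq_complex /=.
by apply/andP; split; apply/eqP; ring.
Qed.

Variables (C : R).
Hypothesis T_bdd : forall t g, bdd t g -> bdd (C * t) (T g).

Lemma complexify_holder u : E u -> E (complexify T u) /\ nrm (complexify T u) <= 2 * C * nrm u.
Proof.
move=> Eu.
have [h1 h2] := @holder_ReIm _ _ (complexify T u) (T_bdd (holder_Re Eu)) (T_bdd (holder_Im Eu)).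
by split => //; lra.
Qed.

End Complexify.

End ComplexHolder.

Section RealNeumann.
Variables (R : realType) (q : nat) (A : 'M[nat]_q) (theta : R) (x0 : SFT A).
Hypothesis htheta : 0 < theta < 1.
Local Notation E := (complex_Ftheta (A := A) theta).
Local Notation nrm := (holder_norm (A := A) theta).
Local Notation bdd := (bdd_lip theta).
Variables (T : (SFT A -> R) -> (SFT A -> R)) (C r : R).
Implicit Types (u v : SFT A -> R[i]^o).
Hypothesis C_ge0 : 0 <= C.
Hypothesis r_ge0 : 0 <= r.
Hypothesis T_lin : forall c t t' g g', bdd t g -> bdd t' g' ->
  T (fun x => c * g x + g' x) = fun x => c * T g x + T g' x.
Hypothesis T_pow : forall n t g, bdd t g -> bdd (C * r ^+ n * t) (iter n T g).

Lemma complexify_pow n u : E u ->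
  E (iter n (complexify T) u) /\
  nrm (iter n (complexify T) u) <= 2 * C * r ^+ n * nrm u.
Proof.
move=> Eu; rewrite complexify_iter -(mulrA 2).
by apply: (complexify_holder x0 htheta (T := iter n T)) => // t g; exact: T_pow.
Qed.

Let T_E u : E u -> E (complexify T u).
Proof. by move=> Eu; exact: (complexify_pow 1 Eu).1. Qed.

Lemma pencil_complexify_inj z u : r < cabs z -> E u ->
  pencil (complexify T) z u = 0 -> u = 0.
Proof.
move=> rz Eu; apply: (pencil_inj (holder_lin x0 htheta) (holder_ge0 x0 htheta)
  (fun z u hu => (holder_scaleE x0 htheta z hu).2) (holder_eq0 x0 htheta) r_ge0
  (fun z u v => complexify_lin x0 htheta T_lin z (u := u) (v := v))
  (fun n v hv => (complexify_pow n hv).2) rz Eu).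
Qed.

Lemma complexify_neumann z : r < cabs z -> exists S : (SFT A -> R[i]^o) -> (SFT A -> R[i]^o),
  [/\ forall u, E u -> E (S u),
      exists C', forall u, E u -> nrm (S u) <= C' * nrm u,
      forall u, E u -> S (pencil (complexify T) z u) = u &
      forall u, E u -> pencil (complexify T) z (S u) = u].
Proof.
move=> rz.
have C2 : 0 <= 2 * C by rewrite mulr_ge0.
have [S [h1 h2 h3 h4]] := neumann_inverse (holder_lin x0 htheta) (holder_ge0 x0 htheta)
  (fun u v hu hv => (holder_addE x0 htheta hu hv).2)
  (fun z u hu => (holder_scaleE x0 htheta z hu).2) (holder_eq0 x0 htheta)
  (holder_complete x0 htheta) C2 r_ge0 T_E
  (fun z u v => complexify_lin x0 htheta T_lin z (u := u) (v := v))
  (fun n v hv => (complexify_pow n hv).2) rz.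
by exists S; split => //; exists (4 * (2 * C) / (cabs z - r)).
Qed.

End RealNeumann.

(** * The spectrum *)

Lemma bdd_lipZ (R : realType) (q : nat) (A : 'M[nat]_q) (theta c t : R) (g : SFT A -> R) :
  bdd_lip theta t g -> bdd_lip theta (`|c| * t) (fun x => c * g x).
Proof.
move=> hg; have := bdd_lip_lin c hg (bdd_lip_cst A theta 0).
by rewrite normr0 addr0; congr bdd_lip; apply/funext => x; rewrite addr0.
Qed.

Section SpectralPicture.
Variables (R : realType) (q : nat) (A : 'M[nat]_q) (M : nat) (theta : R).
Variables (f : SFT A -> R) (b F : R) (m : nat).
Implicit Types (g u : SFT A -> R) (t c e a : R).
Hypothesis H : ruelle_data M theta f b F m.

Let htheta := rd_theta H.

Variable x0 : SFT A.
Local Notation L := (transfer f).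
Local Notation bdd := (bdd_lip theta).
Local Notation nu := (eigenfunctional f x0).
Local Notation lam := (eigenvalue f x0).
Local Notation Ln := (normalized f x0).
Local Notation h := (eigenfunction f x0).
Local Notation a0 := (cone_slope theta b).
Local Notation E := (complex_Ftheta (A := A) theta).
Local Notation N := (complex_theta_norm (A := A) theta).
Local Notation nrm := (holder_norm (A := A) theta).
Local Notation LC := (complexify L).
Local Notation lamC := (real_complex R lam).
Implicit Types (v w : SFT A -> R[i]^o) (z : R[i]).

Variables (c D rho : R).
Hypothesis c_gt0 : 0 < c.
Hypothesis hc : 2 * Harnack q M theta F m a0 * c <= 1 - theta.
Hypothesis rho01 : 0 < rho < 1.
Hypothesis D_ge0 : 0 <= D.
Hypothesis gap : forall n t g, bdd t g ->
  bdd (D * rho ^+ n * t) (fun x => Ln n g x - h x * nu g).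

Let lam_gt0 : 0 < lam. Proof. exact: eigenvalue_gt0 H x0. Qed.
Let rho_gt0 : 0 < rho. Proof. by case/andP: rho01. Qed.
Let rho_lt1 : rho < 1. Proof. by case/andP: rho01. Qed.
Let h_bdd : exists t, bdd t h. Proof. exact: (eigenfunction_bdd H x0 c_gt0 hc). Qed.
Let h_eq : L h = fun x => lam * h x. Proof. exact: (eigenfunction_eq H x0 c_gt0 hc). Qed.
Let nu_h : nu h = 1. Proof. exact: (nu_eigenfunction H x0 c_gt0 hc). Qed.

Definition eigenprojection g : SFT A -> R := fun x => nu g * h x.
(* This operator commutes with the eigenprojection and its spectral radius is at
   most rho lam. *)
Definition transfer_rest g : SFT A -> R := fun x => L g x - lam * (nu g * h x).
Local Notation Pr := eigenprojection.
Local Notation Q := transfer_rest.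
Local Notation PC := (complexify Pr).
Local Notation QC := (complexify Q).

Let bdd_L t g : bdd t g -> exists t', bdd t' (L g).
Proof. exact: (bdd_lip_iter H x0 1). Qed.

Let Q_lin c' t t' g g' : bdd t g -> bdd t' g' ->
  Q (fun x => c' * g x + g' x) = fun x => c' * Q g x + Q g' x.
Proof.
move=> hg hg'; rewrite /Q transfer_lin (nu_lin H x0 c' hg hg').
by apply/funext => x; ring.
Qed.

Let Pr_lin c' t t' g g' : bdd t g -> bdd t' g' ->
  Pr (fun x => c' * g x + g' x) = fun x => c' * Pr g x + Pr g' x.
Proof.
by move=> hg hg'; rewrite /Pr (nu_lin H x0 c' hg hg'); apply/funext => x; ring.
Qed.

Let nu_bound t g : bdd t g -> `|nu g| <= t.
Proof.
move=> hg; case: (hg) => s [s' [_ hs' s0 s'0 ss']].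
by apply: (nu_norm H x0 hg) => x; have := hs' x; rewrite /rabs; lra.
Qed.

(** Q^n is L^n minus its rank one part only for n >= 1, as Q^0 is the identity; hence the successor
    here and the summand 1 in the constant D + 1 of [Q_pow]. *)
Let Q_iter n t g : bdd t g ->
  iter n.+1 Q g = fun x => lam ^+ n.+1 * (Ln n.+1 g x - h x * nu g).
Proof.
move=> hg.
have lamX k : lam ^+ k != 0 by rewrite expf_neq0// gt_eqF.
have E1 k : (fun x => lam ^+ k * (Ln k g x - h x * nu g)) =
    fun x => (- (lam ^+ k * nu g)) * h x + iter k L g x.
  by apply/funext => x; rewrite mulrBr mulVKf//; ring.
elim: n => [|n IH].
  by rewrite /= E1 /Q expr1; apply/funext => x /=; ring.
rewrite iterS IH !E1; have [t' ht'] := h_bdd; have [t'' ht''] := bdd_lip_iter H x0 n.+1 hg.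
rewrite /Q (nu_lin H x0 _ ht' ht'') nu_h (nu_iter H x0 _ hg) transfer_lin h_eq -iterS.
by apply/funext => x; rewrite (exprS lam n.+1); ring.
Qed.

Let Q_pow n t g : bdd t g -> bdd ((D + 1) * (rho * lam) ^+ n * t) (iter n Q g).
Proof.
move=> hg; have t0 := bdd_lip_ge0 hg; case: n => [|n].
  by apply: bdd_lip_le hg; rewrite expr0 mulr1 mulrDl mul1r lerDr mulr_ge0.
rewrite (Q_iter n hg); apply: bdd_lip_le (bdd_lipZ (lam ^+ n.+1) (gap n.+1 hg)).
rewrite ger0_norm ?exprn_ge0 ?(ltW lam_gt0)// exprMn.
have h1 : 0 <= rho ^+ n.+1 * lam ^+ n.+1 * t.
  by rewrite mulr_ge0 ?mulr_ge0 ?exprn_ge0 ?(ltW lam_gt0) ?(ltW rho_gt0).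
lra.
Qed.

Let D1_ge0 : 0 <= D + 1. Proof. by rewrite addr_ge0. Qed.
Let rl_ge0 : 0 <= rho * lam. Proof. by rewrite mulr_ge0// ltW. Qed.

Let Pr_bdd : exists C, forall t g, bdd t g -> bdd (C * t) (Pr g).
Proof.
have [t' ht'] := h_bdd; exists t' => t g hg.
apply: bdd_lip_le (bdd_lipZ (nu g) ht').
by rewrite mulrC ler_wpM2l ?(bdd_lip_ge0 ht')// nu_bound.
Qed.

Let PC_E v : E v -> E (PC v).
Proof. by have [C hC] := Pr_bdd; move=> /(complexify_holder x0 htheta hC)[]. Qed.

Let PC_nrm : exists C, forall v, E v -> nrm (PC v) <= C * nrm v.
Proof.
have [C hC] := Pr_bdd; exists (2 * C) => v.
by move=> /(complexify_holder x0 htheta hC)[].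
Qed.

Let QC_E v : E v -> E (QC v).
Proof. by move=> Ev; exact: (complexify_pow x0 htheta Q_pow 1 Ev).1. Qed.

Let EZ z v : E v -> E (z *: v).
Proof. by move=> Ev; exact: (holder_scaleE x0 htheta z Ev).1. Qed.
Let ED v w : E v -> E w -> E (v + w).
Proof. by move=> Ev Ew; exact: (holder_addE x0 htheta Ev Ew).1. Qed.
Let EB v w : E v -> E w -> E (v - w).
Proof. by move=> Ev Ew; rewrite -scaleN1r; apply: ED => //; exact: EZ. Qed.

Let LC_decomp v : LC v = QC v + lamC *: PC v.
Proof.
apply/funext => x; rewrite addfE scalefE; apply/eqP; rewrite eq_complex /=.
by rewrite /Q /Pr; apply/andP; split; apply/eqP; ring.
Qed.

Let LC_E v : E v -> E (LC v).
Proof. by move=> Ev; rewrite LC_decomp; apply: ED; [exact: QC_E|exact/EZ/PC_E]. Qed.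

Let hC : SFT A -> R[i]^o := fun x => Complex (h x) 0.

Let hC_E : E hC.
Proof.
have [t ht] := h_bdd.
exact: (holder_ReIm x0 htheta (u := hC) ht (bdd_lip_cst A theta 0)).1.
Qed.

Let PC_line v : exists k : R[i], PC v = k *: hC.
Proof.
exists (Complex (nu (fun y => complex.Re (v y))) (nu (fun y => complex.Im (v y)))).
apply/funext => x; rewrite scalefE; apply/eqP; rewrite eq_complex /= /Pr.
by apply/andP; split; apply/eqP; ring.
Qed.

Let LC_hC : LC hC = lamC *: hC.
Proof.
apply/funext => x; rewrite scalefE /complexify /hC /= (_ : (fun y => h y) = h)// h_eq.
apply/eqP; rewrite eq_complex /=; apply/andP; split; apply/eqP; first by ring.
rewrite (_ : (fun=> 0) = fun x => 0 * h x); last by apply/funext => y; rewrite mul0r.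
by rewrite transferZ; ring.
Qed.

Let PC_lin z v w : E v -> E w -> PC (z *: v + w) = z *: PC v + PC w.
Proof. exact: (complexify_lin x0 htheta Pr_lin). Qed.

Let QC_lin z v w : E v -> E w -> QC (z *: v + w) = z *: QC v + QC w.
Proof. exact: (complexify_lin x0 htheta Q_lin). Qed.

Let LC_lin z v w : E v -> E w -> LC (z *: v + w) = z *: LC v + LC w.
Proof.
apply: (complexify_lin x0 htheta) => c' t t' g g' _ _; exact: transfer_lin.
Qed.

Let PC_idem v : E v -> PC (PC v) = PC v.
Proof.
move=> Ev; have [t ht] := h_bdd; apply/funext => x.
rewrite /complexify /= /Pr (nuZ H x0 _ ht) (nuZ H x0 _ ht) nu_h.
by rewrite !mulr1.
Qed.

Let PC_QC v : E v -> PC (QC v) = 0.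
Proof.
move=> Ev; have [t ht] := h_bdd.
have nuQ t' g : bdd t' g -> nu (Q g) = 0.
  move=> hg; have [t'' ht''] := bdd_L hg.
  rewrite (_ : Q g = fun x => (- (lam * nu g)) * h x + L g x); last first.
    by apply/funext => x; rewrite /Q; ring.
  by rewrite (nu_lin H x0 _ ht ht'') nu_h (nu_transfer H x0 hg); ring.
apply/funext => x; rewrite /complexify /= /Pr.
rewrite (nuQ _ _ (holder_Re x0 htheta Ev)) (nuQ _ _ (holder_Im x0 htheta Ev)).
by rewrite !mul0r.
Qed.

Let QC_PC v : E v -> QC (PC v) = 0.
Proof.
move=> Ev; have [t ht] := h_bdd.
have QP t' g : bdd t' g -> Q (Pr g) = fun=> 0.
  move=> hg; apply/funext => x; rewrite /Q /Pr transferZ h_eq (nuZ H x0 _ ht) nu_h.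
  by ring.
apply/funext => x; rewrite /complexify /=.
by rewrite (QP _ _ (holder_Re x0 htheta Ev)) (QP _ _ (holder_Im x0 htheta Ev)).
Qed.

Let pencilE z v : pencil LC z v = pencil QC z v - lamC *: PC v.
Proof. by rewrite /pencil LC_decomp opprD addrA. Qed.

Let QC_lamh (v : SFT A -> R[i]^o) : E v -> QC (v - PC v) = QC v.
Proof.
move=> Ev; rewrite -scaleN1r addrC QC_lin//; last exact: PC_E.
by rewrite (QC_PC Ev) scaler0 add0r.
Qed.

Let PCB v w : E v -> E w -> PC (v - w) = PC v - PC w.
Proof.
by move=> Ev Ew; have := PC_lin (-1) Ew Ev; rewrite !scaleN1r addrC => ->; rewrite addrC.
Qed.

Let PC_0 : PC 0 = 0.
Proof. by have := PCB hC_E hC_E; rewrite !subrr. Qed.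

Let PCZ z v : E v -> PC (z *: v) = z *: PC v.
Proof.
move=> Ev; have E0 : E 0 by rewrite -(subrr hC); exact: EB.
by have := PC_lin z Ev E0; rewrite PC_0 !addr0.
Qed.

Let PC_pencil z v : E v -> PC (pencil LC z v) = (z - lamC) *: PC v.
Proof.
move=> Ev; have EPv := PC_E Ev; have EQv := QC_E Ev.
rewrite pencilE /pencil !PCB ?PCZ ?PC_idem ?PC_QC ?subr0 ?scalerBl//.
- exact: EZ.
- by apply: EB => //; exact: EZ.
- exact: EZ.
Qed.

(** The space splits into the line of h and the kernel of the projection, and on the latter L
    coincides with Q. *)
Let pencil_complement z v : E v ->
  pencil LC z v - PC (pencil LC z v) = pencil QC z (v - PC v).
Proof.
move=> Ev; rewrite PC_pencil// pencilE /pencil QC_lamh// scalerBr scalerBl.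
by rewrite opprB addrA subrK addrAC.
Qed.

Let hC_neq0 : hC <> 0.
Proof.
move=> hC0.
have h0 : h = fun=> 0.
  by apply/funext => x; have := congr1 (fun u : SFT A -> R[i]^o => complex.Re (u x)) hC0.
by have := nu_h; rewrite h0 (nu_cst H) => /esym/eqP; rewrite oner_eq0.
Qed.

Lemma resolventP z : resolvent_set E N LC z <-> exists S : (SFT A -> R[i]^o) -> (SFT A -> R[i]^o),
  [/\ forall v, E v -> E (S v),
      exists C, forall v, E v -> nrm (S v) <= C * nrm v,
      forall v, E v -> S (pencil LC z v) = v &
      forall v, E v -> pencil LC z (S v) = v].
Proof.
have NE v : E v -> N v = (nrm v)%:E by move=> /(holder_elim x0 htheta)[? [? [_]]].
split=> -[S [h1 [C h2] h3 h4]]; exists S; split=> //; exists C => v Ev.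
  by have := h2 _ Ev; rewrite (NE _ (h1 _ Ev)) (NE _ Ev) -EFinM lee_fin.
by rewrite (NE _ (h1 _ Ev)) (NE _ Ev) -EFinM lee_fin h2.
Qed.

Lemma resolvent_large z : rho * lam < cabs z -> z != lamC -> resolvent_set E N LC z.
Proof.
move=> rz zl; apply/resolventP.
have [S [h1 [C h2] h3 h4]] := complexify_neumann x0 htheta D1_ge0 rl_ge0 Q_lin Q_pow rz.
have [C' hC'] := PC_nrm.
have zl' : z - lamC != 0 by rewrite subr_eq0.
have z0 : z != 0.
  by apply: contraTneq rz => ->; rewrite (cabs_real 0) normr0 -leNgt.
have Ec v : E v -> E (v - PC v) by move=> Ev; apply: EB => //; exact: PC_E.
(* On the line of h the resolvent is division by z - lambda; on the complement it is the Neumann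
   inverse S of z - Q. *)
exists (fun v => (z - lamC)^-1 *: PC v + S (v - PC v)); split.
- by move=> v Ev; apply: ED; [exact/EZ/PC_E|exact/h1/Ec].
- exists (cabs (z - lamC)^-1 * C' + `|C| * (1 + C')) => v Ev.
  have EPv := PC_E Ev.
  apply: (le_trans (holder_addE x0 htheta (EZ _ EPv) (h1 _ (Ec _ Ev))).2).
  rewrite mulrDl; apply: lerD.
    apply: (le_trans (holder_scaleE x0 htheta _ EPv).2).
    by rewrite -mulrA ler_wpM2l ?cabs_ge0// hC'.
  apply: (le_trans (h2 _ (Ec _ Ev))).
  have h5 : nrm (v - PC v) <= (1 + C') * nrm v.
    rewrite -scaleN1r.
    apply: (le_trans (holder_addE x0 htheta Ev (EZ (-1) EPv)).2).
    rewrite mulrDl mul1r lerD2l.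
    apply: (le_trans (holder_scaleE x0 htheta _ EPv).2).
    by rewrite cabsN (cabs_real 1) normr1 mul1r hC'.
  apply: (@le_trans _ _ (`|C| * nrm (v - PC v))).
    by rewrite ler_wpM2r ?(holder_ge0 x0 htheta)// ler_norm.
  by rewrite -mulrA ler_wpM2l.
- move=> v Ev; rewrite pencil_complement// h3; last exact: Ec.
  rewrite PC_pencil// scalerA mulVf// scale1r addrC subrK.
  by [].
- move=> v Ev; have EPv := PC_E Ev; have ES := h1 _ (Ec _ Ev).
  set w := S _ in ES *; have hw : pencil QC z w = v - PC v := h4 _ (Ec _ Ev).
  (* Applying the projection P to (z - Q) w = v - P v gives z P w = 0, and z is not 0. *)
  have Pw : PC w = 0.
    have := congr1 PC hw; rewrite PCB// PC_idem// subrr /pencil PCB ?PCZ ?PC_QC//; last 2 first.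
    - exact: EZ.
    - exact: QC_E.
    rewrite subr0 => /eqP; rewrite scaler_eq0 (negPf z0) => /eqP.
    by [].
  have plin : pencil LC z ((z - lamC)^-1 *: PC v + w) =
      (z - lamC)^-1 *: pencil LC z (PC v) + pencil LC z w.
    rewrite /pencil LC_lin// scalerDr scalerBr !scalerA [z * _]mulrC opprD addrACA.
    by [].
  rewrite plin [pencil LC z w]pencilE Pw scaler0 subr0 hw.
  have -> : pencil LC z (PC v) = (z - lamC) *: PC v.
    by rewrite pencilE PC_idem// /pencil QC_PC// subr0 scalerBl.
  by rewrite scalerA mulVf// scale1r addrC subrK.
Qed.

Lemma eigenvalue_spectrum : spectrum E N LC lamC.
Proof.
move=> /resolventP[S [h1 _ h3 _]].
have P0 : pencil LC lamC hC = 0 by rewrite /pencil LC_hC subrr.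
have E0 : E 0 by rewrite -(subrr hC); exact: EB.
have P00 : pencil LC lamC 0 = 0.
  have := LC_lin (-1) E0 E0; rewrite scaleN1r addNr scaleN1r addNr => L0.
  by rewrite /pencil scaler0 L0 subrr.
by apply: hC_neq0; rewrite -(h3 _ hC_E) P0 -{1}P00 h3.
Qed.

Let cabs_lam : cabs lamC = lam.
Proof. by rewrite cabs_real ger0_norm// ltW. Qed.

Lemma spectrum_bound z : spectrum E N LC z -> z = lamC \/ cabs z <= rho * lam.
Proof.
move=> hz; have [->|/eqP zl] := pselect (z = lamC); [by left|right].
by rewrite leNgt; apply/negP => rz; apply: hz; exact: resolvent_large.
Qed.

Lemma spectral_radiusE : spectral_radius E N LC = lam%:E.
Proof.
apply/eqP; rewrite eq_le; apply/andP; split.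
  apply: ge_ereal_sup => _ [z /spectrum_bound[->|hz] <-]; rewrite lee_fin ?cabs_lam//.
  by apply: (le_trans hz); rewrite ler_piMl// ltW.
by apply: ereal_sup_ubound; exists lamC; [exact: eigenvalue_spectrum|rewrite cabs_lam].
Qed.

Lemma spectrum_circle : spectrum E N LC `&` [set z | cabs z = lam] = [set lamC].
Proof.
apply/seteqP; split=> [z [/spectrum_bound[//|hz] /= zl]|_ ->].
  by move: hz; rewrite zl leNgt gtr_pMl// rho_lt1.
by split; [exact: eigenvalue_spectrum|exact: cabs_lam].
Qed.

Lemma spectrum_gap z : spectrum E N LC z -> cabs z < lam -> cabs z <= rho * lam.
Proof. by move=> /spectrum_bound[->|//]; rewrite cabs_lam ltxx. Qed.

(** By induction (lambda - L) v is its own projection; but the projection kills it, so it vanishes.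
    Hence v - P v lies in the kernel of lambda - Q, which is trivial because rho lambda < lambda. *)
Lemma eigenvalue_simple : simple_eigenvalue E LC lamC.
Proof.
exists hC; split; [exact: hC_E|exact: hC_neq0|exact: LC_hC|].
move=> n v Ev hn; suff -> : v = PC v by exact: PC_line.
elim: n v Ev hn => [|n IH] v Ev; first by move=> /= ->; rewrite PC_0.
rewrite iterSr => hn.
have EPv : E (pencil LC lamC v).
  by rewrite /pencil; apply: EB; [exact: EZ|exact: LC_E].
have := IH _ EPv hn; rewrite PC_pencil// subrr scale0r => P0.
have := pencil_complement lamC Ev; rewrite PC_pencil// subrr scale0r subr0 P0 => /esym.
have Ec : E (v - PC v) by apply: EB => //; exact: PC_E.
have rl : rho * lam < cabs lamC by rewrite cabs_lam gtr_pMl.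
move=> /(pencil_complexify_inj x0 htheta rl_ge0 Q_lin Q_pow rl Ec)/eqP.
by rewrite subr_eq0 => /eqP.
Qed.

End SpectralPicture.

(** * The essential spectrum *)

(** The error is expressed through exp x alone, so that it can be absorbed into the weights of L at
    x. *)
Lemma expR_dist (R : realType) (x y d : R) : `|x - y| <= d ->
  `|expR x - expR y| <= d * expR d * expR x.
Proof.
move=> xy; have d0 : 0 <= d by exact: le_trans xy.
have := xy; rewrite ler_norml => /andP[xy1 xy2].
have ed : 1 <= expR d by rewrite -expR0 ler_expR.
have h1 := expR_ge1Dx (y - x); have h2 := expR_ge1Dx (x - y).
have e1 : expR y = expR x * expR (y - x) by rewrite -expRD addrC subrK.
have ex := expR_gt0 x.
have u1 : expR x - expR y <= d * expR x.
  have := ler_wpM2l (ltW ex) h1; rewrite -e1 => h3.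
  have := ler_wpM2r (ltW ex) xy2; lra.
have u2 : expR y - expR x <= d * expR d * expR x.
  have ey := expR_gt0 y.
  have e2 : expR x = expR y * expR (x - y) by rewrite -expRD addrC subrK.
  have h4 := ler_wpM2l (ltW ey) h2; rewrite -e2 in h4.
  have h5 : expR y <= expR d * expR x by rewrite -expRD ler_expR; lra.
  have h6 := ler_wpM2l d0 h5.
  have h7 : (y - x) * expR y <= d * expR y by rewrite ler_wpM2r ?(ltW ey)//; lra.
  lra.
have u3 : d * expR x <= d * expR d * expR x.
  by rewrite ler_wpM2r ?(ltW ex)// ler_peMr.
by rewrite ler_norml; apply/andP; split; lra.
Qed.

Lemma sum_enum_val (V : zmodType) (W : finType) (G : W -> V) :
  \sum_w G w = \sum_(i < #|W|) G (enum_val i).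
Proof.
rewrite (reindex (@enum_val W [in W]))//=.
by exists enum_rank => ? _; [exact: enum_valK|exact: enum_rankK].
Qed.

Section EssentialUpper.
Variables (R : realType) (q : nat) (A : 'M[nat]_q) (M : nat) (theta : R).
Variables (f : SFT A -> R) (b F : R) (m : nat).
Implicit Types (g u : SFT A -> R) (t c e a : R).
Hypothesis H : ruelle_data M theta f b F m.

Let htheta := rd_theta H.
Let b_ge1 := rd_b H.
Let f_lip := rd_lip H.

Variable x0 : SFT A.
Local Notation L := (transfer f).
Local Notation bdd := (bdd_lip theta).
Local Notation E := (complex_Ftheta (A := A) theta).
Local Notation LC := (complexify L).
Implicit Types (v : SFT A -> R[i]^o) (z : R[i]).

Variables (lam k : R) (h : SFT A -> R).
Hypothesis lam_gt0 : 0 < lam.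
Hypothesis h_cone : exists a, 0 <= a /\ cone theta a h.
Hypothesis h_eq : L h = fun x => lam * h x.
Hypothesis h_upper : forall x, h x <= k.
Hypothesis h_lower : forall x, 1 <= k * h x.

Let theta_gt0 : 0 < theta. Proof. by case/andP: htheta. Qed.
Let theta_lt1 : theta < 1. Proof. by case/andP: htheta. Qed.
Let h_ge0 x : 0 <= h x. Proof. by have [a [_ []]] := h_cone. Qed.
Let k_gt0 : 0 < k.
Proof.
have := h_lower x0; rewrite ltNge; apply: contraTN => k0.
by rewrite -ltNge (le_lt_trans _ (ltr01 : 0 < 1 :> R))// mulr_le0_ge0.
Qed.

(* Measured against h, the operator L / lam contracts the oscillation by exactly
   theta up to a multiple of the supremum (Lasota-Yorke). *)
Definition weighted s t g := (forall x, `|g x| <= t * h x) /\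
  forall j x y, agree j x y -> `|g x - g y| <= s * theta ^+ j * h x.

Let h_compare x y : h y <= k ^+ 2 * h x.
Proof.
apply: (le_trans (h_upper y)).
by rewrite -[leLHS]mulr1 expr2 -mulrA ler_wpM2l ?(ltW k_gt0).
Qed.

(** Here b e^b bounds the relative variation of the weights e^f, up to theta^j, and k^2 compares h
    at two points. *)
Let c1 := b * expR b * k ^+ 2.
Let c1_ge0 : 0 <= c1.
Proof. by rewrite /c1 !mulr_ge0 ?expR_ge0 ?exprn_ge0 ?(ltW k_gt0)// (le_trans ler01). Qed.

(** Because L h = lambda h, the weights e^f h sum to exactly lambda h. No factor q is lost and the
    variation contracts by theta itself, which makes theta lambda the critical radius. *)
Lemma weighted_transfer s t g : 0 <= s -> 0 <= t -> weighted s t g ->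
  weighted (lam * (theta * s + c1 * t)) (lam * t) (L g).
Proof.
move=> s0 t0 [ht hs].
have Lh x : lam * h x = \sum_(i < q | A i (coordinate x 0) == 1%N)
    expR (f (prepend i x)) * h (prepend i x) by rewrite -transferE h_eq.
split=> [x|j x y xy].
  rewrite mulrAC Lh mulr_suml transferE; apply: (le_trans (ler_norm_sum _ _ _)).
  apply: ler_sum => i _; rewrite normrM ger0_norm ?expR_ge0//.
  by rewrite -mulrA ler_wpM2l ?expR_ge0// mulrC; exact: ht.
rewrite [leRHS](_ : _ = (theta * s + c1 * t) * theta ^+ j * (lam * h x)); last by ring.
rewrite Lh mulr_sumr !transferE -(xy 0%N)// -sumrB.
apply: (le_trans (ler_norm_sum _ _ _)); apply: ler_sum => i /eqP ix.
have pxy := agree_prepend ix xy.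
set x' := prepend i x in pxy *; set y' := prepend i y in pxy *.
rewrite (_ : _ - _ = expR (f x') * (g x' - g y') + (expR (f x') - expR (f y')) * g y'); last by ring.
apply: (le_trans (ler_normD _ _)); rewrite !normrM (ger0_norm (expR_ge0 _)).
have thj : theta ^+ j.+1 <= theta ^+ j by rewrite exprS ler_piMl ?exprn_ge0// ltW.
have b0 : 0 <= b by exact: le_trans b_ge1.
have e1 : expR (f x') * `|g x' - g y'| <= expR (f x') * (s * theta ^+ j.+1 * h x').
  by rewrite ler_wpM2l ?expR_ge0// hs.
have d1 : `|f x' - f y'| <= b * theta ^+ j.
  by apply: (le_trans (f_lip pxy)); rewrite ler_wpM2l.
have e2 : `|expR (f x') - expR (f y')| <= b * theta ^+ j * expR b * expR (f x').
  apply: (le_trans (expR_dist d1)); rewrite ler_wpM2r ?expR_ge0//.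
  rewrite ler_wpM2l ?mulr_ge0 ?exprn_ge0 ?(ltW theta_gt0)// ler_expR.
  by rewrite ler_piMr// exprn_ile1// ?(ltW theta_gt0)// ltW.
have e3 : `|g y'| <= t * (k ^+ 2 * h x').
  by apply: (le_trans (ht _)); rewrite ler_wpM2l.
have e4 := ler_pM (normr_ge0 _) (normr_ge0 _) e2 e3.
apply: (le_trans (lerD e1 e4)); rewrite le_eqVlt; apply/orP; left; apply/eqP.
by rewrite /c1 exprS; ring.
Qed.

(** The constant c1 / (1 - theta) is the fixed point of x |-> theta x + c1. *)
Lemma weighted_iter n s t g : 0 <= s -> 0 <= t -> weighted s t g ->
  weighted (lam ^+ n * (theta ^+ n * s + c1 / (1 - theta) * t)) (lam ^+ n * t) (iter n L g).
Proof.
move=> s0 t0 hg; have th1 : 0 < 1 - theta by rewrite subr_gt0.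
have ct : 0 <= c1 / (1 - theta) * t by rewrite mulr_ge0// divr_ge0// ltW.
elim: n => [|n [IH1 IH2]].
  rewrite !expr0 !mul1r; case: hg => h1 h2; split => // j x y /h2 /le_trans; apply.
  by rewrite ler_wpM2r// ler_wpM2r ?exprn_ge0 ?(ltW theta_gt0)// lerDl.
rewrite iterS (_ : lam ^+ n.+1 * t = lam * (lam ^+ n * t)); last by rewrite exprS mulrA.
rewrite (_ : lam ^+ n.+1 * _ = lam * (theta * (lam ^+ n * (theta ^+ n * s + c1 / (1 - theta) * t))
   + c1 * (lam ^+ n * t))).
  apply: weighted_transfer => //; rewrite mulr_ge0 ?exprn_ge0 ?(ltW lam_gt0)//.
  by rewrite addr_ge0// mulr_ge0// exprn_ge0// ltW.
by rewrite !exprS; field; rewrite gt_eqF.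
Qed.

Lemma lip_weighted s t g : 0 <= s -> 0 <= t -> lip_le rabs theta s g -> sup_le rabs t g ->
  weighted (k * s) (k * t) g.
Proof.
move=> s0 t0 hs ht; split=> [x|j x y /hs xy].
  apply: (le_trans (ht x)); rewrite (mulrC k) -mulrA -[leLHS]mulr1 ler_wpM2l//.
apply: (le_trans xy); rewrite -[leLHS]mulr1.
rewrite (_ : k * s * theta ^+ j * h x = s * theta ^+ j * (k * h x)); last by ring.
by rewrite ler_wpM2l// mulr_ge0// exprn_ge0// ltW.
Qed.

Lemma weighted_bdd s t g : 0 <= s -> 0 <= t -> weighted s t g -> bdd (k * (s + t)) g.
Proof.
move=> s0 t0 [ht hs]; exists (k * s), (k * t); split; rewrite ?mulr_ge0 ?(ltW k_gt0)//.
- move=> j x y /hs /le_trans; apply; rewrite mulrC -mulrA ler_wpM2r//.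
  by rewrite mulr_ge0// exprn_ge0// ltW.
- by move=> x; apply: (le_trans (ht x)); rewrite mulrC ler_wpM2r.
- by rewrite mulrDr.
Qed.

(* L^n differs from this operator, of norm O((theta lam)^n), by a finite rank
   operator. *)
Definition tail_operator n g := iter n L (fun x => g x - discretize x0 n g x).

Lemma tail_lin n c' g g' : tail_operator n (fun x => c' * g x + g' x) =
  fun x => c' * tail_operator n g x + tail_operator n g' x.
Proof.
rewrite /tail_operator -iter_transfer_lin; congr (iter n L _).
by apply/funext => x; rewrite /discretize; ring.
Qed.

Lemma tail_bound : exists2 C, 0 <= C & forall n t g, bdd t g ->
  bdd (C * (theta * lam) ^+ n * t) (tail_operator n g).
Proof.
have th1 : 0 < 1 - theta by rewrite subr_gt0.
have c1' : 0 <= c1 / (1 - theta) by rewrite divr_ge0// ltW.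
have k0 := ltW k_gt0.
have C0 : 0 <= k * (k * 2 + c1 / (1 - theta) * k + k).
  by apply: mulr_ge0 => //; apply: addr_ge0 => //; apply: addr_ge0; exact: mulr_ge0.
exists (k * (k * 2 + c1 / (1 - theta) * k + k)) => //.
move=> n t g [s [s' [hs hs' s0 s'0 st]]].
have thn : 0 <= theta ^+ n by rewrite exprn_ge0// ltW.
pose g' x := g x - discretize x0 n g x.
have dg x : `|g' x| <= s * theta ^+ n.
  by apply: hs; apply: agree_sym; exact: word_pointK.
have lg' : lip_le rabs theta (2 * s) g'.
  move=> j x y xy; rewrite /rabs; have [nj|jn] := leqP n j.
    rewrite /g' (discretize_const x0 g (agree_le nj xy)) opprB addrA subrK.
    apply: (le_trans (hs _ _ _ xy)); rewrite ler_wpM2r ?exprn_ge0 ?(ltW theta_gt0)//; lra.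
  apply: (le_trans (ler_normB _ _)); apply: (le_trans (lerD (dg x) (dg y))).
  have h1 : s * theta ^+ n <= s * theta ^+ j.
    by apply: ler_wpM2l => //; apply: ler_wiXn2l; [exact: ltW|exact: ltW|exact: ltnW].
  lra.
have s2 : 0 <= 2 * s by rewrite mulr_ge0.
have sn : 0 <= s * theta ^+ n by rewrite mulr_ge0.
have w1 := lip_weighted s2 sn lg' dg.
have w2 := weighted_iter n (mulr_ge0 k0 s2) (mulr_ge0 k0 sn) w1.
have lamn : 0 <= lam ^+ n by rewrite exprn_ge0// ltW.
have w3 := weighted_bdd _ _ w2.
apply: bdd_lip_le (w3 _ _).
- rewrite exprMn [leLHS](_ : _ = k * (k * 2 + c1 / (1 - theta) * k + k) *
    (theta ^+ n * lam ^+ n) * s); last by ring.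
  rewrite ler_wpM2l//; last by lra.
  by rewrite mulr_ge0// mulr_ge0.
- by apply: mulr_ge0 => //; apply: addr_ge0; apply: mulr_ge0 => //; exact: mulr_ge0.
- by apply: mulr_ge0 => //; exact: mulr_ge0.
Qed.

Let EZ z v : E v -> E (z *: v).
Proof. by move=> Ev; exact: (holder_scaleE x0 htheta z Ev).1. Qed.
Let ED v w : E v -> E w -> E (v + w).
Proof. by move=> Ev Ew; exact: (holder_addE x0 htheta Ev Ew).1. Qed.

Let E0 : E 0.
Proof.
have h1 : E (0 : SFT A -> R[i]^o) /\ _ :=
  holder_ReIm x0 htheta (u := 0) (bdd_lip_cst A theta 0) (bdd_lip_cst A theta 0).
exact: h1.1.
Qed.

Let iterLC_E n v : E v -> E (complexify (iter n L) v).
Proof.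
move=> Ev.
have [t ht] := bdd_lip_iter H x0 n (holder_Re x0 htheta Ev).
have [t' ht'] := bdd_lip_iter H x0 n (holder_Im x0 htheta Ev).
exact: (holder_ReIm x0 htheta (u := complexify (iter n L) v) ht ht').1.
Qed.

Let LC_lin z v w : E v -> E w -> LC (z *: v + w) = z *: LC v + LC w.
Proof.
by apply: (complexify_lin x0 htheta) => c' t t' g g' _ _; exact: transfer_lin.
Qed.

(** The images of the cylinder indicators span the finite rank part of L^n. *)
Definition cyl_image n w : SFT A -> R[i]^o :=
  complexify (iter n L) (fun x => Complex (cyl R (k := n) w x) 0).

Arguments cyl_image : clear implicits.

Lemma cyl_image_E n w : E (cyl_image n w).
Proof.
apply: iterLC_E; have [t ht] := cyl_bdd H x0 w.
exact: (holder_ReIm x0 htheta (u := fun x => Complex (cyl R (k := n) w x) 0)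
  ht (bdd_lip_cst A theta 0)).1.
Qed.

Lemma iter_transfer_sum n (W : finType) (a_ : W -> R) (u_ : W -> SFT A -> R) :
  iter n L (fun x => \sum_w a_ w * u_ w x) = fun x => \sum_w a_ w * iter n L (u_ w) x.
Proof.
suff hs (s : seq W) : iter n L (fun x => \sum_(w <- s) a_ w * u_ w x) =
   fun x => \sum_(w <- s) a_ w * iter n L (u_ w) x by exact: hs.
elim: s => [|w s IH].
  rewrite (_ : (fun x => _) = fun x => 0 * (fun=> 0) x); last first.
    by apply/funext => x; rewrite big_nil mul0r.
  by rewrite iter_transferZ; apply/funext => x; rewrite big_nil mul0r.
rewrite (_ : (fun x => _) = fun x => a_ w * u_ w x + \sum_(w <- s) a_ w * u_ w x); last first.
  by apply/funext => x; rewrite big_cons.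
by rewrite iter_transfer_lin IH; apply/funext => x; rewrite big_cons.
Qed.

Let complex_sum (W : finType) (a_ b_ : W -> R) :
  Complex (\sum_w a_ w) (\sum_w b_ w) = \sum_w Complex (a_ w) (b_ w).
Proof.
suff hs (s : seq W) : Complex (\sum_(w <- s) a_ w) (\sum_(w <- s) b_ w) =
  \sum_(w <- s) Complex (a_ w) (b_ w) by exact: hs.
by elim: s => [|w s IH]; rewrite ?big_nil// !big_cons -IH.
Qed.

Lemma iter_decomp n v : complexify (iter n L) v = complexify (tail_operator n) v +
  \sum_w v (word_point x0 w) *: cyl_image n w.
Proof.
have hd g : iter n L g = fun x => tail_operator n g x +
    \sum_w g (word_point x0 w) * iter n L (cyl R (k := n) w) x.
  apply/funext => x; rewrite /tail_operator iter_transferB discretizeE.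
  by rewrite iter_transfer_sum subrK.
apply/funext => x; rewrite addfE fct_sumE.
rewrite {1}/complexify (hd (fun y => complex.Re (v y))) (hd (fun y => complex.Im (v y))).
have L0 : iter n L (fun=> 0) x = 0.
  have := congr1 (fun u => u x) (iter_transferZ f n 0 (fun=> 0)).
  by rewrite (mul0r (iter n L (fun=> 0) x)) (mul0r 0).
rewrite (_ : \sum_w (v (word_point x0 w) *: cyl_image n w) x = Complex
  (\sum_w complex.Re (v (word_point x0 w)) * iter n L (cyl R (k := n) w) x)
  (\sum_w complex.Im (v (word_point x0 w)) * iter n L (cyl R (k := n) w) x)) //.
rewrite complex_sum; apply: eq_bigr => w _; rewrite scalefE /cyl_image /complexify /=.
rewrite (_ : iter n L (fun y => cyl R w y) = iter n L (cyl R w))// L0.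
by case: (v _) => a c; apply/eqP; rewrite eq_complex /=; apply/andP; split; apply/eqP; ring.
Qed.

(** Write L^n = T + G with T the tail operator and G of finite rank, and let S invert z^n - T. An
    element u of the kernel of z - L satisfies (z^n - T) u = G u, so u = S G u. Any v equals (z^n -
    L^n) S v + G S v, and z^n - L^n maps into the range of z - L. *)
Lemma fredholm_outside z : theta * lam < cabs z -> fredholm E (pencil LC z).
Proof.
move=> tz; have [C C0 hC] := tail_bound.
have tl0 : 0 < theta * lam by rewrite mulr_gt0.
have z_gt0 : 0 < cabs z by exact: lt_trans tz.
(* The constant C of the tail bound may exceed 1 and is only beaten for large n, hence the passage
   to powers of L. *)
have [n hn] : exists n, C * (theta * lam) ^+ n < cabs (z ^+ n).
  have : geometric C (theta * lam / cabs z) @ \oo --> 0.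
    apply: cvg_geometric; rewrite ger0_norm; last by rewrite divr_ge0// ltW.
    by rewrite ltr_pdivrMr// mul1r.
  move=> /cvgrPdist_lt /(_ _ ltr01) [n _ /(_ n (leqnn _))]; rewrite sub0r normrN => h1.
  exists n; rewrite cabsX; have := le_lt_trans (ler_norm _) h1.
  by rewrite /geometric /= exprMn exprVn mulrA ltr_pdivrMr ?exprn_gt0// mul1r.
set r := C * _ in hn; have r0 : 0 <= r by rewrite mulr_ge0// exprn_ge0// ltW.
have T_lin c' t t' g g' : bdd t g -> bdd t' g' ->
    tail_operator n (fun x => c' * g x + g' x) =
    fun x => c' * tail_operator n g x + tail_operator n g' x.
  by move=> _ _; exact: tail_lin.
have T_pow j t g : bdd t g -> bdd (1 * r ^+ j * t) (iter j (tail_operator n) g).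
  rewrite mul1r; elim: j => [|j IH] hg; first by rewrite expr0 mul1r.
  by rewrite iterS exprS -mulrA; apply: hC; exact: IH.
have [S [S1 _ S3 S4]] := complexify_neumann x0 htheta ler01 r0 T_lin T_pow hn.
pose e w := cyl_image n w.
have Ee w : E (e w) by exact: cyl_image_E.
pose G v := \sum_w v (word_point x0 w) *: e w.
have pencilT v : pencil (complexify (tail_operator n)) (z ^+ n) v =
    z ^+ n *: v - iter n LC v + G v.
  by rewrite complexify_iter iter_decomp /pencil opprD addrA subrK.
have S_lin k' v w : E v -> E w -> S (k' *: v + w) = k' *: S v + S w.
  move=> Ev Ew; have E1 : E (k' *: S v + S w) by apply: ED; [exact/EZ/S1|exact: S1].
  rewrite -(S3 _ E1); congr S; rewrite -{1}(S4 _ Ev) -{1}(S4 _ Ew).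
  rewrite /pencil (complexify_lin x0 htheta T_lin k' (S1 _ Ev) (S1 _ Ew)).
  by rewrite scalerBr scalerDr !scalerA mulrC opprD addrACA.
have S_0 : S 0 = 0.
  by have := S_lin (-1) _ _ E0 E0; rewrite scaleN1r addNr scaleN1r addNr.
have S_sum (s : seq {ffun 'I_n.+1 -> 'I_q}) (a_ : _ -> R[i]) :
    E (\sum_(w <- s) a_ w *: e w) /\
    S (\sum_(w <- s) a_ w *: e w) = \sum_(w <- s) a_ w *: S (e w).
  elim: s => [|w s [IH1 IH2]]; first by rewrite !big_nil.
  by rewrite !big_cons; split; [apply: ED => //; exact: EZ|rewrite S_lin// IH2].
pose W : finType := {ffun 'I_n.+1 -> 'I_q}.
split.
  exists #|W|, (fun i => S (e (enum_val i))) => u Eu pu.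
  have Lu j : iter j LC u = z ^+ j *: u.
    elim: j => [|j IH]; first by rewrite expr0 scale1r.
    rewrite iterS IH; have := LC_lin (z ^+ j) Eu E0.
    have -> : LC 0 = 0 by have := LC_lin (-1) E0 E0; rewrite scaleN1r addNr scaleN1r addNr.
    rewrite !addr0 => ->; move/eqP: pu; rewrite subr_eq0 => /eqP <-.
    by rewrite scalerA exprSr.
  exists (fun i => u (word_point x0 (enum_val i))).
  rewrite -[LHS](S3 _ Eu) pencilT Lu subrr add0r (S_sum _ _).2.
  exact: (@sum_enum_val _ W (fun w => u (word_point x0 w) *: S (e w))).
have Lpow j v : E v -> exists2 u, E u & z ^+ j *: v - iter j LC v = pencil LC z u.
  elim: j v => [|j IH] v Ev.
    by exists 0 => //; rewrite expr0 scale1r subrr /pencil scaler0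
      (_ : LC 0 = 0) ?subrr//; have := LC_lin (-1) E0 E0;
      rewrite scaleN1r addNr scaleN1r addNr.
  have ELv : E (LC v) by exact: (iterLC_E 1 Ev).
  have [u Eu hu] := IH _ ELv.
  exists (z ^+ j *: v + u); first by apply: ED => //; exact: EZ.
  have -> : pencil LC z (z ^+ j *: v + u) = z ^+ j *: pencil LC z v + pencil LC z u.
    by rewrite /pencil LC_lin// scalerDr scalerBr !scalerA mulrC opprD addrACA.
  by rewrite -hu iterSr /pencil scalerBr scalerA exprSr addrA subrK.
exists #|W|, (fun i => e (enum_val i)); split => // v Ev.
have ES := S1 _ Ev; have [u Eu hu] := Lpow n _ ES.
exists u, (fun i => S v (word_point x0 (enum_val i))); split => //.
rewrite -{1}(S4 _ Ev) pencilT hu; congr (_ + _).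
exact: (@sum_enum_val _ W (fun w => S v (word_point x0 w) *: e w)).
Qed.

End EssentialUpper.

(** * Products, inverses, exponentials and shifts of Lipschitz functions *)

Section LipschitzAlgebra.
Variables (R : realType) (q : nat) (A : 'M[nat]_q) (theta : R).
Hypothesis htheta : 0 < theta < 1.
Let theta_gt0 : 0 < theta. Proof. by case/andP: htheta. Qed.
Let theta_lt1 : theta < 1. Proof. by case/andP: htheta. Qed.
Let thetaX j : 0 <= theta ^+ j. Proof. by rewrite exprn_ge0// ltW. Qed.
Local Notation bdd := (bdd_lip theta).
Implicit Types (g u : SFT A -> R) (t : R).

Lemma bdd_lipM t t' g u : bdd t g -> bdd t' u -> bdd (t * t') (fun x => g x * u x).
Proof.
move=> [s1 [s2 [h1 h2 h3 h4 h5]]] [s1' [s2' [h1' h2' h3' h4' h5']]].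
exists (s2 * s1' + s1 * s2'), (s2 * s2'); split.
- move=> k x y xy; rewrite /rabs.
  rewrite (_ : _ - _ = g x * (u x - u y) + (g x - g y) * u y); last by ring.
  apply: (le_trans (ler_normD _ _)); rewrite !normrM mulrDl lerD//.
    by rewrite -mulrA; apply: ler_pM => //; [exact: h2|exact: h1'].
  by rewrite mulrAC; apply: ler_pM => //; [exact: h1|exact: h2'].
- by move=> x; rewrite /rabs normrM; apply: ler_pM => //; [exact: h2|exact: h2'].
- by rewrite addr_ge0 ?mulr_ge0.
- by rewrite mulr_ge0.
have := ler_pM (addr_ge0 h3 h4) (addr_ge0 h3' h4') h5 h5'.
by apply: le_trans; have := mulr_ge0 h3 h3'; lra.
Qed.

Lemma bdd_lip_inv k t g : 0 < k -> bdd t g -> (forall x, 1 <= k * g x) ->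
  bdd (k ^+ 2 * t + k) (fun x => (g x)^-1).
Proof.
move=> k0 [s1 [s2 [h1 h2 h3 h4 h5]]] kg.
have g0 x : 0 < g x by have := lt_le_trans ltr01 (kg x); rewrite pmulr_rgt0.
have gk x : (g x)^-1 <= k by rewrite -div1r ler_pdivrMr.
exists (k ^+ 2 * s1), k; split.
- move=> j x y xy; rewrite /rabs.
  rewrite (_ : _ - _ = (g x)^-1 * (g y)^-1 * (g y - g x)); last first.
    by field; rewrite !gt_eqF.
  rewrite normrM ger0_norm; last by rewrite mulr_ge0 ?invr_ge0 ?ltW.
  rewrite distrC -[leRHS]mulrA; apply: ler_pM; rewrite ?normr_ge0//.
  + by rewrite mulr_ge0 ?invr_ge0 ?ltW.
  + by rewrite expr2; apply: ler_pM; rewrite ?invr_ge0 ?gk// ltW.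
  + exact: h1.
- by move=> x; rewrite /rabs ger0_norm// invr_ge0 ltW.
- by rewrite mulr_ge0// exprn_ge0// ltW.
- exact: ltW.
- by rewrite lerD2r ler_wpM2l ?exprn_ge0 ?(ltW k0)//; lra.
Qed.

Lemma bdd_lip_exp t g : bdd t g ->
  bdd (t * expR t * expR t + expR t) (fun x => expR (g x)).
Proof.
move=> hg; have t0 := bdd_lip_ge0 hg; move: hg => [s1 [s2 [h1 h2 h3 h4 h5]]].
have gt x : g x <= t by have := h2 x; rewrite /rabs ler_norml => /andP[_]; lra.
exists (t * expR t * expR t), (expR t); split => //.
- move=> j x y xy; rewrite /rabs.
  have d : `|g x - g y| <= t * theta ^+ j.
    by apply: (le_trans (h1 _ _ _ xy)); rewrite ler_wpM2r//; lra.
  apply: (le_trans (expR_dist d)).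
  rewrite [leRHS](_ : _ = t * theta ^+ j * expR t * expR t); last by ring.
  apply: ler_pM; rewrite ?expR_ge0 ?ler_expR ?mulr_ge0 ?expR_ge0//.
  by rewrite ler_wpM2l ?mulr_ge0// ler_expR ler_piMr// exprn_ile1// ltW.
- by move=> x; rewrite /rabs ger0_norm ?expR_ge0// ler_expR.
- by rewrite !mulr_ge0 ?expR_ge0.
Qed.

(** After n shifts an agreement up to j becomes one up to j - n, at the cost of theta^-n; for j < n
    the trivial bound 2 t is used. *)
Lemma bdd_lip_comp_shift n t g : bdd t g ->
  bdd (3 * t * theta ^- n) (fun x => g (iter n (@sft_shift q A) x)).
Proof.
move=> hg; have t0 := bdd_lip_ge0 hg; move: hg => [s1 [s2 [h1 h2 h3 h4 h5]]].
have thn : 0 < theta ^+ n by rewrite exprn_gt0.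
have ithn : 1 <= theta ^- n by rewrite invf_ge1// exprn_ile1// ltW.
have i0 : 0 <= theta ^- n by exact: le_trans ithn.
exists (2 * t * theta ^- n), (t * theta ^- n); split => //.
- move=> j x y xy; rewrite /rabs; have [nj|jn] := leqP n j.
    have : agree (j - n) (iter n (@sft_shift q A) x) (iter n (@sft_shift q A) y).
      by move=> l ljn; rewrite !iter_shiftE; apply: xy; rewrite -(subnK nj) leq_add2r.
    move=> /h1 /le_trans; apply.
    rewrite -{2}(subnKC nj) exprD mulrA mulrVK ?unitfE ?gt_eqF//.
    by rewrite ler_wpM2r//; lra.
  apply: (le_trans (ler_normB _ _)); apply: (le_trans (lerD (h2 _) (h2 _))).
  apply: (@le_trans _ _ (2 * t)); first by lra.
  rewrite -mulrA ler_peMr ?mulr_ge0// mulrC ler_pdivlMr// mul1r.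
  by apply: ler_wiXn2l; [exact: ltW|exact: ltW|exact: ltnW].
- by move=> x; apply: (le_trans (h2 _)); apply: (@le_trans _ _ t); [lra|rewrite ler_peMr].
- by rewrite !mulr_ge0.
- by rewrite mulr_ge0.
- by lra.
Qed.

End LipschitzAlgebra.

(** * Infinite dimensional eigenspaces inside the disc *)

Section EssentialLower.
Variables (R : realType) (q : nat) (A : 'M[nat]_q) (M : nat) (theta : R).
Variables (f : SFT A -> R) (b F : R) (m : nat).
Implicit Types (g u : SFT A -> R) (t c e a : R).
Hypothesis H : ruelle_data M theta f b F m.

Let hA := rd_A H.
Let hAM := rd_AM H.
Let htheta := rd_theta H.
Let b_ge1 := rd_b H.
Let F_ge0 := rd_F H.
Let f_lip := rd_lip H.
Let f_sup := rd_sup H.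

Variable x0 : SFT A.
Local Notation L := (transfer f).
Local Notation bdd := (bdd_lip theta).
Local Notation E := (complex_Ftheta (A := A) theta).
Local Notation LC := (complexify L).
Implicit Types (v : SFT A -> R[i]^o).

Variables (lam k th : R) (h : SFT A -> R).
Hypothesis lam_gt0 : 0 < lam.
Hypothesis h_bdd : bdd th h.
Hypothesis h_eq : L h = fun x => lam * h x.
Hypothesis k_gt0 : 0 < k.
Hypothesis h_lower : forall x, 1 <= k * h x.

Let theta_gt0 : 0 < theta. Proof. by case/andP: htheta. Qed.
Let h_gt0 x : 0 < h x.
Proof. by have := lt_le_trans ltr01 (h_lower x); rewrite pmulr_rgt0. Qed.

(* A right inverse of lam^-1 L. *)
Definition koopman g : SFT A -> R := fun x => h x * (g (sft_shift x) / h (sft_shift x)).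

Lemma koopman_iter n g : iter n koopman g =
  fun x => h x * (g (iter n (@sft_shift q A) x) / h (iter n (@sft_shift q A) x)).
Proof.
elim: n => [|n IH]; first by apply/funext => x /=; rewrite mulrC divfK// gt_eqF.
rewrite iterS IH; apply/funext => x; rewrite /koopman -iterSr.
by rewrite [h (sft_shift x) * _]mulrC mulfK ?gt_eqF.
Qed.

Lemma koopman_lin c' g g' : koopman (fun x => c' * g x + g' x) =
  fun x => c' * koopman g x + koopman g' x.
Proof. by apply/funext => x; rewrite /koopman; ring. Qed.

(** The factors h telescope in [koopman_iter], so the only growth is the theta^-n of the n-fold
    shift. *)
Lemma koopman_pow n t g : bdd t g ->
  bdd (th * (3 * (k ^+ 2 * th + k)) * theta^-1 ^+ n * t) (iter n koopman g).
Proof.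
move=> hg; rewrite koopman_iter.
have hi := bdd_lip_inv k_gt0 h_bdd h_lower.
have := bdd_lipM h_bdd (bdd_lip_comp_shift htheta n (bdd_lipM hg hi)).
by apply: bdd_lip_le; rewrite exprVn le_eqVlt; apply/orP; left; apply/eqP; ring.
Qed.

Lemma transfer_koopman g : L (koopman g) = fun x => lam * g x.
Proof.
apply/funext => x.
rewrite (_ : koopman g = fun y => (g (sft_shift y) / h (sft_shift y)) * h y); last first.
  by apply/funext => y; rewrite /koopman mulrC.
rewrite (transfer_shift f h (fun y => g y / h y)) h_eq.
by rewrite mulrCA divfK ?gt_eqF.
Qed.

(* phi l isolates the points that leave the orbit of y between times l M and
   (l + 1) M; each one, carried by the two preimages i and i' of a symbol j with
   opposite signs, yields an element of the kernel of L. *)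
Lemma kernel_family : exists (w : nat -> SFT A -> R) (p : nat -> SFT A),
  [/\ forall l, exists t, bdd t (w l), forall l, L (w l) = fun=> 0,
      forall l, w l (p l) != 0 & forall l l', l != l' -> w l (p l') = 0].
Proof.
have [i [i' [j [ii' ij i'j]]]] := exists_branching hA hAM (rd_q H).
have [y [yj _]] := connect_pow hA (hAM j (coordinate x0 0)).
pose near l (x : SFT A) := agree (l * M) x y /\ ~ agree (l.+1 * M) x y.
pose phi l (x : SFT A) : R := (`[< near l x >])%:R.
pose psi (x : SFT A) : R := (coordinate x 0 == i)%:R - (coordinate x 0 == i')%:R.
have /choice[z_ hz] l : exists z : SFT A, near l z.
  (* After a bridge of M steps the symbol can be prescribed: one of i and i' differs from the symbol
     of y there, which forces the departure within the window. *)
  pose s := if coordinate y (l * M + M) == i then i' else i.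
  have sy : s != coordinate y (l * M + M).
    by rewrite /s; have [->|] := eqVneq (coordinate y (l * M + M)) i; rewrite eq_sym.
  have [x [xs _]] := connect_pow hA (hAM s (coordinate x0 0)).
  have [z [zy zx]] := mixing hA hAM (l * M) x y.
  exists z; split => // zy'; move/eqP: sy; apply.
  by rewrite -xs -zx iter_shiftE add0n zy'// mulSn addnC.
have zj l : coordinate (z_ l) 0 = j by have [h1 _] := hz l; rewrite h1.
have iz l : A i (coordinate (z_ l) 0) = 1%N by rewrite zj.
have phi_z l l' : phi l (z_ l') = (l == l')%:R.
  rewrite /phi; case: eqP => [->|ll']; first by rewrite asboolT.
  rewrite asboolF// => -[h1 h2]; have [h3 h4] := hz l'.
  have /orP[lt|lt] : (l < l')%N || (l' < l)%N by rewrite -neq_ltn; exact/eqP.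
    by apply: h2; apply: agree_le h3; rewrite leq_mul2r lt orbT.
  by apply: h4; apply: agree_le h1; rewrite leq_mul2r lt orbT.
(* The factor exp (- f) cancels the weight of L, so that only the opposite signs of the two
   preimages remain. *)
exists (fun l x => expR (- f x) * (psi x * phi l (sft_shift x))), (fun l => prepend i (z_ l)).
split.
- move=> l; have bf : bdd (b + F) (fun x => - f x).
    apply: bdd_lipN; exists b, F; split => //; exact: le_trans b_ge1.
  have [t ht] : exists t, bdd t (fun x => psi x * phi l (sft_shift x)).
    apply: (locally_constant_bdd x0 htheta); exists (l.+1 * M).+1 => x x' xx'.
    rewrite /psi (xx' 0%N)//; congr (_ * _); rewrite /phi; congr (nat_of_bool _)%:R.
    have nearE (u u' : SFT A) : agree (l.+1 * M) u u' -> near l u -> near l u'.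
      move=> uu' [h1 h2]; split.
        apply: agree_trans h1; apply/agree_sym/(agree_le _ uu').
        by rewrite leq_mul2r leqnSn orbT.
      by move=> h3; apply: h2; exact: agree_trans uu' h3.
    apply: asbool_equiv_eq; split; apply: nearE; first exact: agree_shift.
    by apply: agree_sym; exact: agree_shift.
  by eexists; exact: bdd_lipM (bdd_lip_exp htheta bf) ht.
- move=> l; apply/funext => x; rewrite transferE.
  rewrite (eq_bigr (fun s : 'I_q => phi l x * ((s == i)%:R - (s == i')%:R))); last first.
    move=> s /eqP sx; rewrite mulrA -expRD addrN expR0 mul1r.
    by rewrite shift_prepend// /psi prepend0// mulrC.
  rewrite -mulr_sumr; have [nx|nx] := asboolP (near l x); last first.
    by rewrite /phi asboolF// mul0r.
  have xj : coordinate x 0 = j by case: nx => h1 _; rewrite h1.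
  rewrite sumrB.
  rewrite (bigD1 i)/=; last by rewrite xj ij.
  rewrite eqxx big1 ?addr0; last by move=> s /andP[_ /negPf ->].
  rewrite (bigD1 i')/=; last by rewrite xj i'j.
  rewrite eqxx big1 ?addr0; last by move=> s /andP[_ /negPf ->].
  by rewrite subrr mulr0.
- move=> l; rewrite shift_prepend// phi_z eqxx mulr1 /psi prepend0// eqxx.
  by rewrite (negPf ii') subr0 mulr1 gt_eqF// expR_gt0.
- move=> l l' ll'; rewrite shift_prepend// phi_z (negPf ll').
  by rewrite !mulr0.
Qed.

Let EZ z v : E v -> E (z *: v).
Proof. by move=> Ev; exact: (holder_scaleE x0 htheta z Ev).1. Qed.
Let ED (v w : SFT A -> R[i]^o) : E v -> E w -> E (v + w).
Proof. by move=> Ev Ew; exact: (holder_addE x0 htheta Ev Ew).1. Qed.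

(** Let U l solve (lambda / t - koopman) U = w l, which is possible as lambda / t > 1 / theta.
    Applying L shows L (U l) = t (U l). If n vectors spanned the kernel, n + 1 of the U l would be
    dependent; the relation passes to the w l, and evaluation at p l kills its coefficients. *)
Lemma essential_spectrum_inside t : 0 < t -> t < theta * lam ->
  essential_spectrum E LC (real_complex R t).
Proof.
move=> t0 tl [[n [e he]] _].
have th0 := bdd_lip_ge0 h_bdd.
have C0 : 0 <= th * (3 * (k ^+ 2 * th + k)).
  by rewrite mulr_ge0// mulr_ge0// addr_ge0 ?(ltW k_gt0)// mulr_ge0// exprn_ge0// ltW.
have r0 : 0 <= theta^-1 by rewrite invr_ge0 ltW.
pose z' := real_complex R (lam / t).
have zr : theta^-1 < cabs z'.
  rewrite cabs_real ger0_norm; last by rewrite divr_ge0// ltW.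
  by rewrite ltr_pdivlMr// mulrC ltr_pdivrMr// mulrC.
have K_lin c' t1 t2 g g' : bdd t1 g -> bdd t2 g' ->
    koopman (fun x => c' * g x + g' x) = fun x => c' * koopman g x + koopman g' x.
  by move=> _ _; exact: koopman_lin.
have [S [S1 _ _ S4]] := complexify_neumann x0 htheta C0 r0 K_lin koopman_pow zr.
have [w [p [wb wL wp wp']]] := kernel_family.
pose W l : SFT A -> R[i]^o := fun x => Complex (w l x) 0.
have EW l : E (W l).
  have [t1 h1] := wb l.
  exact: (holder_ReIm x0 htheta (u := W l) h1 (bdd_lip_cst A theta 0)).1.
have LW l : LC (W l) = 0.
  apply/funext => x; apply/eqP; rewrite eq_complex /=.
  rewrite (_ : (fun y => w l y) = w l)// wL eqxx /=.
  by rewrite (_ : (fun=> 0) = fun y => 0 * w l y) ?transferZ ?mul0r//; apply/funext => y; rewrite mul0r.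
have LK v : LC (complexify koopman v) = real_complex R lam *: v.
  apply/funext => x; rewrite scalefE /complexify.
  rewrite (transfer_koopman (fun y => complex.Re (v y))).
  rewrite (transfer_koopman (fun y => complex.Im (v y))).
  by case: (v x) => a c'; apply/eqP; rewrite eq_complex /=; apply/andP; split; apply/eqP; ring.
have LC_lin (z : R[i]) (v v' : SFT A -> R[i]^o) : E v -> E v' -> LC (z *: v + v') = z *: LC v + LC v'.
  by apply: (complexify_lin x0 htheta) => c' t1 t2 g g' _ _; exact: transfer_lin.
have z'0 : z' != 0.
  by apply: contraTneq zr => ->; rewrite (cabs_real 0) normr0 -leNgt.
pose U l := S (W l); have EU l : E (U l) by exact: S1.
have LU l : pencil LC (real_complex R t) (U l) = 0.
  have := S4 _ (EW l); rewrite -/(U l) /pencil => /(congr1 LC).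
  have EK : E (complexify koopman (U l)).
    exact: (complexify_pow x0 htheta koopman_pow 1 (EU l)).1.
  rewrite LW addrC -scaleN1r LC_lin//; last exact: EZ.
  have E0 : E 0 by rewrite -(scale0r (U l)); exact: EZ.
  have LC0 : LC 0 = 0.
    by have := LC_lin (-1) _ _ E0 E0; rewrite scaleN1r addNr scaleN1r addNr.
  have -> : LC (z' *: U l) = z' *: LC (U l).
    by have := LC_lin z' _ _ (EU l) E0; rewrite LC0 !addr0.
  rewrite LK scaleN1r addrC => /eqP; rewrite subr_eq0 => /eqP zl.
  have tz : real_complex R t = z'^-1 * real_complex R lam.
    rewrite /z' -fmorphV -rmorphM; congr (real_complex R _).
    by field; rewrite !gt_eqF.
  by rewrite tz -scalerA -zl scalerA mulVf// scale1r subrr.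
have /choice[cf hcf] l := he _ (EU l) (LU l).
pose Cm : 'M[R[i]]_(n.+1, n) := \matrix_(l < n.+1, i < n) cf l i.
(* There are n + 1 rows and only n columns, so the rows are dependent. *)
have ker0 : kermx Cm != 0.
  rewrite -mxrank_eq0 mxrank_ker -lt0n subn_gt0.
  by apply: leq_ltn_trans (rank_leq_col Cm) _.
have /rowV0Pn[r rk rn0] := ker0.
have rC : r *m Cm = 0 by apply/sub_kermxP.
have rU : \sum_(l < n.+1) r 0 l *: U l = 0.
  under eq_bigr => l _ do rewrite hcf scaler_sumr.
  rewrite exchange_big /= big1// => i _.
  under eq_bigr => l _ do rewrite scalerA.
  rewrite -scaler_suml.
  have := congr1 (fun X : 'rV[R[i]]_n => X 0 i) rC; rewrite !mxE.
  by under eq_bigr => l _ do rewrite mxE; move=> ->; rewrite scale0r.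
have pS (s : seq 'I_n.+1) : E (\sum_(l <- s) r 0 l *: U l) /\
    pencil (complexify koopman) z' (\sum_(l <- s) r 0 l *: U l) = \sum_(l <- s) r 0 l *: W l.
  elim: s => [|l s [IH1 IH2]].
    have E0 : E 0 by rewrite -(scale0r (U 0%N)); exact: EZ.
    rewrite !big_nil; split => //; rewrite /pencil scaler0.
    have := complexify_lin x0 htheta K_lin (-1) E0 E0.
    by rewrite scaleN1r addNr scaleN1r addNr => ->; rewrite subrr.
  rewrite !big_cons; split; first by apply: ED => //; exact: EZ.
  rewrite -IH2 -[W l](S4 _ (EW l)) -/(U l).
  rewrite /pencil (complexify_lin x0 htheta K_lin _ (EU l) IH1).
  by rewrite scalerBr scalerDr !scalerA mulrC opprD addrACA.
have rW : \sum_(l < n.+1) r 0 l *: W l = 0.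
  have [_ <-] := pS (index_enum 'I_n.+1); rewrite rU.
  have [] := pS [::]; rewrite !big_nil => _; exact.
apply/negP: rn0; rewrite negbK; apply/eqP/rowP => l0; rewrite [RHS]mxE.
have := congr1 (fun u : SFT A -> R[i]^o => u (p l0)) rW.
rewrite fct_sumE (bigD1 l0)//= big1 ?addr0; last first.
  move=> l ll0; by rewrite scalefE /W wp' ?mulr0//.
rewrite scalefE => /eqP; rewrite mulf_eq0 => /orP[/eqP//|].
rewrite eq_complex /= => /andP[/eqP h1 _].
by have := wp l0; rewrite h1 eqxx.
Qed.

End EssentialLower.

(** * Explicit constants *)

Lemma bernoulli_ineq (R : realFieldType) (x : R) n : 0 <= x <= 1 ->
  1 - n%:R * x <= (1 - x) ^+ n.
Proof.
move=> /andP[x0 x1]; elim: n => [|n IH]; first by rewrite mul0r subr0 expr0.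
rewrite exprS -natr1; apply: le_trans (ler_wpM2l _ IH); last by rewrite subr_ge0.
have := mulr_ge0 (ler0n R n) (mulr_ge0 x0 x0); lra.
Qed.

Section Constants.
Variables (R : realType) (q M : nat) (theta b F : R).
Hypothesis q_gt1 : (1 < q)%N.
Hypothesis M_gt0 : (0 < M)%N.
Hypothesis htheta : 0 < theta < 1.
Hypothesis b_ge1 : 1 <= b.
Hypothesis F_ge0 : 0 <= F.

Local Notation B := (expR (2 * theta / (1 - theta)) * q%:R ^+ M.+1
  * expR (2 * M.+1%:R * F) / (1 - theta)).
Local Notation r0 := ((ln q%:R + 2 * F) / `|ln theta|).
Local Notation K := (B * b `^ r0).
Local Notation rho := (1 - (1 - theta) / (8 * K ^+ 3)).
Local Notation D := (100 * K ^+ 5 * b ^+ 3 / (1 - theta)).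
Local Notation w := (q%:R * expR (2 * F)).

Let theta_gt0 : 0 < theta. Proof. by case/andP: htheta. Qed.
Let theta_lt1 : theta < 1. Proof. by case/andP: htheta. Qed.
Let theta1_gt0 : 0 < 1 - theta. Proof. by rewrite subr_gt0. Qed.
Let b_gt0 : 0 < b. Proof. exact: lt_le_trans b_ge1. Qed.
Let q_gt0 : 0 < q%:R :> R. Proof. by rewrite ltr0n ltnW. Qed.

Let w_ge2 : 2 <= w.
Proof.
rewrite -[2]mulr1; apply: ler_pM => //; first by rewrite ler_nat.
by rewrite -[leLHS]expR0 ler_expR mulr_ge0.
Qed.

(** Let l = ln b / |ln theta| and m = floor l + 1. Then m > l gives b theta^m <= 1, and m - 1 <= l
    gives w^(m - 1) <= w^l = b^r0. The remaining M + 1 factors w explain the exponents M + 1 in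
    B. *)
Lemma exponent_exists : exists m, b * theta ^+ m <= 1 /\
  w ^+ (m + M) <= q%:R ^+ M.+1 * expR (2 * M.+1%:R * F) * b `^ r0.
Proof.
have lt0 : 0 < `|ln theta| by rewrite normr_gt0 lt_eqF// ln_lt0.
have ltE : ln theta = - `|ln theta| by rewrite ltr0_norm ?opprK ?ln_lt0.
have lb0 : 0 <= ln b by exact: ln_ge0.
pose l := ln b / `|ln theta|; have l0 : 0 <= l by rewrite divr_ge0// ltW.
have w0 : 0 < w by exact: lt_le_trans w_ge2.
exists (Num.truncn l).+1; split.
  rewrite -[b]lnK ?posrE// -{1}[theta]lnK ?posrE// -expRM_natl -expRD.
  rewrite -[leRHS]expR0 ler_expR ltE mulrN subr_le0 -ler_pdivrMr//.
  by rewrite ltW// truncnS_gt.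
rewrite addSnnS exprD mulrC.
have -> : q%:R ^+ M.+1 * expR (2 * M.+1%:R * F) = w ^+ M.+1.
  by rewrite exprMn -expRM_natr; congr (_ * expR _); ring.
rewrite ler_wpM2l ?exprn_ge0 ?(ltW w0)//.
have -> : b `^ r0 = expR (l * ln w).
  rewrite /powR gt_eqF//; congr expR; rewrite lnM ?posrE ?expR_gt0// expRK /l.
  by field; rewrite gt_eqF.
rewrite -{1}[w]lnK ?posrE// -expRM_natl ler_expR ler_wpM2r//.
  by rewrite ln_ge0//; have := w_ge2; lra.
by rewrite truncn_le.
Qed.

Variable m : nat.
Hypothesis hm : b * theta ^+ m <= 1.
Hypothesis hw : w ^+ (m + M) <= q%:R ^+ M.+1 * expR (2 * M.+1%:R * F) * b `^ r0.
Local Notation n0 := (m + M)%N.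
Local Notation S := (Harnack q M theta F m (cone_slope theta b)).
Local Notation c := (n0%:R * ((1 - theta) / (8 * K ^+ 3))).

Let w_gt0 : 0 < w. Proof. exact: lt_le_trans w_ge2. Qed.
Let wX_gt0 : 0 < w ^+ n0. Proof. by rewrite exprn_gt0. Qed.

Let Q_le (y : R) : 0 <= y -> y * w ^+ n0 <=
  y * (q%:R ^+ M.+1 * expR (2 * M.+1%:R * F) * b `^ r0).
Proof. by move=> y0; rewrite ler_wpM2l. Qed.

Let KE : K = expR (2 * theta / (1 - theta)) * (1 - theta)^-1 *
  (q%:R ^+ M.+1 * expR (2 * M.+1%:R * F) * b `^ r0).
Proof. by rewrite !mulrA; field; rewrite gt_eqF. Qed.

Let K_ge : expR (2 * theta / (1 - theta)) * w ^+ n0 <= K.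
Proof.
apply: le_trans (_ : _ <= expR (2 * theta / (1 - theta)) * (1 - theta)^-1 * w ^+ n0) _.
  rewrite ler_wpM2r ?(ltW wX_gt0)// ler_peMr ?expR_ge0// invf_ge1//.
  by rewrite gerBl ltW.
by rewrite KE Q_le// mulr_ge0 ?expR_ge0// invr_ge0 ltW.
Qed.

Let wX_le_K : w ^+ n0 <= K.
Proof.
apply: (le_trans _ K_ge); rewrite ler_peMl ?(ltW wX_gt0)//.
by rewrite -[leLHS]expR0 ler_expR divr_ge0 ?mulr_ge0// ltW.
Qed.

(** From n < 2^n and w >= 2. *)
Let n0_le_K : n0%:R <= K.
Proof.
apply: (le_trans _ wX_le_K); apply: (@le_trans _ _ (2 ^+ n0)).
  by rewrite -natrX ler_nat ltnW// ltn_expl.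
by apply: lerXn2r; rewrite ?nnegrE// ltW.
Qed.

Lemma K_ge2 : 2 <= K.
Proof.
apply: (le_trans _ wX_le_K); apply: (le_trans w_ge2).
by apply: ler_eXnr; [rewrite addn_gt0 M_gt0 orbT|have := w_ge2; lra].
Qed.

Let K_gt0 : 0 < K. Proof. exact: lt_le_trans K_ge2. Qed.

Lemma rho01 : 0 < rho < 1.
Proof.
have K3 : 1 <= K ^+ 3 by rewrite exprn_ege1//; have := K_ge2; lra.
have d0 : 0 < 8 * K ^+ 3 by move: K3; lra.
have : 0 < (1 - theta) / (8 * K ^+ 3) by rewrite divr_gt0.
have : (1 - theta) / (8 * K ^+ 3) < 1.
  by rewrite ltr_pdivrMr// mul1r; move: K3 theta_gt0; lra.
by move=> h1 h2; apply/andP; split; move: h1 h2; lra.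
Qed.

Let eX4 : expR 1 <= 4 :> R.
Proof.
have h : 1 / 2 <= expR (- (1 / 2)) :> R by have := expR_ge1Dx (- (1 / 2) : R); lra.
have -> : expR 1 = (expR (- (1 / 2)))^-1 ^+ 2 :> R.
  by rewrite -expRN -expRM_natr; congr expR; field.
rewrite exprVn -[leRHS]invrK lef_pV2 ?posrE ?invr_gt0 ?exprn_gt0 ?expR_gt0//.
have := ler_pM (ltac:(lra) : (0 : R) <= 1 / 2) (ltac:(lra) : (0 : R) <= 1 / 2) h h.
by rewrite -expr2; apply: le_trans; lra.
Qed.

(** As b theta^m <= 1, the exponent is at most (1 + theta) / (1 - theta) = 1 + 2 theta / (1 -
    theta), and e <= 4. *)
Lemma Harnack_slope_le : S <= 4 * K.
Proof.
rewrite /Harnack; apply: (@le_trans _ _ (expR 1 * (expR (2 * theta / (1 - theta)) * w ^+ n0))).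
  rewrite mulrA ler_wpM2r ?(ltW wX_gt0)// -expRD ler_expR.
  apply: (@le_trans _ _ ((1 + theta) / (1 - theta))); last first.
    by rewrite le_eqVlt; apply/orP; left; apply/eqP; field; rewrite gt_eqF.
  rewrite /cone_slope; have := ler_wpM2r (_ : 0 <= (1 + theta) / (1 - theta)) hm.
  rewrite mul1r => /(_ _) h; rewrite (_ : _ * _ = b * theta ^+ m * ((1 + theta) / (1 - theta))); last by ring.
  by apply: h; rewrite divr_ge0 ?(ltW theta1_gt0)//; move: theta_gt0; lra.
by apply: ler_pM => //; rewrite ?mulr_ge0 ?expR_ge0// ltW.
Qed.

(** Here the exponent is at most theta / (1 - theta), half of what K provides. *)
Lemma Harnack_eigenslope_le : Harnack q M theta F m (eigenslope theta b) <= K.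
Proof.
apply: (le_trans _ K_ge); rewrite /Harnack ler_wpM2r ?(ltW wX_gt0)// ler_expR.
rewrite /eigenslope (_ : _ * _ = b * theta ^+ m * (theta / (1 - theta))); last by ring.
have h0 : 0 <= theta / (1 - theta) by rewrite divr_ge0 ?ltW.
apply: le_trans (ler_wpM2r h0 hm) _; rewrite mul1r -mulrA.
by move: h0; lra.
Qed.

Lemma eigenslope_le_K : eigenslope theta b * Harnack q M theta F m (eigenslope theta b)
  <= B * b * K.
Proof.
apply: ler_pM.
- by rewrite /eigenslope divr_ge0 ?mulr_ge0 ?(ltW theta1_gt0)// ltW.
- by rewrite mulr_ge0 ?expR_ge0// ltW.
- rewrite /eigenslope [leRHS]mulrAC ler_wpM2r ?invr_ge0 ?(ltW theta1_gt0)//.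
  rewrite mulrC ler_wpM2r ?(ltW b_gt0)//; apply: (le_trans (ltW theta_lt1)).
  have e1 : 1 <= expR (2 * theta / (1 - theta)).
    by rewrite -[leLHS]expR0 ler_expR divr_ge0 ?mulr_ge0// ltW.
  have e2 : 1 <= q%:R ^+ M.+1 :> R by rewrite exprn_ege1// ler1n ltnW.
  have e3 : 1 <= expR (2 * M.+1%:R * F) by rewrite -[leLHS]expR0 ler_expR !mulr_ge0.
  by do 2!apply: mulr_ege1 => //.
- exact: Harnack_eigenslope_le.
Qed.

Lemma contraction_gt0 : 0 < c.
Proof.
have K3 : 0 < K ^+ 3 by rewrite exprn_gt0.
apply: mulr_gt0; first by rewrite ltr0n addn_gt0 M_gt0 orbT.
by rewrite divr_gt0// mulr_gt0.
Qed.

(** By S <= 4 K and N <= K, 2 S N <= 8 K^2 <= 8 K^3, the denominator in rho. *)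
Lemma contraction_le : 2 * S * c <= 1 - theta.
Proof.
have K3 : 0 < K ^+ 3 by rewrite exprn_gt0.
rewrite (_ : _ * _ = 2 * (S * n0%:R) * (1 - theta) / (8 * K ^+ 3)); last by ring.
rewrite ler_pdivrMr; last by rewrite mulr_gt0.
rewrite [leLHS]mulrC ler_wpM2l ?(ltW theta1_gt0)//.
have S0 : 0 <= S by rewrite mulr_ge0 ?expR_ge0// ltW.
have h := ler_pM S0 (ler0n R n0) Harnack_slope_le n0_le_K.
apply: (@le_trans _ _ (2 * (4 * K * K))); first by rewrite ler_wpM2l.
rewrite (_ : 2 * _ = 8 * K ^+ 2); last by ring.
rewrite ler_wpM2l// ler_eXn2l//; have := K_ge2; lra.
Qed.

(** Bernoulli gives 1 - c <= rho^N, and the n mod N leftover steps cost at most a factor 2 because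
    rho^N >= 1/2. The constants multiply to 144 K b / (1 - theta), where 144 = 3 . 6 . 4 . 2, and
    K^4 >= 16 brings this below D. *)
Lemma contraction_rate n : 3 * ((1 + 2 * cone_slope theta b) * S) * (1 - c) ^+ (n %/ n0)
  <= D * rho ^+ n.
Proof.
have /andP[r0 r1] := rho01.
have N0 : (0 < n0)%N by rewrite addn_gt0 M_gt0 orbT.
have S0 : 0 <= S by rewrite mulr_ge0 ?expR_ge0// ltW.
have K3 : 0 < K ^+ 3 by rewrite exprn_gt0.
have Ki : 0 < (1 - theta) / (8 * K ^+ 3) by rewrite divr_gt0// mulr_gt0.
have bern : 1 - c <= rho ^+ n0 by apply: bernoulli_ineq; apply/andP; split; move: r0 Ki; lra.
have chalf : c <= 1 / 2.
  have K2 : 2 ^+ 2 <= K ^+ 2 by apply: lerXn2r; rewrite ?nnegrE ?K_ge2// ltW.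
  rewrite mulrA ler_pdivrMr; last by rewrite mulr_gt0.
  apply: (@le_trans _ _ (K * 1)).
    by apply: ler_pM; rewrite ?ler0n ?(ltW theta1_gt0)//; move: theta_gt0; lra.
  have halfE (k : R) : 1 / 2 * (8 * k ^+ 3) = k * (4 * k ^+ 2) by field.
  rewrite halfE.
  by rewrite ler_wpM2l ?(ltW K_gt0)//; move: K2; lra.
have c1 : 0 <= 1 - c by move: chalf; lra.
have rhoN : 1 / 2 <= rho ^+ n0 by move: bern chalf; lra.
have powle : (1 - c) ^+ (n %/ n0) <= 2 * rho ^+ n.
  rewrite {2}(divn_eq n n0) exprD mulnC exprM.
  have h1 : (1 - c) ^+ (n %/ n0) <= (rho ^+ n0) ^+ (n %/ n0).
    by apply: lerXn2r; rewrite ?nnegrE// exprn_ge0// ltW.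
  have h2 : 1 <= 2 * rho ^+ (n %% n0).
    have : rho ^+ n0 <= rho ^+ (n %% n0).
      by apply: ler_wiXn2l; rewrite ?(ltW r0) ?(ltW r1)// ltnW// ltn_pmod.
    by move: rhoN; lra.
  by apply: (le_trans h1); rewrite [leRHS]mulrCA ler_peMr// exprn_ge0// exprn_ge0// ltW.
apply: (@le_trans _ _ (3 * ((6 * b / (1 - theta)) * (4 * K)) * (2 * rho ^+ n))).
  have a1 : 1 + 2 * cone_slope theta b <= 6 * b / (1 - theta).
    rewrite /cone_slope ler_pdivlMr//.
    rewrite [leLHS](_ : _ = (1 - theta) + 2 * (b * (1 + theta))); last first.
      by field; rewrite gt_eqF.
    have := ler_wpM2r (ltW theta1_gt0) b_ge1; have := ler_wpM2l (ltW b_gt0) (ltW theta_lt1).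
    have := mulr_ge0 (ltW b_gt0) (ltW theta_gt0); have := b_gt0; lra.
  have a0 : 0 <= 1 + 2 * cone_slope theta b.
    have : 0 <= cone_slope theta b.
      by rewrite divr_ge0 ?mulr_ge0 ?(ltW theta1_gt0) ?(ltW b_gt0)//; move: theta_gt0; lra.
    lra.
  apply: ler_pM => //; rewrite ?exprn_ge0 ?mulr_ge0//.
  by rewrite ler_wpM2l//; apply: ler_pM => //; exact: Harnack_slope_le.
rewrite [leLHS]mulrA ler_wpM2r ?exprn_ge0 ?(ltW r0)//.
rewrite (_ : _ * 2 = (144 * K * b) / (1 - theta)); last by ring.
rewrite ler_wpM2r ?invr_ge0 ?(ltW theta1_gt0)//.
have K4 : 2 ^+ 4 <= K ^+ 4 by apply: lerXn2r; rewrite ?nnegrE ?K_ge2// ltW.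
apply: ler_pM; [by move: K_gt0; lra|exact: ltW| |by rewrite ler_eXnr].
by rewrite [K ^+ 5]exprSr [leRHS]mulrA ler_wpM2r ?(ltW K_gt0)//; move: K4; lra.
Qed.

End Constants.

(** The other measure is tested on h, whose integral is positive because k h >= 1; this integral is
    scaled by lam' on one side and by lam on the other. *)
Lemma dual_eigenvalue_unique (R : realType) (q : nat) (A : 'M[nat]_q) (x0 : SFT A)
    (f : SFT A -> R) (P : probability (borel_SFT x0) R) (lam lam' k : R) h :
  dual_eigenmeasure f lam' P -> continuous h -> transfer f h = (fun x => lam * h x) ->
  0 < k -> (forall x, 1 <= k * h x) -> lam' = lam.
Proof.
move=> dual h_cont h_eq k_gt0 h_lower.
have cst_cont (c : R) : continuous (fun _ : SFT A => c) by move=> x; exact: cst_continuous.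
have scale c : \int[P]_x (c * h x) = c * \int[P]_x h x.
  rewrite -[RHS]addr0 -[X in _ + X](integral_cst P) -integral_lin//.
  by congr Rintegral; apply/funext => x; rewrite addr0.
have int_gt0 : 0 < \int[P]_x h x.
  rewrite -(pmulr_rgt0 _ k_gt0) -scale; apply: lt_le_trans ltr01 _.
  by rewrite -(integral_cst P 1); apply: integral_le => //; exact: continuousZ_SFT.
have := dual _ h_cont; rewrite h_eq scale => /eqP.
by rewrite eq_sym (inj_eq (mulIf _)) ?(gt_eqF int_gt0)// => /eqP.
Qed.

(** * Assembly of the statement *)

Section Conclusion.
Variables (R : realType) (q : nat) (A : 'M[nat]_q) (M : nat) (theta : R).
Variables (f : SFT A -> R) (b F : R) (m : nat).
Implicit Types (g u : SFT A -> R) (t c e a : R).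
Hypothesis H : ruelle_data M theta f b F m.

Let q_gt0 := ltnW (rd_q H).
Let htheta := rd_theta H.

Variables (x0 : SFT A) (c : R).
Hypothesis c_gt0 : 0 < c.
Hypothesis hc : 2 * Harnack q M theta F m (cone_slope theta b) * c <= 1 - theta.
Local Notation L := (transfer f).
Local Notation LC := (complexify L).
Local Notation bdd := (bdd_lip theta).
Local Notation E := (complex_Ftheta (A := A) theta).
Local Notation lam := (eigenvalue f x0).
Local Notation h := (eigenfunction f x0).
Local Notation K0 := (Harnack q M theta F m (eigenslope theta b)).

Let theta_gt0 : 0 < theta. Proof. by case/andP: htheta. Qed.
Let lam_gt0 : 0 < lam. Proof. exact: (eigenvalue_gt0 H). Qed.

Lemma essential_spectral_radiusE : essential_spectral_radius E LC = (theta * lam)%:E.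
Proof.
have K0_gt0 : 0 < K0 by rewrite mulr_gt0 ?expR_gt0// exprn_gt0// mulr_gt0 ?expR_gt0// ltr0n.
have h_eq := eigenfunction_eq H x0 c_gt0 hc.
have h_lower := eigenfunction_lower H x0 c_gt0 hc.
have h_upper := eigenfunction_upper H x0 c_gt0 hc.
have h_cone : exists a, 0 <= a /\ cone theta a h.
  by exists (eigenslope theta b); split; [exact: (eigenslope_ge0 H)|exact: (eigenfunction_cone H x0 c_gt0 hc)].
have [th h_bdd] := eigenfunction_bdd H x0 c_gt0 hc.
apply/eqP; rewrite eq_le; apply/andP; split.
  apply: ge_ereal_sup => _ [z nz <-]; rewrite lee_fin leNgt; apply/negP => zl.
  exact: nz (fredholm_outside H x0 lam_gt0 h_cone h_eq h_upper h_lower zl).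
apply/lee_subgt0Pr => e e0; rewrite -EFinB.
(* Eigenvalues are available only at positive t; when theta lambda - e is not positive, theta lambda
   / 2 serves instead. *)
have [tl|tl] := ltP 0 (theta * lam - e); last first.
  have tl2 : 0 < theta * lam / 2 by rewrite divr_gt0// mulr_gt0.
  apply: (@le_trans _ _ (theta * lam / 2)%:E); first by rewrite lee_fin (le_trans tl)// ltW.
  apply: ereal_sup_ubound; exists (real_complex R (theta * lam / 2)).
    apply: (essential_spectrum_inside H x0 lam_gt0 h_bdd h_eq K0_gt0 h_lower tl2).
    by move: tl2; lra.
  by rewrite cabs_real gtr0_norm.
apply: ereal_sup_ubound; exists (real_complex R (theta * lam - e)).
  by apply: (essential_spectrum_inside H x0 lam_gt0 h_bdd h_eq K0_gt0 h_lower tl); rewrite gtrBl.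
by rewrite cabs_real gtr0_norm.
Qed.

Variables (D rho : R).
Hypothesis gap : forall n t g, bdd t g ->
  bdd (D * rho ^+ n * t) (fun x => normalized f x0 n g x - h x * eigenfunctional f x0 g).

Lemma iterate_decay n (g : SFT A -> R) : Ftheta rabs theta g ->
  (theta_norm rabs theta
    (fun x => iter n L g x - lam ^+ n * h x * eigenfunctional f x0 g)%R
    <= (D * lam ^+ n * rho ^+ n)%:E * theta_norm rabs theta g)%E.
Proof.
move=> hg.
have rabs_ge0 (v : R) : 0 <= rabs v by exact: normr_ge0.
have [s [t [s0 t0 gs gt [-> _ _]]]] := Ftheta_elim x0 theta_gt0 rabs_ge0 hg.
have bg : bdd (s + t) g by exists s, t.
have := bdd_lipZ (lam ^+ n) (gap n bg).
have -> : (fun x => lam ^+ n * (normalized f x0 n g x - h x * eigenfunctional f x0 g)) =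
    (fun x => iter n L g x - lam ^+ n * h x * eigenfunctional f x0 g).
  apply/funext => x; rewrite mulrBr [X in _ - X]mulrA /normalized mulrA divff ?mul1r//.
  by rewrite expf_neq0// gt_eqF.
move=> [s1 [t1 [h1 h2 _ _ h3]]]; apply: (le_trans (theta_norm_le theta_gt0 h1 h2)).
rewrite -EFinM lee_fin; apply: (le_trans h3).
rewrite ger0_norm; last by rewrite exprn_ge0// ltW.
by rewrite le_eqVlt; apply/orP; left; apply/eqP; ring.
Qed.

End Conclusion.

Theorem theorem2p1 (R : realType) (q : nat) (hq : (2 <= q)%N)
  (A : 'M[nat]_q) (hA : forall i j, A i j = 0%N \/ A i j = 1%N)
  (M : nat) (hM : (1 <= M)%N) (hAM : forall i j, (0 < (A ^+ M) i j)%N)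
  (theta : R) (htheta : 0 < theta < 1)
  (f : SFT A -> R) (hf : Ftheta rabs theta f) :
  let x0 := sft_point hq hA hM hAM in
  let f_theta := fine (theta_seminorm rabs theta f) in
  let f_sup := fine (sup_norm rabs f) in
  let b := Num.max 1 f_theta in
  let B := expR (2 * theta / (1 - theta)) * q%:R ^+ M.+1
           * expR (2 * M.+1%:R * f_sup) / (1 - theta) in
  let r0 := (ln q%:R + 2 * f_sup) / `|ln theta| in
  let K := B * b `^ r0 in
  let rho : R := 1 - (1 - theta) / (8 * K ^+ 3) in
  let D := 100 * K ^+ 5 * b ^+ 3 / (1 - theta) in
  let E := complex_Ftheta (A := A) theta in
  let N := complex_theta_norm (A := A) theta in
  let L := complexify (transfer f) in
  exists (lambda : R) (nu : probability (borel_SFT x0) R) (h : SFT A -> R),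
    (* (a) *)
    [/\ rpf_data theta f lambda nu h,
        forall (lambda' : R) (nu' : probability (borel_SFT x0) R)
          (h' : SFT A -> R), rpf_data theta f lambda' nu' h' ->
          lambda' = lambda,
        spectral_radius E N L = lambda%:E,
        essential_spectral_radius E L = (theta * lambda)%:E &
        (forall x, K^-1 <= h x <= K) /\
        (theta_seminorm rabs theta h <= (B * b * K)%:E)%E] /\
    (* (b) *)
    (exists nuhat : probability (borel_SFT x0) R,
       has_density h nu nuhat /\ shift_invariant nuhat) /\
    (* (c) *)
    [/\ spectrum E N L `&` [set z | cabs z = lambda]
          = [set real_complex R lambda],
        simple_eigenvalue E L (real_complex R lambda),
        0 < rho < 1 &
        forall z, spectrum E N L z -> cabs z < lambda ->
          cabs z <= rho * lambda] /\
    (* (d) *)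
    (forall g : SFT A -> R, Ftheta rabs theta g -> forall n : nat,
       (theta_norm rabs theta
          (fun x => iter n (transfer f) g x
                    - lambda ^+ n * h x * \int[nu]_y g y)%R
        <= (D * lambda ^+ n * rho ^+ n)%:E * theta_norm rabs theta g)%E).
Proof.
move=> x0 f_theta f_sup b B r0 K rho D E N L.
have theta0 : 0 < theta by case/andP: htheta.
have rabs_ge0 (v : R) : 0 <= rabs v by exact: normr_ge0.
have [s [F [s0 F0 fs fF [_ sE FE]]]] := Ftheta_elim x0 theta0 rabs_ge0 hf.
have fthetaE : f_theta = s by rewrite /f_theta sE.
have fsupE : f_sup = F by rewrite /f_sup FE.
have F_ge0 : 0 <= f_sup by rewrite fsupE.
have b1 : 1 <= b by rewrite le_max lexx.
have f_lip : lip_le rabs theta b f.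
  move=> k x y xy; apply: (le_trans (fs _ _ _ xy)).
  by rewrite ler_wpM2r ?exprn_ge0 ?(ltW theta0)// le_max fthetaE lexx orbT.
have f_bound : sup_le rabs f_sup f by rewrite fsupE.
have [m [hm hw]] := exponent_exists M hq htheta b1 F_ge0.
have H : ruelle_data M theta f b f_sup m by [].
have c0 := contraction_gt0 hq hM htheta F_ge0 hw.
have hc := contraction_le hq hM htheta F_ge0 hm hw.
have rate := contraction_rate hq hM htheta b1 F_ge0 hm hw.
have rho_01 : 0 < rho < 1 := rho01 hq hM htheta F_ge0 hw.
have K2 : 2 <= K := K_ge2 hq hM htheta F_ge0 hw.
have K0K : Harnack q M theta f_sup m (eigenslope theta b) <= K :=
  Harnack_eigenslope_le hq htheta F_ge0 hm hw.
have aK : eigenslope theta b * Harnack q M theta f_sup m (eigenslope theta b) <= B * b * K :=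
  eigenslope_le_K hq htheta b1 F_ge0 hm hw.
rewrite -/r0 -/B -/K in c0 hc rate.
set c := _ * _ in c0 hc rate.
rewrite -/rho -/D in rate.
have K_gt0 : 0 < K by exact: lt_le_trans K2.
have D0 : 0 <= D.
  rewrite /D divr_ge0//; last by rewrite subr_ge0 ltW//; case/andP: htheta.
  apply: mulr_ge0; last by rewrite exprn_ge0// (le_trans ler01 b1).
  by apply: mulr_ge0 => //; rewrite exprn_ge0// ltW.
have gap n t g : bdd_lip theta t g -> bdd_lip theta (D * rho ^+ n * t)
    (fun x => normalized f x0 n g x - eigenfunction f x0 x * eigenfunctional f x0 g).
  move=> hg; apply: bdd_lip_le (spectral_gap H x0 c0 hc n hg).
  have swap (u v w y : R) : u * v * w * y = u * w * y * v by ring.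
  by rewrite [leLHS]swap; apply: ler_wpM2r (rate n); exact: bdd_lip_ge0 hg.
have lam0 : 0 < eigenvalue f x0 := eigenvalue_gt0 H x0.
have [nu hnu] := eigenmeasure_exists H x0.
have [th h_bdd] := eigenfunction_bdd H x0 c0 hc.
have h_cont := bdd_continuous H h_bdd.
have h_eq := eigenfunction_eq H x0 c0 hc.
have h_lip := eigenfunction_lip H x0 c0 hc.
have h_low x : 1 <= K * eigenfunction f x0 x.
  apply: le_trans (eigenfunction_lower H x0 c0 hc x) _; rewrite ler_wpM2r//.
  by case: (eigenfunction_cone H x0 c0 hc).
have h_up x : eigenfunction f x0 x <= K.
  exact: le_trans (eigenfunction_upper H x0 c0 hc x) K0K.
have h_gt0 x : 0 < eigenfunction f x0 x.
  by have := lt_le_trans ltr01 (h_low x); rewrite pmulr_rgt0.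
have nu_dual : dual_eigenmeasure f (eigenvalue f x0) nu.
  by move=> g; exact: (integral_transfer H hnu).
have h_int : \int[nu]_x eigenfunction f x0 x = 1.
  by rewrite (integral_nu H hnu h_bdd) (nu_eigenfunction H x0 c0 hc).
exists (eigenvalue f x0), nu, (eigenfunction f x0); split; last split; last split.
- split.
  + split => //; last by move=> x; rewrite h_eq.
    split => //; apply: (Ftheta_intro theta0 h_lip (t := K)) => x.
    by rewrite /rabs gtr0_norm.
  + move=> lam' nu' h' [_ dual' _ _ _].
    exact: (dual_eigenvalue_unique dual' h_cont h_eq K_gt0 h_low).
  + exact: (spectral_radiusE H c0 hc rho_01 D0 gap).
  + exact: (essential_spectral_radiusE H x0 c0 hc).
  + split.
      by move=> x; rewrite h_up andbT -div1r ler_pdivrMr// mulrC.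
    by apply/theta_seminorm_leP => // k x y /h_lip /le_trans; apply; rewrite ler_wpM2r// exprn_ge0// ltW.
- by apply: (density_probability h_cont _ h_int lam0 nu_dual h_eq) => x; exact: ltW.
- split => //.
  + exact: (spectrum_circle H c0 hc rho_01 D0 gap).
  + exact: (eigenvalue_simple H c0 hc rho_01 D0 gap).
  + move=> z; exact: (spectrum_gap H c0 hc rho_01 D0 gap).
- move=> g hg n; have [s' [t' [s'0 t'0 gs gt _]]] := Ftheta_elim x0 theta0 rabs_ge0 hg.
  have bg : bdd_lip theta (s' + t') g by exists s', t'.
  rewrite (integral_nu H hnu bg).
  exact: (iterate_decay H gap).
Qed.
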